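(* Let $K=\mathbb{Q}(\sqrt2)$, let $\zeta_K$ be its Dedekind zeta function, let $\mathcal{A}\subset\mathbb{R}^2$ be the Ammann-Beenker point set and let $\mathcal{A}'=\sqrt2\,\mathcal{A}$. Then $$\theta(\widehat{\mathcal{A}'})=\frac{1}{2\zeta_K(2)},\qquad\text{hence}\qquad \theta(\widehat{\mathcal{A}})=\frac{1}{\zeta_K(2)}.$$
   Context: Density: a locally finite set $\mathcal{P}\subset\mathbb{R}^d$ has (asymptotic) density $\theta(\mathcal{P})$ if $\lim_{R\to\infty}\frac{\#(\mathcal{P}\cap RD)}{\mathrm{vol}(RD)}=\theta(\mathcal{P})$ for all Jordan measurable $D\subset\mathbb{R}^d$ with $\mathrm{vol}(D)>0$ (Jordan measurable: bounded with boundary of Lebesgue measure zero). An equality for $\theta(\mathcal{P})$ includes the claim that the density exists. The set of visible points of $\mathcal{P}$ is $\widehat{\mathcal{P}}=\{x\in\mathcal{P}\mid tx\notin\mathcal{P}\ \forall t\in(0,1)\}$. Let $K=\mathbb{Q}(\sqrt2)\subset\mathbb{R}$ with ring of integers $\mathcal{O}_K=\mathbb{Z}[\sqrt2]$ and algebraic conjugation $x\mapsto\overline{x}$ ($\sqrt2\mapsto-\sqrt2$), applied coordinatewise to vectors: $\overline{(x_1,x_2)}=(\overline{x_1},\overline{x_2})$. Let $W_8\subset\mathbb{R}^2$ be the closed (solid) regular octagon of side length $1$ centered at the origin, with sides perpendicular to the coordinate axes (i.e. four of its sides are perpendicular to a coordinate axis), and let $\mathcal{W}_{\mathcal{A}}=\sqrt2\,W_8$.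 Put $$\mathcal{A}'=\{x=(x_1,x_2)\in\mathcal{O}_K^2\mid (x_1-x_2)/\sqrt2\in\mathcal{O}_K,\ \overline{x}\in\mathcal{W}_{\mathcal{A}}\}\subset\mathbb{R}^2.$$ The Ammann-Beenker point set is $\mathcal{A}=\frac{1}{\sqrt2}\mathcal{A}'$. *)

(* Defs.v *)
(* MathComp-Analysis, over an arbitrary [R : realType]. *)
From HB Require Import structures.
From mathcomp Require Import all_boot all_order all_algebra.
From mathcomp Require Import finmap all_classical all_reals all_analysis.

Set Implicit Arguments.
Unset Strict Implicit.
Unset Printing Implicit Defensive.

Import Order.TTheory GRing.Theory Num.Theory.
Import numFieldNormedType.Exports.

Local Open Scope classical_set_scope.
Local Open Scope ring_scope.

Section plane.
Variable R : realType.
Implicit Types (P D : set (R * R)) (r : R).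

(* [mu_ext] makes this the Lebesgue measure of every Lebesgue measurable set:
   the product measure alone is only meaningful on Borel sets, and a Jordan
   measurable set need not be Borel. *)
Definition area D : \bar R :=
  mu_ext (@lebesgue_measure R \x @lebesgue_measure R)%E D.

Definition boundary D : set (R * R) := closure D `\` interior D.

Definition jordan_measurable D : Prop :=
  bounded_set D /\ area (boundary D) = 0%E.

Definition dilate r D : set (R * R) := [set (r * x.1, r * x.2) | x in D].

Definition locally_finite P : Prop :=
  forall B : set (R * R), bounded_set B -> finite_set (P `&` B).

Definition has_density P (theta : R) : Prop :=
  locally_finite P /\
  forall D, jordan_measurable D -> (0 < area D)%E ->
    (#|` fset_set (P `&` dilate r D)|)%:R / fine (area (dilate r D))
      @[r --> +oo] --> theta.

Definition visible P : set (R * R) :=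
  [set x | P x /\ forall t : R, 0 < t < 1 -> ~ P (t * x.1, t * x.2)].

End plane.

Section number_field.
Variable R : realType.
Implicit Types (K O I : set R) (s : R).

Definition ring_of_integers K : set R :=
  [set x | K x /\ integralOver (intr : int -> R) x].

Definition is_ideal O I : Prop :=
  [/\ I `<=` O, I 0, forall x y, I x -> I y -> I (x + y) &
      forall a x, O a -> I x -> I (a * x)].

(* The number of cosets x + I, x in O; nonzero ideals of a ring of integers
   have finitely many. *)
Definition ideal_norm O I : nat :=
  #|` fset_set [set [set x + y | y in I] | x in O]|.

(* The Dirichlet series, which defines zeta_K(s) for s > 1. *)
Definition dedekind_zeta K s : R :=
  let O := ring_of_integers K in
  fine (\esum_(I in [set I | is_ideal O I /\ I <> [set 0]])
          ((ideal_norm O I)%:R `^ (- s))%:E).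

End number_field.

Section ammann_beenker.
Variable R : realType.

Definition sqrt2 : R := Num.sqrt 2.

Definition Qsqrt2 : set R :=
  [set x | exists a b : rat, x = ratr a + ratr b * sqrt2].

Definition OK : set R := ring_of_integers Qsqrt2.

(* The conjugation of Q(sqrt 2); its value outside Q(sqrt 2) is irrelevant. *)
Definition conjK (x : R) : R :=
  xget 0 [set y | exists a b : rat,
    x = ratr a + ratr b * sqrt2 /\ y = ratr a - ratr b * sqrt2].

(* The eight half-planes have outer normals at the multiples of 45 degrees, and
   1 / (2 tan (pi / 8)) is the apothem of a regular octagon of side 1. *)
Definition octagon : set (R * R) :=
  [set x | forall k : 'I_8,
    x.1 * cos (k%:R * (pi / 4)) + x.2 * sin (k%:R * (pi / 4))
      <= 1 / (2 * tan (pi / 8))].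

Definition windowA : set (R * R) := dilate sqrt2 octagon.

Definition ammann_beenker' : set (R * R) :=
  [set x | [/\ OK x.1, OK x.2, OK ((x.1 - x.2) / sqrt2) &
               windowA (conjK x.1, conjK x.2)]].

Definition ammann_beenker : set (R * R) := dilate sqrt2^-1 ammann_beenker'.

End ammann_beenker.

Arguments Qsqrt2 : clear implicits.
Arguments ammann_beenker' : clear implicits.
Arguments ammann_beenker : clear implicits.

(* Main.v *)
(* Write lam = 1 + sqrt2, let W be the window and L the lattice of the x in
   O_K^2 with (x1 - x2) / sqrt2 in O_K.  O_K is Euclidean, so every nonzero x
   in L is d y with y unimodular and d unique once it is normalised modulo
   units.  Since an h in O_K with 0 < h < 1 has |conj h| >= lam, and since for a
   nonunit d some unit u has |u| < |d| and |conj u| <= |conj d|, a point x of A'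
   is visible iff it is unimodular and conj x is not in W / lam.

   Let T(r, s) and p(r, s) count the x in L, respectively the unimodular x in L,
   with x in r D and conj x in s (W \ W / lam).  Equidistribution of the ring
   O_K in strips gives T(r, s) ~ area(D) (r s)^2 / 2.  As
     T(r, s) = sum_d p(r / d, s / conj d)
   over the normalised d, and as p(r, s) <= K (r s)^2 uniformly (multiply by
   units), an asymptotic relative error e for p ~ area(D) (r s)^2 / (2 zeta_K(2))
   improves to (zeta_K(2) - 1) e.  Now zeta_K(2) <= 11/6 < 2, so the error
   vanishes: neither an Euler product nor Moebius inversion is needed. *)
Require Import Defs.
From mathcomp Require Import all_boot all_order all_algebra all_field.
From mathcomp Require Import finmap all_classical all_reals all_analysis.
From mathcomp Require Import ring lra zify.

Set Implicit Arguments.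
Unset Strict Implicit.
Unset Printing Implicit Defensive.

Import Order.TTheory GRing.Theory Num.Theory.
Import numFieldNormedType.Exports.

Local Open Scope classical_set_scope.
Local Open Scope ring_scope.

(** * The ring of integers Z[sqrt2] *)

Section zsqrt2.
Variable R : realType.
Local Notation s2 := (sqrt2 R).
Local Notation OKR := (@OK R).

(** The asymptotic for p is obtained for each fixed s, with a threshold in r that depends on s and
    on the error wanted, while the number of d in the decomposition grows with r. The sum over d is
    therefore cut: finitely many d use the error already reached at s / conj d, and the others use
    the uniform bound, their total weight being a tail of the zeta series. The uniform bound
    survives small r because a nonzero element of O_K has norm at least 1 in absolute value: once s
    is normalised by units, either the count is zero or r is bounded below, and the boundary terms
    are absorbed. The d are normalised so that conj d >= 1, which keeps s / conj d <= 1 throughout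
    the recursion. The factor 1/2 in T is 8/16: under x -> (x, conj x) the lattice L has covolume 16
    in R^4, and W minus W / lam has area 8. The bound 11/6 is 1 + 1/2 + 1/3: exactly a of the
    normalised d have rational part a, each of norm at least a^2 / 2, so they contribute at most 4 /
    a^3, which is 1/2 for a = 2 and sums to at most 1/3 over a >= 3. *)

Lemma sqrt2_sqr : s2 * s2 = 2.
Proof. by rewrite -expr2 sqr_sqrtr // ler0n. Qed.

Lemma sqrt2_gt0 : 0 < s2.
Proof. by rewrite sqrtr_gt0 ltr0n. Qed.

Lemma sqrt2_neq0 : s2 != 0.
Proof. by rewrite gt_eqF // sqrt2_gt0. Qed.

Lemma sqrt2_bounds : 141 / 100 < s2 < 142 / 100.
Proof.
have := sqrt2_sqr; have := sqrt2_gt0 => h0 h.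
by apply/andP; split; nra.
Qed.

(** Parity of the 2-adic valuation: even on the left, odd on the right unless n = 0. *)
Lemma nat_sqr_2sqr (m n : nat) : (m * m = 2 * (n * n))%N -> n = 0%N.
Proof.
case: n => // n h; exfalso.
have m0 : (0 < m)%N by case: m h => //; lia.
have := congr1 (logn 2) h.
rewrite lognM // lognM ?muln_gt0 // lognM //.
have -> : logn 2 2 = 1%N by [].
lia.
Qed.

Lemma int_sqr_2sqr (m n : int) : m * m = 2 * (n * n) -> m = 0 /\ n = 0.
Proof.
move=> h.
have n0 : n = 0.
  have := @nat_sqr_2sqr `|m|%N `|n|%N.
  by have := congr1 absz h; rewrite !abszM; lia.
split=> //; move: h; rewrite n0; nia.
Qed.

Lemma rat_sqr_2sqr (p q : rat) : p * p = 2 * (q * q) -> p = 0 /\ q = 0.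
Proof.
move=> h.
have dp : (denq p)%:~R != 0 :> rat by rewrite intr_eq0 denq_eq0.
have dq : (denq q)%:~R != 0 :> rat by rewrite intr_eq0 denq_eq0.
have := @int_sqr_2sqr (numq p * denq q) (numq q * denq p).
have -> : numq p * denq q * (numq p * denq q) =
   2 * (numq q * denq p * (numq q * denq p)).
  apply: (@intr_inj rat); rewrite !(rmorphM, rmorphD) /=.
  move: h; rewrite -{1 2}(divq_num_den p) -{1 2}(divq_num_den q).
  set a := (numq p)%:~R; set b := (numq q)%:~R.
  set c := (denq p)%:~R in dp *; set d := (denq q)%:~R in dq * => h.
  have -> : a * d * (a * d) = (a / c * (a / c)) * (c * c * d * d) by field.
  by rewrite h; field; rewrite ?dq ?dp.
case=> // /eqP; rewrite mulf_eq0 denq_eq0 orbF => /eqP p0.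
move=> /eqP; rewrite mulf_eq0 denq_eq0 orbF => /eqP q0.
by split; apply/eqP; rewrite -numq_eq0 ?p0 ?q0.
Qed.

Lemma Qsqrt2_inj (a b c d : rat) :
  ratr a + ratr b * s2 = ratr c + ratr d * s2 -> a = c /\ b = d.
Proof.
move=> h.
have e : ratr (a - c) = ratr (d - b) * s2 :> R.
  rewrite !rmorphB /=; nra.
have : (a - c) * (a - c) = 2 * ((d - b) * (d - b)).
  apply: (fmorph_inj (@ratr R)); rewrite !rmorphM /= e.
  rewrite mulrACA sqrt2_sqr rmorph_nat; ring.
by move/rat_sqr_2sqr => [/eqP + /eqP]; rewrite !subr_eq0 => /eqP -> /eqP ->.
Qed.

Lemma conjKE (a b : rat) : conjK (ratr a + ratr b * s2) = ratr a - ratr b * s2.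
Proof.
rewrite /conjK; case: xgetP => [y _ /= [a' [b' [/Qsqrt2_inj[-> ->]]]]//|].
by move/(_ (ratr a - ratr b * s2)) => /= []; exists a, b.
Qed.

Definition zs (a b : int) : R := a%:~R + b%:~R * s2.

Lemma conjK_zs a b : conjK (zs a b) = a%:~R - b%:~R * s2.
Proof. by rewrite /zs -!(@ratr_int R) conjKE. Qed.

Lemma conjK_zsN a b : conjK (zs a b) = zs a (- b).
Proof. by rewrite conjK_zs /zs rmorphN mulNr. Qed.

Lemma zs_inj a b c d : zs a b = zs c d -> a = c /\ b = d.
Proof.
by rewrite /zs -!(@ratr_int R) => /Qsqrt2_inj [/intr_inj -> /intr_inj ->].
Qed.

Lemma zsM a b c d : zs a b * zs c d = zs (a * c + 2 * (b * d)) (a * d + b * c).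
Proof.
rewrite /zs !(rmorphD, rmorphM, rmorph_nat) /=.
have := sqrt2_sqr; set s := s2 => h.
transitivity (a%:~R * c%:~R + s * s * (b%:~R * d%:~R) +
  (a%:~R * d%:~R + b%:~R * c%:~R) * s); first by ring.
by rewrite h.
Qed.

Lemma zsD a b c d : zs a b + zs c d = zs (a + c) (b + d).
Proof. by rewrite /zs !rmorphD /=; ring. Qed.

Lemma zsN a b : - zs a b = zs (- a) (- b).
Proof. by rewrite /zs !rmorphN /=; ring. Qed.

(** The polynomial is pulled back to [rat] along the injective [ratr] and pushed on to [algC], where
    rational algebraic integers are known to be integers. *)
Lemma ratr_integral (t : rat) :
  integralOver (intr : int -> R) (ratr t) -> exists n : int, t = n%:~R.
Proof.
case=> p pm rp.
have rr : root (map_poly (intr : int -> rat) p) t.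
  rewrite -(fmorph_root (@ratr R)) -map_poly_comp.
  by rewrite (eq_map_poly (g := intr)) // => i /=; rewrite ratr_int.
have : (ratr t : algC) \in Aint.
  have rc : root (map_poly (intr : int -> algC) p) (ratr t).
    rewrite -(eq_map_poly (f := @ratr algC \o intr)); last first.
      by move=> i /=; rewrite ratr_int.
    by rewrite map_poly_comp fmorph_root.
  apply: (root_monic_Aint rc); first exact: monic_map.
  by apply/polyOverP => i; rewrite coef_map /= rpred_int.
move/(Cint_rat_Aint (Crat_rat t)) => /intrP [n hn]; exists n.
by apply: (fmorph_inj (@ratr algC)); rewrite /= hn ratr_int.
Qed.

(** Evaluation commutes with conjugation. Stated through the coefficients A and B, since [conjK] is
    defined by choice on all of R and is a morphism only on Q(sqrt2). *)
Lemma poly_conj (p : {poly rat}) (a b : rat) : exists A B : rat,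
  (map_poly (@ratr R) p).[ratr a + ratr b * s2] = ratr A + ratr B * s2 /\
  (map_poly (@ratr R) p).[ratr a - ratr b * s2] = ratr A - ratr B * s2.
Proof.
elim/poly_ind: p => [|p c [A [B [h1 h2]]]].
  by exists 0, 0; rewrite rmorph0 !horner0 rmorph0; split; ring.
exists (A * a + 2 * (B * b) + c), (A * b + B * a).
rewrite rmorphD rmorphM /= map_polyX map_polyC /= !hornerE h1 h2.
by rewrite !(rmorphD, rmorphM, rmorph_nat) /= -sqrt2_sqr; split; ring.
Qed.

Lemma integral_conj (a b : rat) :
  integralOver (intr : int -> R) (ratr a + ratr b * s2) ->
  integralOver (intr : int -> R) (ratr a - ratr b * s2).
Proof.
case=> p pm rp; exists p => //.
have [A [B []]] := poly_conj (map_poly intr p) a b.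
rewrite -map_poly_comp (eq_map_poly (g := intr)); last first.
  by move=> i /=; rewrite ratr_int.
rewrite (rootP rp) => h h2.
have [A0 B0] : 0 = A /\ 0 = B.
  by apply: Qsqrt2_inj; rewrite -h rmorph0 mul0r addr0.
by apply/rootP; rewrite h2 -A0 -B0 rmorph0 mul0r subr0.
Qed.

Lemma integral_sqrt2 : integralOver (intr : int -> R) s2.
Proof.
exists ('X^2 - 2%:P); first exact: monicXnsubC.
apply/rootP; rewrite rmorphB /= map_polyXn map_polyC /= !hornerE expr2 sqrt2_sqr.
by rewrite subrr.
Qed.

(** Trace m = 2 a and norm n of an integral element are integers, which first shows only that e = 4
    b is an integer. Parity does the rest: e^2 = 2 (m^2 - 4 n) forces e, m and e / 2 to be even, in
    this order. *)
Lemma OKP x : OKR x <-> exists a b : int, x = zs a b.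
Proof.
split=> [[/= [a [b ->]] hi]|[a [b ->]]]; last first.
  split=> /=; first by exists a%:~R, b%:~R; rewrite !ratr_int.
  apply: integral_add; first exact: (integral_id (intr : int -> R)).
  by apply: integral_mul integral_sqrt2; exact: (integral_id (intr : int -> R)).
have hc := integral_conj hi.
have [m hm] : exists m : int, a + a = m%:~R.
  apply: ratr_integral; have := integral_add hi hc.
  by rewrite addrACA subrr addr0 rmorphD.
have [n hn] : exists n : int, a * a - 2 * (b * b) = n%:~R.
  apply: ratr_integral; have := integral_mul hi hc.
  suff -> : (ratr a + ratr b * s2) * (ratr a - ratr b * s2) =
     ratr (a * a - 2 * (b * b)) by [].
  rewrite rmorphB !rmorphM rmorph_nat /= -sqrt2_sqr; ring.
have h16 : (4 * b) * (4 * b) = (2 * (m * m - 4 * n))%:~R.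
  rewrite rmorphM rmorphB !rmorphM !rmorph_nat /= -hm -hn.
  ring.
have [e he] : exists e : int, 4 * b = e%:~R.
  apply: ratr_integral; exists ('X^2 - (2 * (m * m - 4 * n))%:P).
    exact: monicXnsubC.
  apply/rootP; rewrite rmorphB /= map_polyXn map_polyC /= !hornerE expr2.
  by rewrite -rmorphM /= h16 ratr_int subrr.
have ee : e * e = 2 * (m * m - 4 * n).
  by apply: (@intr_inj rat); rewrite -h16 he rmorphM.
have [f ef] : exists f, e = 2 * f by exists (e %/ 2)%Z; nia.
have [m' em] : exists m', m = 2 * m' by exists (m %/ 2)%Z; nia.
have [f' ff] : exists f', f = 2 * f' by exists (f %/ 2)%Z; nia.
exists m', f'; rewrite /zs -!(@ratr_int R); congr (ratr _ + ratr _ * _).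
  have : (2 * m')%:~R = a + a :> rat by rewrite -em.
  by rewrite rmorphM rmorph_nat /=; lra.
by apply: (@mulfI _ 4) => //; rewrite he ef ff !rmorphM !rmorph_nat /=; ring.
Qed.

End zsqrt2.

(** * Conjugation, norm and Euclidean division in Z[sqrt2] *)

Section arithmetic.
Variable R : realType.
Local Notation s2 := (sqrt2 R).
Local Notation OKR := (@OK R).
Implicit Types x y z d u : R.

Lemma OK_zs a b : OKR (zs R a b).
Proof. by apply/OKP; exists a, b. Qed.

Lemma zs_int n : zs R n 0 = n%:~R.
Proof. by rewrite /zs mul0r addr0. Qed.

Lemma zs01 : zs R 0 1 = s2.
Proof. by rewrite /zs mul1r add0r. Qed.

Lemma OK_int n : OKR n%:~R.
Proof. by rewrite -zs_int; exact: OK_zs. Qed.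

Lemma OK0 : OKR 0. Proof. exact: (OK_int 0). Qed.

Lemma OK1 : OKR 1. Proof. exact: (OK_int 1). Qed.

Lemma OK_sqrt2 : OKR s2.
Proof. by rewrite -zs01; exact: OK_zs. Qed.

Lemma OKD x y : OKR x -> OKR y -> OKR (x + y).
Proof.
move=> /OKP[a [b ->]] /OKP[c [d ->]]; rewrite zsD; exact: OK_zs.
Qed.

Lemma OKN x : OKR x -> OKR (- x).
Proof. by move=> /OKP[a [b ->]]; rewrite zsN; exact: OK_zs. Qed.

Lemma OKB x y : OKR x -> OKR y -> OKR (x - y).
Proof. by move=> hx hy; apply: OKD => //; exact: OKN. Qed.

Lemma OKM x y : OKR x -> OKR y -> OKR (x * y).
Proof.
move=> /OKP[a [b ->]] /OKP[c [d ->]]; rewrite zsM; exact: OK_zs.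
Qed.

Lemma OKX x n : OKR x -> OKR (x ^+ n).
Proof.
move=> hx; elim: n => [|n IHn]; first by rewrite expr0; exact: OK1.
by rewrite exprS; exact: OKM.
Qed.

Lemma OK_conj x : OKR x -> OKR (conjK x).
Proof. by move=> /OKP[a [b ->]]; rewrite conjK_zsN; exact: OK_zs. Qed.

Lemma conjKK x : OKR x -> conjK (conjK x) = x.
Proof. by move=> /OKP[a [b ->]]; rewrite !conjK_zsN opprK. Qed.

Lemma conjD x y : OKR x -> OKR y -> conjK (x + y) = conjK x + conjK y.
Proof.
move=> /OKP[a [b ->]] /OKP[c [d ->]].
by rewrite zsD !conjK_zsN zsD opprD.
Qed.

Lemma conjN x : OKR x -> conjK (- x) = - conjK x.
Proof. by move=> /OKP[a [b ->]]; rewrite zsN !conjK_zsN zsN. Qed.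

Lemma conjB x y : OKR x -> OKR y -> conjK (x - y) = conjK x - conjK y.
Proof. by move=> hx hy; rewrite conjD ?conjN //; exact: OKN. Qed.

Lemma conjM x y : OKR x -> OKR y -> conjK (x * y) = conjK x * conjK y.
Proof.
move=> /OKP[a [b ->]] /OKP[c [d ->]].
by rewrite zsM !conjK_zsN zsM; congr (zs _ _ _); lia.
Qed.

Lemma conj_int n : conjK (n%:~R : R) = n%:~R.
Proof. by rewrite -zs_int conjK_zsN oppr0. Qed.

Lemma conj0 : conjK (0 : R) = 0. Proof. exact: (conj_int 0). Qed.

Lemma conj1 : conjK (1 : R) = 1. Proof. exact: (conj_int 1). Qed.

Lemma conj_sqrt2 : conjK s2 = - s2.
Proof. by rewrite -[in LHS]zs01 conjK_zs mul1r sub0r. Qed.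

Lemma conjX x n : OKR x -> conjK (x ^+ n) = conjK x ^+ n.
Proof.
move=> hx; elim: n => [|n IHn]; first by rewrite !expr0 conj1.
by rewrite !exprS conjM ?IHn //; exact: OKX.
Qed.

Lemma norm_zs a b : zs R a b * conjK (zs R a b) = (a * a - 2 * (b * b))%:~R.
Proof. by rewrite conjK_zsN zsM -zs_int; congr (zs _ _ _); lia. Qed.

Lemma norm_int_eq0 (a b : int) : a * a - 2 * (b * b) = 0 -> a = 0 /\ b = 0.
Proof. by move=> h; apply: int_sqr_2sqr; lia. Qed.

Lemma conj_neq0 x : OKR x -> x != 0 -> conjK x != 0.
Proof.
by move=> hx; apply: contra => /eqP h; rewrite -(conjKK hx) h conj0.
Qed.

Lemma norm_ge1 x : OKR x -> x != 0 -> 1 <= `|x * conjK x|.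
Proof.
move=> hx x0; have cx0 := conj_neq0 hx x0.
have : x * conjK x != 0 by rewrite mulf_neq0.
move/OKP: hx => [a [b ->]]; rewrite norm_zs intr_eq0 => h.
by rewrite -intr_norm ler1z; lia.
Qed.

(** Both coordinates of z / d = z conj(d) / N(d) are rounded to nearest integers. The remainder
    divided by d is X + Y sqrt2 with |X|, |Y| <= 1/2, and |X^2 - 2 Y^2| <= 1/2. *)
Lemma OK_euclid z d : OKR z -> OKR d -> d != 0 ->
  exists2 q, OKR q & `|(z - d * q) * conjK (z - d * q)| < `|d * conjK d|.
Proof.
move=> hz hd d0.
have nd := norm_ge1 hd d0.
have [a [b ed]] := (OKP d).1 hd.
have [P [Q ePQ]] := (OKP (z * conjK d)).1 (OKM hz (OK_conj hd)).
set N : int := a * a - 2 * (b * b).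
have eN : d * conjK d = N%:~R by rewrite ed norm_zs.
have N0 : N != 0.
  by rewrite -(intr_eq0 R) -eN mulf_neq0 // conj_neq0.
(* Nearest multiple of N, for N of either sign: a remainder e above |N| / 2 is replaced by e -
   |N|. *)
have rnd (X : int) : exists q : int, `|X - q * N| * 2 <= `|N|.
  have [e [he1 he2]] : exists e : int, 0 <= e < `|N| /\ exists q, X = q * N + e.
    exists (X %% N)%Z; split; first by rewrite modz_ge0 //= ltz_mod.
    by exists (X %/ N)%Z; rewrite -divz_eq.
  case: he2 => q ->.
  have [h|h] := leP (e * 2) `|N|; first by exists q; rewrite addrC addKr; lia.
  have [hN|hN] := ltP 0 N.
    by exists (q + 1); lia.
  by exists (q - 1); lia.
have [p hp] := rnd P; have [q hq] := rnd Q.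
exists (zs R p q); first exact: OK_zs.
set r := z - _.
have hr : OKR r by apply: OKB => //; apply: OKM => //; exact: OK_zs.
have er : r * conjK d = zs R (P - p * N) (Q - q * N).
  rewrite mulrBl ePQ -mulrA [zs R p q * _]mulrC mulrA eN -zs_int zsM zsN zsD.
  by congr (zs _ _ _); lia.
have : (r * conjK r) * (d * conjK d) =
    ((P - p * N) * (P - p * N) - 2 * ((Q - q * N) * (Q - q * N)))%:~R.
  rewrite -norm_zs -er conjM ?conjKK //; last exact: OK_conj.
  by ring.
set M : int := _ - _ => eM.
have hM : `|M| * 2 <= N * N.
  have : `|P - p * N| * 2 * (`|P - p * N| * 2) <= `|N| * `|N| by nia.
  have : `|Q - q * N| * 2 * (`|Q - q * N| * 2) <= `|N| * `|N| by nia.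
  rewrite /M; set X := P - _; set Y := Q - _.
  have -> : `|N| * `|N| = N * N by lia.
  have -> : `|X| * 2 * (`|X| * 2) = 4 * (X * X) by lia.
  have -> : `|Y| * 2 * (`|Y| * 2) = 4 * (Y * Y) by lia.
  have : 0 <= X * X by nia.
  have : 0 <= Y * Y by nia.
  by lia.
have : `|r * conjK r| * `|d * conjK d| = `|M|%:~R by rewrite -normrM eM intr_norm.
have : (`|M| * 2)%:~R <= (N * N)%:~R :> R by rewrite ler_int.
rewrite !rmorphM /= -eN -expr2 -real_normK ?num_real // rmorph_nat.
set A := `|r * conjK r|; set B := `|d * conjK d| in nd * => h1 h2.
have : A * 2 * B <= B * B by rewrite -expr2; lra.
rewrite ler_pM2r; last lra.
by lra.
Qed.

(** The generator is a nonzero element whose norm is minimal in absolute value; a nonzero remainder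
    would be smaller. *)
Lemma ideal_principal (I : set R) : is_ideal OKR I -> I <> [set 0] ->
  exists d, [/\ OKR d, d != 0 & I = [set d * z | z in OKR]].
Proof.
move=> [IO I0 ID IM] In0.
have [x0 Ix0 x0n] : exists2 x, I x & x != 0.
  apply: contrapT => h; apply: In0; apply/seteqP; split=> [x Ix /=|x /= ->//].
  by apply: contrapT => /eqP xn; apply: h; exists x.
have exn : exists n : nat, `[<exists x, [/\ I x, x != 0 & `|x * conjK x| = n%:R]>].
  have /OKP[a [b e]] := IO _ Ix0.
  exists (absz (a * a - 2 * (b * b))%R); apply: asboolT; exists x0; split=> //.
  by rewrite {1 2}e norm_zs -intr_norm natr_absz.
case: (ex_minnP exn) => n /asboolP [d [Id d0 dn]] nmin.
exists d; split=> //; first exact: IO.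
apply/seteqP; split=> [z Iz|_ [z hz <-]] /=; last by rewrite mulrC; apply: IM.
have [q hq lt] := OK_euclid (IO _ Iz) (IO _ Id) d0.
set r := z - d * q in lt.
have Ir : I r.
  apply: ID => //; rewrite -mulrN mulrC; apply: IM => //; exact: OKN.
have [r0|r0] := eqVneq r 0.
  by exists q => //; move/eqP: r0; rewrite subr_eq0 => /eqP.
have /OKP[a [b e]] := IO _ Ir.
have : (n <= absz (a * a - 2 * (b * b))%R)%N.
  apply: nmin; apply: asboolT; exists r; split=> //.
  by rewrite {1 2}e norm_zs -intr_norm natr_absz.
move: lt; rewrite dn {1 2}e norm_zs -intr_norm -natr_absz ltr_nat.
by rewrite ltnNge => /negP.
Qed.

End arithmetic.

(** * Generators of ideals modulo units *)

Section representatives.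
Variable R : realType.
Local Notation s2 := (sqrt2 R).
Local Notation OKR := (@OK R).
Implicit Types x y z d e u v g : R.

(* Every nonzero ideal of O_K has exactly one generator of this form: the
   condition on a and b says that d and its conjugate are positive and that
   their ratio lies in [(1 + sqrt2)^-2, (1 + sqrt2)^2), a fundamental domain
   for the action of the units. *)
Definition is_rep (d : R) : Prop :=
  exists a b : int, [/\ d = zs R a b, 0 < a, - a <= 2 * b & 2 * b < a].

Lemma zs_eq1 a b : a = 1 -> b = 0 -> zs R a b = 1.
Proof. by move=> -> ->; rewrite zs_int. Qed.

Lemma rep_OK d : is_rep d -> OKR d.
Proof. by case=> a [b [-> _ _ _]]; exact: OK_zs. Qed.

Lemma rep_gt0 d : is_rep d -> 0 < d.
Proof.
case=> a [b [-> a0 h1 h2]]; rewrite /zs.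
have /andP[s1 s3] := sqrt2_bounds R.
have : - a%:~R <= 2 * b%:~R :> R.
  by rewrite -(rmorph_nat intr) -rmorphM -rmorphN ler_int.
have : 0 < a%:~R :> R by rewrite ltr0z.
by have [b0|b0] := leP 0 (b%:~R : R); nra.
Qed.

(** The strict side 2 b < a of the normalisation is what bounds the conjugate a - b sqrt2 from
    below; d itself may be less than 1, as 2 - sqrt2 shows. The bound keeps s / conj d <= 1 in the
    sieve. *)
Lemma rep_conj_ge1 d : is_rep d -> 1 <= conjK d.
Proof.
case=> a [b [-> a0 h1 h2]]; rewrite conjK_zs.
have /andP[s1 s3] := sqrt2_bounds R.
have h : 2 * b + 1 <= a by lia.
have : 2 * b%:~R + 1 <= a%:~R :> R.
  by rewrite -(rmorph_nat intr) -rmorphM -[1](rmorph1 intr) -rmorphD ler_int.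
have : 1 <= a%:~R :> R by rewrite ler1z.
have [b0|b0] := leP b 0.
  have : b%:~R <= 0 :> R by rewrite lerz0.
  nra.
have : 1 <= b%:~R :> R by rewrite ler1z.
by nra.
Qed.

(** A unit p + q sqrt2 of norm 1 with p, q > 0 has slope q / p >= 2/3, the value at 3 + 2 sqrt2.
    Multiplication by it moves every slope f / c >= - 1/2 to a slope b / a >= 1/2, out of the
    fundamental interval [- 1/2, 1/2). *)
Lemma rep_unique_int (a b c f p q : int) :
  0 < a -> 2 * b < a -> 0 < c -> - c <= 2 * f -> 0 < p -> 0 < q ->
  p * p = 1 + 2 * (q * q) -> a = c * p + 2 * (f * q) -> b = c * q + f * p ->
  False.
Proof.
move=> a0 ba c0 fc p0 q0 e ea eb.
have q2 : 2 <= q.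
  rewrite leNgt; apply/negP => q2; have q1 : q = 1 by lia.
  by move: e; rewrite q1; have [|] := leP p 1; nia.
have h : 2 * p <= 3 * q by nia.
have pq : q <= p by nia.
have : c * (3 * q - 2 * p) <= 2 * b - a.
  rewrite ea eb.
  have -> : 2 * (c * q + f * p) - (c * p + 2 * (f * q)) =
     c * (2 * q - p) + (2 * f) * (p - q) by ring.
  have : 0 <= (2 * f + c) * (p - q) by apply: mulr_ge0; lia.
  by lia.
have : 0 <= c * (3 * q - 2 * p) by apply: mulr_ge0; lia.
by lia.
Qed.

Lemma norm_unit u v : OKR u -> OKR v -> u * v = 1 ->
  exists p q : int, u = zs R p q /\ `|p * p - 2 * (q * q)| = 1.
Proof.
move=> /OKP[p [q ->]] /OKP[p' [q' ->]] h; exists p, q; split=> //.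
have : (p * p - 2 * (q * q)) * (p' * p' - 2 * (q' * q')) = 1.
  apply: (@intr_inj R); rewrite rmorphM /= -!norm_zs mulrACA -conjM ?h ?conj1 ?mulr1 //.
    exact: OK_zs.
  exact: OK_zs.
move/(congr1 absz); rewrite abszM /= => /eqP; rewrite muln_eq1 => /andP[/eqP + _].
by lia.
Qed.

(** Both norms are positive, so the unit p + q sqrt2 has norm 1, and positivity of the rational
    parts forces p > 0. If q is nonzero, one of d and e is the other times a unit with two positive
    coordinates: u itself, or its inverse p - q sqrt2. *)
Lemma rep_unique d e u v : is_rep d -> is_rep e -> OKR u -> OKR v ->
  u * v = 1 -> d = e * u -> d = e.
Proof.
move=> [a [b [-> a0 h1 h2]]] [c [f [-> c0 h3 h4]]] hu hv uv.
have [p [q [-> Nu]]] := norm_unit hu hv uv => E.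
have := E; rewrite zsM => /zs_inj [ea eb].
have N1 : a * a - 2 * (b * b) = (c * c - 2 * (f * f)) * (p * p - 2 * (q * q)).
  by rewrite ea eb; ring.
have Na : 0 < a * a - 2 * (b * b) by nia.
have Nc : 0 < c * c - 2 * (f * f) by nia.
have Np : p * p - 2 * (q * q) = 1.
  have : p * p - 2 * (q * q) = 1 \/ p * p - 2 * (q * q) = -1 by lia.
  by case=> // Np; move: N1; rewrite Np; lia.
have p0 : 0 < p.
  rewrite ltNge; apply/negP => p0.
  have qp : `|q| <= - p by nia.
  have : `|2 * f| <= c by lia.
  have : p != 0 by apply/eqP => p00; move: Np; rewrite p00; nia.
  move=> pn0 fc.
  have : `|(2 * f) * q| <= c * - p.
    rewrite normrM; apply: ler_pM => //.
  by move: (a0); rewrite ea; lia.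
have [q0|q0|q0] := ltgtP q 0; last first.
- have p1 : p = 1 by move: Np; rewrite q0; nia.
  by congr (zs _ _ _); rewrite ?ea ?eb q0 p1; lia.
- by case: (@rep_unique_int a b c f p q); lia.
- have ec : c = a * p + 2 * (b * - q).
    have -> : c = c * (p * p - 2 * (q * q)) by rewrite Np mulr1.
    by rewrite ea eb; ring.
  have ef : f = a * - q + b * p.
    have -> : f = f * (p * p - 2 * (q * q)) by rewrite Np mulr1.
    by rewrite ea eb; ring.
  by case: (@rep_unique_int c f a b p (- q)); lia.
Qed.

(** Reduction as for binary forms: 1 + sqrt2 has norm -1 and corrects the sign of the norm, -1
    corrects the sign of the rational part, and among the associates so obtained one of least
    rational part is taken. *)
Lemma rep_exists g : OKR g -> g != 0 ->
  exists d u v, [/\ is_rep d, OKR u, OKR v, u * v = 1 & g = d * u].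
Proof.
move=> /OKP[a0 [b0 ->]] g0.
pose assoc (a b : int) := exists u v,
  [/\ OKR u, OKR v, u * v = 1 & zs R a0 b0 = zs R a b * u].
have step a b p q p' q' : assoc a b -> zs R p q * zs R p' q' = 1 ->
    assoc (a * p + 2 * (b * q)) (a * q + b * p).
  move=> [u [v [hu hv uv e]]] h.
  exists (zs R p' q' * u), (zs R p q * v); split.
  - by apply: OKM => //; exact: OK_zs.
  - by apply: OKM => //; exact: OK_zs.
  - by rewrite mulrACA uv mulr1 mulrC.
  - by rewrite e -zsM -mulrA [X in _ = _ * X]mulrA h mul1r.
have l1 : zs R 1 1 * zs R (-1) 1 = 1 by rewrite zsM zs_eq1.
have l2 : zs R (-1) 0 * zs R (-1) 0 = 1 by rewrite zsM zs_eq1.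
have l3 : zs R 3 2 * zs R 3 (-2) = 1 by rewrite zsM zs_eq1.
have l4 : zs R 3 (-2) * zs R 3 2 = 1 by rewrite zsM zs_eq1.
have A0 : assoc a0 b0.
  exists 1, 1; split; rewrite ?mulr1 //; exact: OK1.
have [a1 [b1 [A1 N1]]] : exists a b, assoc a b /\ 0 < a * a - 2 * (b * b).
  have nz : a0 * a0 - 2 * (b0 * b0) <> 0.
    by move/norm_int_eq0 => [ea eb]; move: g0; rewrite ea eb zs_int eqxx.
  have [lt0|gt0|//] := ltgtP (a0 * a0 - 2 * (b0 * b0)) 0.
    by do 2 eexists; split; [exact: step A0 l1|nia].
  by exists a0, b0.
have [a2 [b2 [A2 N2 a20]]] :
    exists a b, [/\ assoc a b, 0 < a * a - 2 * (b * b) & 0 < a].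
  have [lt0|gt0|e0] := ltgtP a1 0; last by move: N1; rewrite e0; nia.
    by do 2 eexists; split; [exact: step A1 l2|nia|lia].
  by exists a1, b1.
have exn : exists n : nat, `[< exists b, assoc n%:Z b /\ 0 < n%:Z * n - 2 * (b * b) /\ 0 < n%:Z >].
  exists (absz a2); apply: asboolT; exists b2.
  by have -> : (absz a2 : int) = a2 by lia.
case: (ex_minnP exn) => n /asboolP [b [Ab [Nb n0]]] nmin.
have key (c e : int) : assoc c e -> 0 < c * c - 2 * (e * e) -> 0 < c -> n%:Z <= c.
  move=> Ac Nc c0; suff : (n <= absz c)%N by lia.
  apply: nmin; apply: asboolT; exists e.
  by have -> : (absz c : int) = c by lia.
(* Multiplication by 3 + 2 sqrt2 and by 3 - 2 sqrt2 cannot lower the minimal rational part n; this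
   gives - n <= 2 b and 2 b <= n. *)
have Ap := step _ _ _ _ _ _ Ab l3; have An := step _ _ _ _ _ _ Ab l4.
have bn : `|b| < n%:Z by nia.
have h1 : n%:Z <= n%:Z * 3 + 2 * (b * 2).
  apply: key Ap _ _; last by nia.
  suff -> : forall n : int, (n * 3 + 2 * (b * 2)) * (n * 3 + 2 * (b * 2)) -
    2 * ((n * 2 + b * 3) * (n * 2 + b * 3)) = n * n - 2 * (b * b) by [].
  by move=> k; ring.
have h2 : n%:Z <= n%:Z * 3 + 2 * (b * - 2).
  apply: key An _ _; last by nia.
  suff -> : forall n : int, (n * 3 + 2 * (b * - 2)) * (n * 3 + 2 * (b * - 2)) -
    2 * ((n * - 2 + b * 3) * (n * - 2 + b * 3)) = n * n - 2 * (b * b) by [].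
  by move=> k; ring.
have [eb|nb] := eqVneq (2 * b) n%:Z.
  case: An => u [v [hu hv uv e]].
  exists (zs R (n%:Z * 3 + 2 * (b * - 2)) (n%:Z * - 2 + b * 3)), u, v; split=> //.
  by exists (n%:Z * 3 + 2 * (b * - 2)), (n%:Z * - 2 + b * 3); split=> //; lia.
case: Ab => u [v [hu hv uv e]].
exists (zs R n b), u, v; split=> //.
by exists n%:Z, b; split=> //; lia.
Qed.

End representatives.

(** * The window and visible points *)

Section octagon_window.
Variable R : realType.
Local Notation s2 := (sqrt2 R).

Lemma cos_sin_pi4 : cos (pi / 4 : R) = s2 / 2 /\ sin (pi / 4 : R) = s2 / 2.
Proof.
have e2 : (pi / 4 : R) *+ 2 = pi / 2 by rewrite -mulr_natr; field.
have pi0 := @pi_gt0 R.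
have c0 : 0 < cos (pi / 4 : R) by apply: cos_gt0_pihalf; lra.
have := cos_mulr2n (pi / 4 : R); rewrite e2 cos_pihalf => hc.
have := sin_mulr2n (pi / 4 : R); rewrite e2 sin_pihalf => hs.
have s0 := sqrt2_gt0 R; have ss := sqrt2_sqr R.
have ec : cos (pi / 4 : R) = s2 / 2.
  move: hc; rewrite -mulr_natr expr2.
  set c := cos _ in c0 * => hc.
  have : (c - s2 / 2) * (c + s2 / 2) = 0 by nra.
  by move/eqP; rewrite mulf_eq0 => /orP[] /eqP; lra.
split=> //; move: hs; rewrite ec -mulr_natr; set s := sin _ => hs.
have e : s2 * s = 1 by lra.
by apply: (mulfI (sqrt2_neq0 R)); rewrite e; lra.
Qed.

Lemma tan_pi8 : tan (pi / 8 : R) = s2 - 1.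
Proof.
have e2 : (pi / 8 : R) *+ 2 = pi / 4 by rewrite -mulr_natr; field.
have pi0 := @pi_gt0 R.
have c0 : 0 < cos (pi / 8 : R) by apply: cos_gt0_pihalf; lra.
have [ec es] := cos_sin_pi4.
have := cos_mulr2n (pi / 8 : R); rewrite e2 ec -mulr_natr expr2 => hc.
have := sin_mulr2n (pi / 8 : R); rewrite e2 es -mulr_natr => hs.
have ss := sqrt2_sqr R.
rewrite /tan; move: hc hs.
set c := cos _ in c0 *; set s := sin _ => hc hs.
have e : s = (s2 - 1) * c.
  apply: (mulfI (lt0r_neq0 c0)).
  have -> : c * s = s2 / 4 by lra.
  have -> : c * ((s2 - 1) * c) = (s2 - 1) * (c * c) by ring.
  have -> : c * c = (s2 / 2 + 1) / 2 by lra.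
  by nra.
by rewrite e mulfK // lt0r_neq0.
Qed.

Lemma cos_sin_nat_pi4 (k : nat) :
  cos (k.+2%:R * (pi / 4 : R)) = - sin (k%:R * (pi / 4)) /\
  sin (k.+2%:R * (pi / 4 : R)) = cos (k%:R * (pi / 4)).
Proof.
have -> : k.+2%:R * (pi / 4 : R) = k%:R * (pi / 4) + pi / 2.
  by rewrite -[k.+2]addn2 natrD mulrDl; congr (_ + _); field.
by rewrite cosDpihalf sinDpihalf.
Qed.

(** c times the octagon of side sqrt2, whose apothem is 1 + sqrt2 / 2; on the diagonal sides |x1| +
    |x2| is sqrt2 times the apothem. Absolute values make the symmetry under negative scalars
    visible, which matters because conjugates of positive units may be negative. *)
Definition win (c : R) : set (R * R) :=
  [set x | [/\ `|x.1| <= c * (1 + s2 / 2), `|x.2| <= c * (1 + s2 / 2)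
             & `|x.1| + `|x.2| <= c * (1 + s2)]].

Lemma scale_sqrt2_half (z b : R) : (z * (s2 / 2) <= b / 2) = (z <= s2 * b / 2).
Proof.
have ss := sqrt2_sqr R; have s0 := sqrt2_gt0 R.
rewrite -(ler_pM2r s0).
have -> : z * (s2 / 2) * s2 = z * (s2 * s2) / 2 by ring.
by rewrite ss mulfK // mulrC mulrA.
Qed.

Lemma ler_norm_add (x y b : R) : (`|x| + `|y| <= b) =
  [&& x + y <= b, - x + y <= b, x - y <= b & - x - y <= b].
Proof.
apply/idP/and4P => [h|[h1 h2 h3 h4]].
  have [n1 n2] := (ler_norm x, ler_norm (- x)); rewrite normrN in n2.
  have [n3 n4] := (ler_norm y, ler_norm (- y)); rewrite normrN in n4.
  by split; apply: le_trans h; apply: lerD.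
by case: (ger0P x) => _; case: (ger0P y) => _; rewrite // addrC // addrC.
Qed.

Lemma octagonE (x : R * R) : octagon x <->
  [/\ `|x.1| <= (1 + s2) / 2, `|x.2| <= (1 + s2) / 2
    & `|x.1| + `|x.2| <= s2 * (1 + s2) / 2].
Proof.
have ss := sqrt2_sqr R; have s0 := sqrt2_gt0 R.
have ap : 1 / (2 * tan (pi / 8)) = (1 + s2) / 2 :> R.
  rewrite tan_pi8; have h : 2 * (s2 - 1) != 0.
    by rewrite gt_eqF //; have /andP[] := sqrt2_bounds R; lra.
  apply: (mulIf h); rewrite divfK //.
  have -> : (1 + s2) / 2 * (2 * (s2 - 1)) = s2 * s2 - 1 by field.
  by rewrite ss; lra.
have [c4 s4] := cos_sin_pi4.
have c0 : cos (0%:R * (pi / 4) : R) = 1 by rewrite mul0r cos0.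
have d0 : sin (0%:R * (pi / 4) : R) = 0 by rewrite mul0r sin0.
have c1 : cos (1%:R * (pi / 4) : R) = s2 / 2 by rewrite mul1r.
have d1 : sin (1%:R * (pi / 4) : R) = s2 / 2 by rewrite mul1r.
(* Quarter turns give the other six normals from k = 0 and k = 1. *)
have [] := cos_sin_nat_pi4 0; rewrite c0 d0 => c2 d2.
have [] := cos_sin_nat_pi4 1; rewrite c1 d1 => c3 d3.
have [] := cos_sin_nat_pi4 2; rewrite c2 d2 => c4' d4.
have [] := cos_sin_nat_pi4 3; rewrite c3 d3 => c5 d5.
have [] := cos_sin_nat_pi4 4; rewrite c4' d4 => c6 d6.
have [] := cos_sin_nat_pi4 5; rewrite c5 d5 => c7 d7.
rewrite /octagon /= ap ler_norm_add !ler_norml; case: x => x y /=.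
split=> [h|[/andP[h1 h2] /andP[h3 h4] /and4P[h5 h6 h7 h8]] k].
  have := h (Ordinal (isT : 0 < 8)%N); have := h (Ordinal (isT : 1 < 8)%N).
  have := h (Ordinal (isT : 2 < 8)%N); have := h (Ordinal (isT : 3 < 8)%N).
  have := h (Ordinal (isT : 4 < 8)%N); have := h (Ordinal (isT : 5 < 8)%N).
  have := h (Ordinal (isT : 6 < 8)%N); have := h (Ordinal (isT : 7 < 8)%N).
  rewrite /= c0 d0 c1 d1 c2 d2 c3 d3 c4' d4 c5 d5 c6 d6 c7 d7.
  clear; rewrite ?(mulrN, oppr0, mulr0, mulr1, add0r, addr0, opprK) -?mulNr -?mulrDl.
  rewrite !scale_sqrt2_half => h7 h6 h5 h4 h3 h2 h1 h0.
  by split; [apply/andP; split|apply/andP; split|apply/and4P; split] => //; rewrite mulNr lerNl.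
move: k; case=> -[|[|[|[|[|[|[|[|//]]]]]]]] /= _;
rewrite ?(c0, d0, c1, d1, c2, d2, c3, d3, c4', d4, c5, d5, c6, d6, c7, d7);
  rewrite ?(mulrN, oppr0, mulr0, mulr1, add0r, addr0, opprK) -?mulNr -?mulrDl;
  by rewrite ?scale_sqrt2_half // lerNl.
Qed.

Lemma windowAE : @windowA R = win 1.
Proof.
have ss := sqrt2_sqr R; have s0 := sqrt2_gt0 R.
have sc (z b : R) : (`|s2 * z| <= s2 * b) = (`|z| <= b).
  by rewrite normrM (gtr0_norm s0) ler_pM2l.
have e1 : 1 + s2 / 2 = s2 * ((1 + s2) / 2) by nra.
have e2 : 1 + s2 = s2 * (s2 * (1 + s2) / 2) by nra.
rewrite /windowA /win /dilate; apply/seteqP; split=> [_ [x /octagonE[h1 h2 h3] <-]|x] /=.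
  rewrite !mul1r; split; [by rewrite e1 sc|by rewrite e1 sc|].
  by rewrite e2 !normrM (gtr0_norm s0) -mulrDr ler_pM2l.
rewrite !mul1r => -[h1 h2 h3]; exists (s2^-1 * x.1, s2^-1 * x.2) => /=; last first.
  by rewrite !mulrA mulfV ?sqrt2_neq0 // !mul1r; case: (x).
apply/octagonE => /=; rewrite !normrM -mulrDr normfV (gtr0_norm s0).
rewrite -!(ler_pM2l s0 (s2^-1 * _)) !mulrA mulfV ?sqrt2_neq0 // !mul1r.
split; [by rewrite -mulrA -e1|by rewrite -mulrA -e1|].
by apply: le_trans h3 _; rewrite ss; lra.
Qed.

End octagon_window.

(** * Unimodular vectors and visible points *)

Section visibility.
Variable R : realType.
Local Notation s2 := (sqrt2 R).
Local Notation OKR := (@OK R).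
Implicit Types (x y : R * R) (d e h t u v : R).

Definition latL : set (R * R) :=
  [set x | [/\ OKR x.1, OKR x.2 & OKR ((x.1 - x.2) / s2)]].

(* The coordinates of x in the O_K-basis (1, 1), (0, - sqrt2) of latL generate
   the unit ideal. *)
Definition unimod : set (R * R) :=
  [set x | latL x /\ exists u v,
     [/\ OKR u, OKR v & u * x.1 + v * ((x.1 - x.2) / s2) = 1]].

Definition conj2 x : R * R := (conjK x.1, conjK x.2).

Definition scal t x : R * R := (t * x.1, t * x.2).

Lemma scalA t u x : scal t (scal u x) = scal (t * u) x.
Proof. by rewrite /scal /= !mulrA. Qed.

Lemma scal1 x : scal 1 x = x.
Proof. by rewrite /scal !mul1r; case: x. Qed.

Lemma scalK t x : t != 0 -> scal t^-1 (scal t x) = x.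
Proof. by move=> t0; rewrite scalA mulVf // scal1. Qed.

Lemma scal_diff t x : ((scal t x).1 - (scal t x).2) / s2 = t * ((x.1 - x.2) / s2).
Proof. by rewrite /scal /= -mulrBr mulrA. Qed.

Lemma latL_scal t x : OKR t -> latL x -> latL (scal t x).
Proof.
by move=> ht [h1 h2 h3]; split; rewrite ?scal_diff; exact: OKM.
Qed.

Lemma conj2_scal t x : OKR t -> latL x ->
  conj2 (scal t x) = scal (conjK t) (conj2 x).
Proof. by move=> ht [h1 h2 _]; rewrite /conj2 /scal /= !conjM. Qed.

(** Here t is any real number: the Bezout relation of x writes it as an O_K-combination of the
    coordinates of [scal t x]. This turns visibility, a condition on all real t in (0, 1), into
    arithmetic of O_K. *)
Lemma unimod_ratio t x : unimod x -> latL (scal t x) -> OKR t.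
Proof.
move=> [hx [u [v [hu hv e]]]] [h1 h2]; rewrite scal_diff => h3.
have -> : t = u * (t * x.1) + v * (t * ((x.1 - x.2) / s2)).
  by rewrite -[LHS]mulr1 -e; ring.
by apply: OKD; apply: OKM.
Qed.

Lemma unimod_scal_unit u v x : OKR u -> OKR v -> u * v = 1 -> unimod x ->
  unimod (scal u x).
Proof.
move=> hu hv uv [hx [p [q [hp hq e]]]]; split; first exact: latL_scal.
exists (v * p), (v * q); split; [exact: OKM|exact: OKM|].
rewrite scal_diff /scal /=; transitivity ((u * v) * (p * x.1 + q * ((x.1 - x.2) / s2))).
  by ring.
by rewrite e uv mulr1.
Qed.

(** d is the normalised generator of the ideal spanned by the coordinates x.1 and w of x in the
    basis (1, 1), (0, - sqrt2); dividing by it leaves a vector whose coordinates generate the unit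
    ideal. *)
Lemma latL_decomp x : latL x -> x <> (0, 0) ->
  exists d y, [/\ is_rep d, unimod y & x = scal d y].
Proof.
move=> hx x0; have [h1 h2 h3] := hx.
set w := (x.1 - x.2) / s2 in h3.
have x2E : x.2 = x.1 - s2 * w by rewrite /w mulrCA divff ?sqrt2_neq0 // mulr1; ring.
pose I : set R := [set z | exists u v, [/\ OKR u, OKR v & z = u * x.1 + v * w]].
have I1 : I x.1.
  by exists 1, 0; split; [exact: OK1|exact: OK0|rewrite mul1r mul0r addr0].
have Iw : I w.
  by exists 0, 1; split; [exact: OK0|exact: OK1|rewrite mul1r mul0r add0r].
have idI : is_ideal OKR I.
  split.
  - by move=> _ [u [v [hu hv ->]]]; apply: OKD; exact: OKM.
  - by exists 0, 0; split; rewrite ?mul0r ?addr0 //; exact: OK0.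
  - move=> _ _ [u [v [hu hv ->]]] [u' [v' [hu' hv' ->]]].
    by exists (u + u'), (v + v'); split; [exact: OKD|exact: OKD|ring].
  - move=> a _ ha [u [v [hu hv ->]]].
    by exists (a * u), (a * v); split; [exact: OKM|exact: OKM|ring].
have In0 : I <> [set 0].
  move=> I0; apply: x0; move: I1 Iw; rewrite I0 /= => e1 ew.
  by move: x2E; rewrite e1 ew mulr0 subr0; case: (x) e1 => a b /= -> ->.
have [g [hg g0 Ig]] := ideal_principal idI In0.
have [d [u [v [rd hu hv uv gE]]]] := rep_exists hg g0.
have d0 := rep_gt0 rd; have dn0 := lt0r_neq0 d0.
have div z : I z -> OKR (z / d).
  rewrite Ig => -[q hq <-]; rewrite gE mulrAC [d * u]mulrC mulfK //.
  exact: OKM.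
exists d, (scal d^-1 x); split=> //; last by rewrite scalA divff // scal1.
have y1 := div _ I1; have yw := div _ Iw.
split.
  split; rewrite ?scal_diff /=; [by rewrite mulrC| |by rewrite mulrC].
  rewrite x2E mulrBr; apply: OKB; first by rewrite mulrC.
  rewrite mulrCA; apply: OKM; first exact: OK_sqrt2.
  by rewrite mulrC.
have : I g by rewrite Ig /=; exists 1; [exact: OK1|rewrite mulr1].
case=> p [q [hp hq e]].
exists (v * p), (v * q); split; [exact: OKM|exact: OKM|].
rewrite scal_diff /scal /= -/w.
transitivity (v * d^-1 * (p * x.1 + q * w)); first by ring.
by rewrite -e gE -mulrA mulKf // mulrC.
Qed.

(** By unimodularity d / e and e / d both lie in O_K, so d and e are associate. *)
Lemma latL_decomp_unique d e x y : is_rep d -> is_rep e -> unimod x ->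
  unimod y -> scal d x = scal e y -> d = e /\ x = y.
Proof.
move=> rd re ux uy E.
have d0 := lt0r_neq0 (rep_gt0 rd); have e0 := lt0r_neq0 (rep_gt0 re).
have ede : d = e.
  apply: (@rep_unique _ d e (d / e) (e / d)) => //.
  - apply: (unimod_ratio ux); rewrite mulrC -scalA E scalK //; exact: uy.1.
  - apply: (unimod_ratio uy); rewrite mulrC -scalA -E scalK //; exact: ux.1.
  - by rewrite mulrA divfK // divff.
  - by rewrite mulrCA divff // mulr1.
by split=> //; rewrite -(scalK x d0) E ede scalK.
Qed.

(** For h = a + b sqrt2 the conjugate is h - 2 b sqrt2, and b = 0 is impossible. Only b = 1 needs
    care: then h = sqrt2 - 1, where the bound is attained. *)
Lemma small_OK h : OKR h -> 0 < h < 1 -> 1 + s2 <= `|conjK h|.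
Proof.
move=> /OKP[a [b ->]] /andP[]; rewrite conjK_zs /zs => h0 h1.
have /andP[s1 s3] := sqrt2_bounds R.
have [b0|b0|b0] := ltgtP b 0; last first.
- move: h0 h1; rewrite b0 !mul0r !addr0 ltr0z -[1](rmorph1 intr) ltr_int; lia.
- have [b1|b1] : b = 1 \/ 2 <= b by lia.
    have a1 : a = -1.
      have : (- 2)%:~R < a%:~R :> R by rewrite rmorphN; move: h0; rewrite b1; lra.
      have : a%:~R < 0 :> R by move: h1; rewrite b1; lra.
      by rewrite ltr_int ltrz0; lia.
    by rewrite a1 b1 ler_normr; apply/orP; right; rewrite rmorphN; lra.
  have : 2 <= b%:~R :> R by rewrite -(rmorph_nat intr) ler_int.
  by move=> b2; rewrite ler_normr; apply/orP; right; nra.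
- have : b%:~R <= -1 :> R by rewrite -[-1](rmorphN1 intr) ler_int; lia.
  by move=> b2; rewrite ler_normr; apply/orP; left; nra.
Qed.

Lemma win_scal t c x : `|t| <= 1 -> win c x -> win c (scal t x).
Proof.
move=> t1 [h1 h2 h3]; rewrite /win /= !normrM -mulrDr.
have le z : 0 <= z -> `|t| * z <= z by move=> z0; rewrite ler_piMl.
by split; [apply: le_trans h1|apply: le_trans h2|apply: le_trans h3]; apply: le;
  rewrite ?addr_ge0.
Qed.

Lemma win_scalE t c x : t != 0 -> win c (scal t x) <-> win (c / `|t|) x.
Proof.
move=> t0; have t0' : 0 < `|t| by rewrite normr_gt0.
rewrite /win /= !normrM -mulrDr.
have e z b : (`|t| * z <= c * b) = (z <= c / `|t| * b).
  by rewrite mulrAC ler_pdivlMr // mulrC.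
by rewrite !e.
Qed.

(* u = 1 works except for d = 2 - sqrt2, whose norm is 2. *)
Lemma rep_unit_below d : is_rep d -> d != 1 ->
  exists u, [/\ OKR u, 0 < u, u < d & `|conjK u| <= conjK d].
Proof.
move=> [a [b [-> a0 h1 h2]]]; rewrite conjK_zs => d1.
have /andP[s1 s3] := sqrt2_bounds R; have ss := sqrt2_sqr R.
have [a1|[[a2 b2]|[[a2 b0]|a3]]] : a = 1 \/ (a = 2 /\ b = -1) \/ (a = 2 /\ b = 0)
    \/ 3 <= a by lia.
- have b0 : b = 0 by lia.
  by move: d1; rewrite a1 b0 zs_int eqxx.
- exists (zs R (-1) 1); split; first exact: OK_zs.
  + by rewrite /zs rmorphN; lra.
  + by rewrite a2 b2 /zs !rmorphN; lra.
  + by rewrite conjK_zs a2 b2 !rmorphN ler_norml; apply/andP; split; lra.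
- exists 1; rewrite conj1 a2 b0 /zs normr1 mul0r subr0 addr0.
  by split; [exact: OK1|lra|lra|lra].
- exists 1; rewrite conj1 normr1 /zs.
  have [b1 b2] : - a%:~R <= 2 * b%:~R :> R /\ 2 * b%:~R + 1 <= a%:~R :> R.
    rewrite -(rmorph_nat intr) -rmorphM -rmorphN ler_int; split=> //.
    by rewrite -[1](rmorph1 intr) -rmorphD ler_int; lia.
  have a4 : 3 <= a%:~R :> R by rewrite -(rmorph_nat intr) ler_int.
  have h3 : - a + 1 <= 2 * b \/ 4 <= a by lia.
  have b3 : - a%:~R + 1 <= 2 * b%:~R :> R \/ 4 <= a%:~R :> R.
    case: h3 => h3; [left|right; by rewrite -(rmorph_nat intr) ler_int].
    by rewrite -[1](rmorph1 intr) -(rmorph_nat intr) -rmorphM -rmorphN -rmorphD ler_int.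
  split; [exact: OK1|lra| |].
  + by have [b0|b0] := leP 0 (b%:~R : R); [nra|case: b3; nra].
  + by have [b0|b0] := leP 0 (b%:~R : R); nra.
Qed.

Lemma visible_ammann_beenker' : visible (ammann_beenker' R) =
  [set x | [/\ unimod x, win 1 (conj2 x) & ~ win (s2 - 1) (conj2 x)]].
Proof.
have /andP[s1 s3] := sqrt2_bounds R; have ss := sqrt2_sqr R.
have ABE x : ammann_beenker' R x <-> latL x /\ win 1 (conj2 x).
  by rewrite /ammann_beenker' /= windowAE; split=> [[h1 h2 h3 h4]|[[h1 h2 h3] h4]].
have il0 : s2 - 1 != 0 by rewrite gt_eqF //; lra.
have OKil : OKR (s2 - 1) by apply: OKB; [exact: OK_sqrt2|exact: OK1].
have cil : conjK (s2 - 1) = - (s2 + 1).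
  by rewrite conjB ?conj_sqrt2 ?conj1; [ring|exact: OK_sqrt2|exact: OK1].
(* [win (s2 - 1)] is W / lam, since sqrt2 - 1 = 1 / lam. The conjugate of sqrt2 - 1 is - lam, and
   the window is symmetric. *)
have winlam x : win (s2 - 1) (conj2 x) <-> win 1 (scal (- (s2 + 1)) (conj2 x)).
  rewrite win_scalE; last by rewrite oppr_eq0 gt_eqF //; lra.
  suff -> : 1 / `|- (s2 + 1)| = s2 - 1 by [].
  rewrite normrN gtr0_norm; last lra.
  by apply: (mulIf (x := s2 + 1)); rewrite ?divfK ?gt_eqF //; [nra|lra|lra].
apply/seteqP; split=> x /=.
  move=> [/ABE[hL hW] hv].
  have x0 : x <> (0, 0).
    (* The origin belongs to the point set and is hidden by itself, with t = 1/2. *)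
    move=> xE; apply: (hv (1 / 2)); first by apply/andP; split; lra.
    by rewrite -[(_, _)]/(scal _ x) xE /scal /= mulr0 -xE; apply/ABE.
  have [d [y [rd uy xE]]] := latL_decomp hL x0.
  have d0 := rep_gt0 rd.
  have cd1 := rep_conj_ge1 rd.
  have hvd u : OKR u -> 0 < u -> u < d -> ~ win 1 (conj2 (scal u y)).
    move=> hu u0 ud hW'; apply: (hv (u / d)).
      by rewrite divr_gt0 //= ltr_pdivrMr // mul1r.
    rewrite -[(_, _)]/(scal _ x); apply/ABE.
    have -> : scal (u / d) x = scal u y by rewrite xE scalA divfK // lt0r_neq0.
    by split=> //; apply: latL_scal => //; exact: uy.1.
  have d1 : d = 1.
    have [//|d1] := eqVneq d 1.
    have [u [hu u0 ud hcu]] := rep_unit_below rd d1.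
    case: (hvd u) => //; move: hW; rewrite xE conj2_scal //; last exact: uy.1.
      rewrite conj2_scal //; last exact: uy.1.
      have -> : conjK u = (conjK u / conjK d) * conjK d.
        by rewrite divfK // gt_eqF //; lra.
      rewrite -scalA; apply: win_scal.
      have cd0 : 0 < conjK d by lra.
      by rewrite normrM normfV (gtr0_norm cd0) ler_pdivrMr // mul1r.
    exact: rep_OK.
  have yx : y = x by rewrite xE d1 scal1.
  rewrite -yx; split=> //; first by rewrite yx.
  (* The test factor is t = sqrt2 - 1, an element of O_K in (0, 1) whose conjugate is - lam. *)
  rewrite winlam -cil -conj2_scal //; last exact: uy.1.
  by apply: hvd => //; rewrite ?d1; lra.
move=> [ux hW hnW]; split; first by apply/ABE; split=> //; exact: ux.1.
move=> t t01; rewrite -[(_, _)]/(scal t x) => /ABE[htL htW]; apply: hnW.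
have ht := unimod_ratio ux htL.
move: htW; rewrite conj2_scal //; last exact: ux.1.
have hct := small_OK ht t01.
have ct0 : conjK t != 0 by rewrite -normr_gt0; lra.
move=> hW'; apply/winlam.
have -> : - (s2 + 1) = (- (s2 + 1) / conjK t) * conjK t by rewrite divfK.
rewrite -scalA; apply: win_scal => //.
by rewrite normrM normfV normrN (@gtr0_norm _ (s2 + 1)) ?ler_pdivrMr ?normr_gt0 //; lra.
Qed.

End visibility.

(** * Counting lattice points *)

(** [fset_set] of an infinite set is empty, so a count is meaningful only together with finiteness;
    the estimates below therefore carry it along. *)
Definition cnt (T : choiceType) (A : set T) : nat := #|` fset_set A|.

Section counting.
Variable T : choiceType.
Implicit Types A B : set T.

Lemma cnt0 : cnt (set0 : set T) = 0%N.
Proof. by rewrite /cnt fset_set0 cardfs0. Qed.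

Lemma cnt_le A B : finite_set B -> A `<=` B -> (cnt A <= cnt B)%N.
Proof.
move=> fB AB; apply: fsubset_leq_card.
by rewrite -fset_set_sub //; exact: sub_finite_set AB fB.
Qed.

Lemma cntU_le A B : finite_set A -> finite_set B ->
  (cnt (A `|` B) <= cnt A + cnt B)%N.
Proof. by move=> fA fB; rewrite /cnt fset_setU // cardfsU leq_subr. Qed.

Lemma cntU A B : finite_set A -> finite_set B -> A `&` B = set0 ->
  cnt (A `|` B) = (cnt A + cnt B)%N.
Proof.
move=> fA fB AB; rewrite /cnt fset_setU // cardfsU -fset_setI // AB.
by rewrite fset_set0 cardfs0 subn0.
Qed.

Lemma cnt_image (U : choiceType) (f : T -> U) A : finite_set A ->
  {in A &, injective f} -> cnt (f @` A) = cnt A.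
Proof.
move=> fA inj; rewrite /cnt fset_set_image // card_in_imfset //= => x y.
by rewrite !in_fset_set // => xA yA; apply: inj.
Qed.

Lemma cnt_cover (I : eqType) (s : seq I) (F : I -> set T) A :
  (forall i, i \in s -> finite_set (F i)) ->
  (forall x, A x -> exists2 i, i \in s & F i x) ->
  finite_set A /\ (cnt A <= \sum_(i <- s) cnt (F i))%N.
Proof.
elim: s A => [|i s IHs] A fF cov.
  have -> : A = set0 by rewrite -subset0 => x /cov [].
  by split; rewrite ?cnt0.
have [j js|x|fA' leA'] := IHs (A `\` F i).
- by apply: fF; rewrite inE js orbT.
- by case=> /cov [k]; rewrite inE => /orP[/eqP -> //|ks Fk _]; exists k.
have fi : finite_set (F i) by apply: fF; rewrite mem_head.
have sub : A `<=` F i `|` (A `\` F i).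
  by move=> x Ax; have [Fx|nFx] := pselect (F i x); [left|right].
have fU : finite_set (F i `|` (A `\` F i)) by rewrite finite_setU.
split; first exact: sub_finite_set sub fU.
rewrite big_cons; apply: leq_trans (cnt_le fU sub) _.
by apply: leq_trans (cntU_le fi fA') _; rewrite leq_add2l.
Qed.

Lemma cnt_pack (I : eqType) (s : seq I) (F : I -> set T) A :
  finite_set A -> uniq s -> (forall i, i \in s -> F i `<=` A) ->
  (forall i j, i \in s -> j \in s -> i != j -> F i `&` F j = set0) ->
  (\sum_(i <- s) cnt (F i) <= cnt A)%N.
Proof.
elim: s A => [|i s IHs] A fA /=; first by rewrite big_nil.
case/andP=> nis us sub dis; rewrite big_cons.
have sub' j : j \in s -> F j `<=` A `\` F i.
  move=> js x Fx; split; first by apply: (sub j) => //; rewrite inE js orbT.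
  move=> Fix; have : (F i `&` F j) x by [].
  rewrite dis ?inE ?eqxx ?js ?orbT //.
  by apply: contra nis => /eqP ->.
have fi : finite_set (F i) by apply: sub_finite_set fA; apply: sub; rewrite mem_head.
have fd : finite_set (A `\` F i) by exact: finite_setD.
have h : (cnt (F i) + cnt (A `\` F i) <= cnt A)%N.
  rewrite -cntU //; last by rewrite setDE setICA setICr setI0.
  by apply: cnt_le => // x [|[//]]; apply: sub; rewrite mem_head.
apply: leq_trans h; rewrite leq_add2l; apply: IHs => // j k js ks; apply: dis;
  by rewrite inE ?js ?ks orbT.
Qed.

Lemma cntX (U : choiceType) A (B : set U) : finite_set A -> finite_set B ->
  cnt (A `*` B) = (cnt A * cnt B)%N.
Proof.
move=> fA fB; rewrite /cnt -(size_allpairs (fun x y => (x, y))).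
apply: perm_size; apply: uniq_perm; first exact: fset_uniq.
  by apply: allpairs_uniq; rewrite ?fset_uniq //; case=> a b [c d] _ _ [-> ->].
move=> [x y]; rewrite in_fset_set; last exact: finite_setX.
apply/idP/allpairsP => [|[[a b] /= [+ + [-> ->]]]].
  by rewrite inE => -[/= hx hy]; exists (x, y); rewrite !in_fset_set //= !inE.
by rewrite !in_fset_set // !inE.
Qed.

End counting.

Lemma cnt_int_itv (R : realType) (p q : R) :
  let A := [set b : int | p <= b%:~R < q] in
  finite_set A /\ (p <= q -> q - p - 1 <= (cnt A)%:R <= q - p + 1).
Proof.
move=> A; set k := Num.ceil p; set l := Num.ceil q.
have AE : A = (fun i : nat => k + i%:Z) @` `I_(absz (Num.max 0 (l - k))%R).
  rewrite /A; apply/seteqP; split=> [b|_ [i /= + <-]] /=.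
    rewrite -ceil_le_int -ceil_gt_int -/k -/l => /andP[h1 h2].
    by exists (absz (b - k)) => /=; lia.
  by rewrite -ceil_le_int -ceil_gt_int -/k -/l => h; apply/andP; split; lia.
have fA : finite_set A by rewrite AE; apply: finite_image; exact: finite_II.
split=> // pq; rewrite AE cnt_image; last 2 first.
- exact: finite_II.
- by move=> i j _ _ /addrI [].
rewrite /cnt fset_set_II card_imfset /=; last exact: val_inj.
rewrite size_enum_ord natr_absz.
have kl : k <= l by exact: le_ceil.
have -> : `|Num.max 0 (l - k)| = l - k by lia.
have := ceil_itv p; have := ceil_itv q.
rewrite -/k -/l !rmorphB /= => /andP[h1 h2] /andP[h3 h4].
by apply/andP; split; lra.
Qed.

(** * Equidistribution of Z[sqrt2] in strips *)

Section one_dimensional_count.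
Variable R : realType.
Local Notation s2 := (sqrt2 R).
Local Notation OKR := (@OK R).
Implicit Types (e : int) (u v w z : R) (I J : R * R).

Definition inI z I := I.1 <= z < I.2.

(** The parity e of the rational part is fixed because (x1, x2) lies in L exactly when the rational
    parts of x1 and x2 have the same parity; a box count in L is then a sum of two products of strip
    counts. *)
Definition strip e I J : set R :=
  [set z | (exists a b : int, z = zs R (2 * a + e) b) /\
           inI z I /\ inI (conjK z) J].

(* For each b exactly one a puts the conjugate in a window of length 2. *)
Lemma strip_base e v w u : v <= w ->
  let S := strip e (v, w) (u, u + 2) in
  finite_set S /\ `|(cnt S)%:R - (w - v) / (2 * s2)| <= 2.
Proof.
move=> vw S; have s0 := sqrt2_gt0 R; have s0' : 0 < 2 * s2 by lra.
have /andP[s1 s3] := sqrt2_bounds R.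
pose c (b : int) := Num.ceil ((u - e%:~R + b%:~R * s2) / 2).
pose f (b : int) := zs R (2 * c b + e) b.
have cP b : u <= conjK (f b) < u + 2.
  rewrite conjK_zs rmorphD rmorphM rmorph_nat /=.
  have := ceil_itv ((u - e%:~R + b%:~R * s2) / 2); rewrite -/(c b) rmorphB /=.
  by move=> /andP[h1 h2]; apply/andP; split; lra.
have fE b : f b = conjK (f b) + 2 * s2 * b%:~R.
  by rewrite conjK_zs /f /zs; ring.
pose B := [set b | inI (f b) (v, w)].
have SE : S = f @` B.
  apply/seteqP; split=> [z [[a [b ->]] [hI hJ]]|_ [b hb <-]].
    suff ac : a = c b by exists b; rewrite /B /= /f -ac.
    rewrite /c; apply/esym/eqP; rewrite ceil_eq.
    move: hJ; rewrite /inI /= conjK_zs rmorphD rmorphM rmorph_nat rmorphB /=.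
    by move=> /andP[h1 h2]; apply/andP; split; lra.
  by split; [exists (c b), b|split=> //; exact: cP].
(* f b exceeds its conjugate by 2 sqrt2 b, and the conjugate is known up to 2: the condition on f b
   confines b between two intervals whose lengths differ from (w - v) / (2 sqrt2) by 2 / (2 sqrt2)
   <= 1. *)
pose A1 := [set b : int | (v - u) / (2 * s2) <= b%:~R < (w - u - 2) / (2 * s2)].
pose A2 := [set b : int | (v - u - 2) / (2 * s2) <= b%:~R < (w - u) / (2 * s2)].
have [_ h1] := cnt_int_itv ((v - u) / (2 * s2)) ((w - u - 2) / (2 * s2)).
have [fA2 h2] := cnt_int_itv ((v - u - 2) / (2 * s2)) ((w - u) / (2 * s2)).
rewrite -/A1 in h1; rewrite -/A2 in fA2 h2.
have A1B : A1 `<=` B.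
  move=> b /andP[]; rewrite ler_pdivrMr // ltr_pdivlMr // /B /= /inI /= fE.
  have /andP[p1 p2] := cP b; set X := conjK _ in p1 p2 *.
  by rewrite [b%:~R * _]mulrC => p3 p4; apply/andP; split; lra.
have BA2 : B `<=` A2.
  move=> b; rewrite /B /= /inI /= fE => /andP[].
  have /andP[p1 p2] := cP b; set X := conjK _ in p1 p2 * => p3 p4.
  rewrite /A2 /= ler_pdivrMr // ltr_pdivlMr // [b%:~R * _]mulrC.
  by apply/andP; split; lra.
have fB := sub_finite_set BA2 fA2.
split; first by rewrite SE; exact: finite_image.
have -> : cnt S = cnt B.
  by rewrite SE cnt_image // => b b' _ _ /zs_inj [_ ->].
have l1 : (cnt A1)%:R <= (cnt B)%:R :> R by rewrite ler_nat cnt_le.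
have l2 : (cnt B)%:R <= (cnt A2)%:R :> R by rewrite ler_nat cnt_le.
have e2 : 2 / (2 * s2) <= 1 by rewrite ler_pdivrMr // mul1r; lra.
have d1 x y : x / (2 * s2) - y / (2 * s2) = (x - y) / (2 * s2) by rewrite mulrBl.
rewrite !d1 in h1 h2.
have e3 : (w - u - 2 - (v - u)) / (2 * s2) = (w - v) / (2 * s2) - 2 / (2 * s2).
  by rewrite d1; congr (_ / _); ring.
have e4 : (w - u - (v - u - 2)) / (2 * s2) = (w - v) / (2 * s2) + 2 / (2 * s2).
  by rewrite -mulrDl; congr (_ / _); ring.
have /andP[_ p2] : (w - u - (v - u - 2)) / (2 * s2) - 1 <= (cnt A2)%:R
    <= (w - u - (v - u - 2)) / (2 * s2) + 1.
  by apply: h2; rewrite ler_pM2r ?invr_gt0 //; lra.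
have p1 : (w - u - 2 - (v - u)) / (2 * s2) - 1 <= (cnt A1)%:R.
  have [le|lt] := leP (v - u) (w - u - 2).
    have /h1 /andP[] // : (v - u) / (2 * s2) <= (w - u - 2) / (2 * s2).
    by rewrite ler_pM2r ?invr_gt0.
  apply: le_trans (ler0n _ _).
  have : (w - u - 2 - (v - u)) / (2 * s2) <= 0.
    by rewrite ler_pdivrMr // mul0r; lra.
  lra.
rewrite e4 in p2; rewrite e3 in p1.
move: p1 p2 l1 l2 e2; set D := (w - v) / _; set E := 2 / _.
by clear=> p1 p2 l1 l2 e2; rewrite ler_norml; apply/andP; split; lra.
Qed.

(** The square of lam. Unlike lam it has a positive conjugate, so stretching respects half-open
    intervals on both sides; multiplication by it also preserves the parity of the rational part. *)
Definition mu : R := 3 + 2 * s2.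

Lemma mu_zs : mu = zs R 3 2. Proof. by rewrite /mu /zs. Qed.

Lemma mu_gt5 : 5 < mu.
Proof. by rewrite /mu; have /andP[] := sqrt2_bounds R; lra. Qed.

Lemma mu_gt0 : 0 < mu.
Proof. by have := mu_gt5; lra. Qed.

Lemma OK_mu : OKR mu. Proof. by rewrite mu_zs; exact: OK_zs. Qed.

Lemma muV : mu^-1 = zs R 3 (-2).
Proof.
apply: (mulIf (lt0r_neq0 mu_gt0)); rewrite mulVf ?lt0r_neq0 ?mu_gt0 //.
by rewrite mu_zs zsM zs_eq1.
Qed.

Lemma OK_muV : OKR mu^-1. Proof. by rewrite muV; exact: OK_zs. Qed.

Lemma conj_mu : conjK mu = mu^-1.
Proof. by rewrite muV mu_zs conjK_zsN. Qed.

Lemma conj_muV : conjK mu^-1 = mu.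
Proof. by rewrite -conj_mu conjKK //; exact: OK_mu. Qed.

Definition stretch v I : R * R := (v * I.1, v * I.2).

Lemma inI_stretch v z I : 0 < v -> inI (v * z) (stretch v I) = inI z I.
Proof. by move=> v0; rewrite /inI /= ler_pM2l // ltr_pM2l. Qed.

Lemma strip_mu e I J :
  strip e (stretch mu I) (stretch mu^-1 J) = [set mu * z | z in strip e I J].
Proof.
have mu0 := mu_gt0; have mun0 := lt0r_neq0 mu0.
have muV0 : 0 < mu^-1 by rewrite invr_gt0.
apply/seteqP; split=> [z [[a [b ->]] [hI hJ]]|_ [z [[a [b zE]] [hI hJ]] <-]].
  exists (mu^-1 * zs R (2 * a + e) b); last by rewrite mulVKf.
  split; [|split].
  - rewrite muV zsM; exists (3 * a + e - 2 * b), (3 * b - 2 * (2 * a + e)).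
    by congr (zs _ _ _); lia.
  - by rewrite -(inI_stretch _ _ mu0) mulVKf.
  - rewrite conjM ?conj_muV; [|exact: OK_muV|exact: OK_zs].
    by rewrite -(inI_stretch _ _ muV0) mulKf.
split; [|split].
- rewrite zE mu_zs zsM; exists (3 * a + e + 2 * b), (3 * b + 2 * (2 * a + e)).
  by congr (zs _ _ _); lia.
- by rewrite inI_stretch.
- rewrite conjM ?conj_mu; [|exact: OK_mu|by rewrite zE; exact: OK_zs].
  by rewrite inI_stretch.
Qed.

Lemma strip_muX e I J n :
  strip e (stretch (mu ^+ n) I) (stretch (mu ^- n) J) =
  [set mu ^+ n * z | z in strip e I J].
Proof.
elim: n => [|n IHn].
  rewrite expr0 invr1 /stretch !mul1r -!surjective_pairing.
  by under eq_imagel do rewrite mul1r; rewrite image_id.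
have -> : stretch (mu ^+ n.+1) I = stretch mu (stretch (mu ^+ n) I).
  by rewrite /stretch /= !mulrA -exprS.
have -> : stretch (mu ^- n.+1) J = stretch mu^-1 (stretch (mu ^- n) J).
  by rewrite /stretch /= !mulrA -invfM -exprS.
rewrite strip_mu IHn image_comp; apply: eq_imagel => z _ /=.
by rewrite mulrA -exprS.
Qed.

(** Division by mu^n magnifies the conjugate window from length 2 mu^-n to length 2 and shrinks the
    other interval, so the error stays 2 however narrow the window. The constant 4 sqrt2 is the
    covolume of the elements with even rational part. *)
Lemma strip_scaled e v w u n : v <= w ->
  let S := strip e (v, w) (u, u + 2 * mu ^- n) in
  finite_set S /\ `|(cnt S)%:R - (w - v) * (2 * mu ^- n) / (4 * s2)| <= 2.
Proof.
move=> vw S; have mu0 : 0 < mu ^+ n by rewrite exprn_gt0 // mu_gt0.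
have mun0 := lt0r_neq0 mu0; have s20 := sqrt2_neq0 R.
have vw' : mu ^- n * v <= mu ^- n * w by rewrite ler_pM2l ?invr_gt0.
have [fS' hS'] := strip_base e (mu ^+ n * u) vw'.
set S' := strip _ _ _ in fS' hS'.
have SE : S = [set mu ^+ n * z | z in S'].
  rewrite -strip_muX /stretch /= !mulrA mulfV // mul1r mul1r mulrDr mulrA mulVf //.
  by rewrite mul1r [mu ^- n * 2]mulrC.
split; first by rewrite SE; exact: finite_image.
rewrite SE cnt_image //; last by move=> z z' _ _ /(mulfI mun0).
suff -> : (w - v) * (2 * mu ^- n) / (4 * s2) =
    (mu ^- n * w - mu ^- n * v) / (2 * s2) by [].
by field; rewrite s20 mun0.
Qed.

Lemma strip_split e I u u' u'' : u <= u' -> u' <= u'' ->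
  strip e I (u, u'') = strip e I (u, u') `|` strip e I (u', u'') /\
  strip e I (u, u') `&` strip e I (u', u'') = set0.
Proof.
move=> uu uu'; split.
  apply/seteqP; split=> [z [h1 [h2 /andP[/= h3 h4]]]|z].
    have [lt|ge] := ltP (conjK z) u'; [left|right]; split=> //; split=> //;
      by apply/andP; split.
  by case=> -[h1 [h2 /andP[/= h3 h4]]]; split=> //; split=> //; apply/andP; split=> //=;
    lra.
apply/seteqP; split=> [z [[_ [_ /andP[_ /= h3]]] [_ [_ /andP[/= h4 _]]]]|//].
by move: (le_lt_trans h4 h3); rewrite ltxx.
Qed.

Lemma strip_multiple e v w u n q : v <= w ->
  let h := 2 * mu ^- n in
  let S := strip e (v, w) (u, u + q%:R * h) in
  finite_set S /\ `|(cnt S)%:R - (w - v) * (q%:R * h) / (4 * s2)| <= 2 * q%:R.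
Proof.
move=> vw h; have h0 : 0 < h.
  by rewrite mulr_gt0 // invr_gt0 exprn_gt0 // mu_gt0.
elim: q => [|q [fS IHq]].
  rewrite mul0r addr0 /= !mulr0 mul0r subr0.
  have -> : strip e (v, w) (u, u) = set0.
    rewrite -subset0 => z [_ [_ /andP[/= h1 h2]]].
    by move: (le_lt_trans h1 h2); rewrite ltxx.
  by rewrite cnt0 normr0; split.
have [fS' IH'] := strip_scaled e (u + q%:R * h) n vw.
rewrite -/h in fS' IH'.
have e1 : u + q%:R * h + h = u + q.+1%:R * h by rewrite -natr1; ring.
rewrite e1 in fS' IH'.
have q0 : 0 <= q%:R * h :> R by rewrite mulr_ge0 // ltW.
have [SE Sd] := @strip_split e (v, w) u (u + q%:R * h) (u + q.+1%:R * h) ltac:(lra)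
  ltac:(rewrite -e1; lra).
rewrite /= SE cntU // finite_setU; split=> //.
rewrite natrD.
have -> : (w - v) * (q.+1%:R * h) / (4 * s2) =
  (w - v) * (q%:R * h) / (4 * s2) + (w - v) * h / (4 * s2) by rewrite -natr1; ring.
have -> : 2 * q.+1%:R = 2 * q%:R + 2 :> R by rewrite -natr1; ring.
move: IHq IH'; rewrite !ler_norml; move: (cnt _)%:R (cnt _)%:R => X Y.
set A := _ / _; set B := _ / _ => /andP[h1 h2] /andP[h3 h4].
by apply/andP; split; lra.
Qed.

(** The window lies between q and q + 1 stacked windows of height h <= eps: each costs an error 2,
    and the one in doubt holds about h (w - v) / (4 sqrt2) points. C does not depend on v and w; the
    limit in r and the uniform bound [Pset_bound] both rest on this. *)
Lemma strip_count e u u' eps : u <= u' -> 0 < eps ->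
  exists2 C, 0 <= C & forall v w, v <= w ->
    let S := strip e (v, w) (u, u') in
    finite_set S /\
    `|(cnt S)%:R - (w - v) * (u' - u) / (4 * s2)| <= eps * (w - v) + C.
Proof.
move=> uu eps0; have /andP[s1 s3] := sqrt2_bounds R.
have [n hn] : exists n, 2 * mu ^- n <= eps.
  have [n hn] : exists n : nat, 2 / eps < n%:R.
    by exists (Num.truncn (2 / eps)).+1; exact: truncnS_gt.
  exists n; rewrite ler_pdivrMr ?exprn_gt0 ?mu_gt0 //.
  have h : n%:R <= mu ^+ n.
    have {}hn : n%:R <= 2 ^+ n :> R by rewrite -natrX ler_nat ltnW // ltn_expl.
    by apply: le_trans hn _; apply: lerXn2r; rewrite ?nnegrE //; have := mu_gt5; lra.
  move: hn; rewrite ltr_pdivrMr // => hn.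
  by apply: le_trans (ltW hn) _; rewrite mulrC ler_pM2l.
set h := 2 * mu ^- n in hn.
have h0 : 0 < h by rewrite mulr_gt0 // invr_gt0 exprn_gt0 // mu_gt0.
set q := Num.truncn ((u' - u) / h).
have /andP[q1 q2] : q%:R * h <= u' - u < q.+1%:R * h.
  rewrite -ler_pdivlMr // -ltr_pdivrMr //; apply: truncn_itv.
  by apply: divr_ge0; lra.
exists (2 * q.+1%:R) => [|v w vw S]; first by [].
have [f1 c1] := strip_multiple e u n q vw.
have [f2 c2] := strip_multiple e u n q.+1 vw.
rewrite -/h in f1 c1 f2 c2.
have sub1 : strip e (v, w) (u, u + q%:R * h) `<=` S.
  by move=> z [h1 [h2 /andP[/= h3 h4]]]; split=> //; split=> //; apply/andP; split=> //=; lra.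
have sub2 : S `<=` strip e (v, w) (u, u + q.+1%:R * h).
  by move=> z [h1 [h2 /andP[/= h3 h4]]]; split=> //; split=> //; apply/andP; split=> //=; lra.
have fS := sub_finite_set sub2 f2; split=> //.
have l1 : (cnt (strip e (v, w) (u, u + q%:R * h)))%:R <= (cnt S)%:R :> R.
  by rewrite ler_nat cnt_le.
have l2 : (cnt S)%:R <= (cnt (strip e (v, w) (u, u + q.+1%:R * h)))%:R :> R.
  by rewrite ler_nat cnt_le.
move: c1 c2 l1 l2.
have eq1 : q.+1%:R = q%:R + 1 :> R by rewrite -natr1.
have wv0 : 0 <= (w - v) / (4 * s2) by apply: divr_ge0; lra.
have b1 : (w - v) / (4 * s2) <= w - v.
  by rewrite ler_pdivrMr; nra.
have assoc x : (w - v) * x / (4 * s2) = (w - v) / (4 * s2) * x by ring.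
rewrite !ler_norml !assoc.
set k := (w - v) / _ in wv0 b1 *.
set X := (cnt _)%:R; set Y := (cnt _)%:R; set Z := (cnt _)%:R.
move=> /andP[h1 h2] /andP[h3 h4] h5 h6.
have m1 : k * (u' - u) <= k * (q.+1%:R * h).
  by apply: ler_wpM2l => //; rewrite ltW.
have m2 : k * (q%:R * h) <= k * (u' - u) by apply: ler_wpM2l.
have m3 : k * h <= eps * (w - v).
  by rewrite mulrC; apply: ler_pM => //; exact: ltW.
have m4 : k * (q.+1%:R * h) = k * (q%:R * h) + k * h by rewrite eq1; ring.
by apply/andP; split; lra.
Qed.

End one_dimensional_count.

(** * Points of L in boxes and in sets with Jordan content *)

Section lattice_count.
Variable R : realType.
Local Notation s2 := (sqrt2 R).
Implicit Types (D V : set (R * R)) (B : (R * R) * (R * R)) (I J : R * R) (r : R).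

Lemma cvg_sum_seq (I : eqType) (s : seq I) (f : I -> R -> R) (l : I -> R)
    (F : set_system R) : Filter F ->
  (forall i, i \in s -> f i x @[x --> F] --> l i) ->
  (\sum_(i <- s) f i x) @[x --> F] --> \sum_(i <- s) l i.
Proof.
move=> FF; elim: s => [|i s IHs] h.
  by rewrite big_nil; under eq_fun do rewrite big_nil; exact: cvg_cst.
rewrite big_cons; under eq_fun do rewrite big_cons.
apply: cvgD; first by apply: h; rewrite mem_head.
by apply: IHs => j js; apply: h; rewrite inE js orbT.
Qed.

Definition inB (x : R * R) B := inI x.1 B.1 && inI x.2 B.2.

Definition proper B := (B.1.1 <= B.1.2) && (B.2.1 <= B.2.2).

Definition barea B := (B.1.2 - B.1.1) * (B.2.2 - B.2.1).

Lemma barea_ge0 B : proper B -> 0 <= barea B.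
Proof. by move=> /andP[h1 h2]; apply: mulr_ge0; rewrite subr_ge0. Qed.

Definition bstretch r B := (stretch r B.1, stretch r B.2).

Lemma inB_stretch r x B : 0 < r -> inB (scal r x) (bstretch r B) = inB x B.
Proof. by move=> r0; rewrite /inB /= !inI_stretch. Qed.

Lemma barea_stretch r B : barea (bstretch r B) = r ^+ 2 * barea B.
Proof. by rewrite /barea /=; ring. Qed.

Lemma proper_stretch r B : 0 < r -> proper (bstretch r B) = proper B.
Proof. by move=> r0; rewrite /proper /= !ler_pM2l. Qed.

Lemma strip_cvg e I J : I.1 <= I.2 -> J.1 <= J.2 ->
  (cnt (strip e (stretch r I) J))%:R / r @[r --> +oo] -->
  (I.2 - I.1) * (J.2 - J.1) / (4 * s2).
Proof.
case: I J => v w [u u'] /= vw uu.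
apply/cvgrPdist_le => eps eps0.
set dlt := eps / (2 * (w - v + 1)).
have wv : 0 < 2 * (w - v + 1) by lra.
have dlt0 : 0 < dlt by rewrite divr_gt0.
have [C C0 hC] := strip_count e uu dlt0.
near=> r.
have r0 : 0 < r by near: r; exact: nbhs_pinfty_gt.
have rC : 2 * C / eps <= r by near: r; apply: nbhs_pinfty_ge; exact: num_real.
have vwr : r * v <= r * w by rewrite ler_pM2l.
have [_] := hC _ _ vwr; rewrite /stretch /=.
move: (cnt _)%:R => X hX.
have -> : (w - v) * (u' - u) / (4 * s2) - X / r =
   - ((X - (r * w - r * v) * (u' - u) / (4 * s2)) / r).
  by field; rewrite sqrt2_neq0 gt_eqF.
rewrite normrN normrM normfV (gtr0_norm r0) ler_pdivrMr //.
apply: le_trans hX _.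
have h1 : C <= eps / 2 * r.
  by move: rC; rewrite ler_pdivrMr // => h; lra.
have h2 : dlt * (w - v) <= eps / 2.
  rewrite /dlt mulrAC ler_pdivrMr //; nra.
have -> : dlt * (r * w - r * v) = r * (dlt * (w - v)) by ring.
have : r * (dlt * (w - v)) <= r * (eps / 2) by rewrite ler_pM2l.
by move: h1; clear; move=> *; lra.
Unshelve. all: by end_near.
Qed.

Definition Lbox r B B' : set (R * R) :=
  [set x | [/\ @latL R x, inB x (bstretch r B) & inB (conj2 x) B']].

(** A difference a + b sqrt2 is divisible by sqrt2 exactly when a is even, so L splits into two
    products of parity classes. *)
Lemma LboxE r B B' : Lbox r B B' =
  (strip 0 (stretch r B.1) B'.1 `*` strip 0 (stretch r B.2) B'.2) `|`
  (strip 1 (stretch r B.1) B'.1 `*` strip 1 (stretch r B.2) B'.2).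
Proof.
have even a b a' b' (c : int) : a - a' = 2 * c ->
    OK ((zs R a b - zs R a' b') / s2).
  move=> ac; have -> : (zs R a b - zs R a' b') / s2 = zs R (b - b') c; last exact: OK_zs.
  apply: (mulIf (sqrt2_neq0 R)); rewrite divfK ?sqrt2_neq0 //.
  by rewrite -(zs01 R) zsM zsN zsD; congr (zs _ _ _); lia.
apply/seteqP; split=> -[x y].
  move=> [[/= /OKP[a [b ->]] /OKP[a' [b' ->]] /OKP[c [d hcd]]]].
  move=> /andP[/= h1 h2] /andP[/= h3 h4].
  have : zs R a b - zs R a' b' = zs R (2 * d) c.
    have -> : zs R (2 * d) c = zs R c d * s2.
      by rewrite -(zs01 R) zsM; congr (zs _ _ _); lia.
    by rewrite -hcd divfK // sqrt2_neq0.
  rewrite zsN zsD => /zs_inj [e1 _].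
  have [[k ak]|[k ak]] : (exists k, a = 2 * k + 0) \/ (exists k, a = 2 * k + 1).
  - have [e|e] : a = 2 * (a %/ 2)%Z + 0 \/ a = 2 * (a %/ 2)%Z + 1 by lia.
      by left; exists (a %/ 2)%Z.
    by right; exists (a %/ 2)%Z.
  - left; split=> /=; split=> //; first by exists k, b; rewrite -ak.
    by exists (k - d), b'; congr (zs _ _ _); lia.
  - right; split=> /=; split=> //; first by exists k, b; rewrite -ak.
    by exists (k - d), b'; congr (zs _ _ _); lia.
by case=> -[/= [[a [b ->]] [h1 h2]] [[a' [b' ->]] [h3 h4]]];
  (split; [split=> /=; [exact: OK_zs|exact: OK_zs|apply: (even _ _ _ _ (a - a')); lia]
  |exact/andP|exact/andP]).
Qed.

Lemma strip_finite e I J : I.1 <= I.2 -> J.1 <= J.2 -> finite_set (strip e I J).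
Proof.
case: I J => v w [u u'] /= vw uu; have [C _ h] := strip_count e uu (@ltr01 R).
by case: (h _ _ vw).
Qed.

Lemma Lbox_finite r B B' : 0 < r -> proper B -> proper B' ->
  finite_set (Lbox r B B').
Proof.
move=> r0 /andP[h1 h2] /andP[h3 h4].
by rewrite LboxE finite_setU; split; apply: finite_setX; apply: strip_finite;
  rewrite //= ler_pM2l.
Qed.

Lemma cnt_Lbox r B B' : 0 < r -> proper B -> proper B' ->
  cnt (Lbox r B B') =
  (cnt (strip 0 (stretch r B.1) B'.1) * cnt (strip 0 (stretch r B.2) B'.2) +
   cnt (strip 1 (stretch r B.1) B'.1) * cnt (strip 1 (stretch r B.2) B'.2))%N.
Proof.
move=> r0 /andP[h1 h2] /andP[h3 h4].
have fs e I J : I.1 <= I.2 -> J.1 <= J.2 -> finite_set (strip e (stretch r I) J).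
  by move=> h h'; apply: strip_finite; rewrite //= ler_pM2l.
rewrite LboxE cntU; [|exact: finite_setX (fs _ _ _ h1 h3) (fs _ _ _ h2 h4)
  |exact: finite_setX (fs _ _ _ h1 h3) (fs _ _ _ h2 h4)|].
  by rewrite !cntX //; apply: fs.
rewrite -subset0 => -[x y] [[/= [[a [b ->]] _] _] [/= [[a' [b' /zs_inj[+ _]]] _] _]].
by lia.
Qed.

(** Each of the two parity classes has density (1 / (4 sqrt2))^2 = 1/32; their sum 1/16 is the
    inverse covolume of L. *)
Lemma Lbox_cvg B B' : proper B -> proper B' ->
  (cnt (Lbox r B B'))%:R / r ^+ 2 @[r --> +oo] --> barea B * barea B' / 16.
Proof.
move=> pB pB'; have /andP[h1 h2] := pB; have /andP[h3 h4] := pB'.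
pose g e r : R := (cnt (strip e (stretch r B.1) B'.1))%:R / r *
  ((cnt (strip e (stretch r B.2) B'.2))%:R / r).
have ge e : g e r @[r --> +oo] --> (B.1.2 - B.1.1) * (B'.1.2 - B'.1.1) / (4 * s2) *
    ((B.2.2 - B.2.1) * (B'.2.2 - B'.2.1) / (4 * s2)).
  by apply: cvgM; apply: strip_cvg.
have := cvgD (ge 0) (ge 1).
have ss := sqrt2_sqr R.
have -> : barea B * barea B' / 16 = (B.1.2 - B.1.1) * (B'.1.2 - B'.1.1) / (4 * s2) *
    ((B.2.2 - B.2.1) * (B'.2.2 - B'.2.1) / (4 * s2)) + (B.1.2 - B.1.1) *
    (B'.1.2 - B'.1.1) / (4 * s2) * ((B.2.2 - B.2.1) * (B'.2.2 - B'.2.1) / (4 * s2)).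
  have e x y : x / (4 * s2) * (y / (4 * s2)) = x * y / 32.
    by rewrite mulf_div mulrACA ss; congr (_ / _); lra.
  by rewrite !e /barea; field.
move=> h; apply: (cvg_trans _ (h _)); apply: near_eq_cvg; near=> r.
have r0 : 0 < r by near: r; exact: nbhs_pinfty_gt.
change (g 0 r + g 1 r = (cnt (Lbox r B B'))%:R / r ^+ 2).
rewrite cnt_Lbox // /g natrD !natrM /=.
by field; rewrite gt_eqF.
Unshelve. all: by end_near.
Qed.

(* Jordan content v, witnessed by disjoint boxes inside and boxes covering. *)
Definition has_content D (v : R) : Prop := forall eps, 0 < eps ->
  (exists s : seq ((R * R) * (R * R)),
    [/\ uniq s, forall B, B \in s -> proper B /\ [set x | inB x B] `<=` D,
        forall B B' x, B \in s -> B' \in s -> inB x B -> inB x B' -> B = B'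
      & v - eps <= \sum_(B <- s) barea B]) /\
  (exists t : seq ((R * R) * (R * R)),
    [/\ forall B, B \in t -> proper B,
        forall x, D x -> exists2 B, B \in t & inB x B
      & \sum_(B <- t) barea B <= v + eps]).

Definition Lset r D V : set (R * R) :=
  [set x | [/\ @latL R x, D (scal r^-1 x) & V (conj2 x)]].

Lemma has_content_ge0 D v : has_content D v -> 0 <= v.
Proof.
move=> h; apply/ler_addgt0Pl => eps eps0; have [_ [t [pt _ le]]] := h _ eps0.
rewrite addrC; apply: le_trans le; rewrite big_seq.
by apply: sumr_ge0 => B Bt; apply: barea_ge0; exact: pt.
Qed.

Lemma inB_dilate r x B : 0 < r -> inB (scal r^-1 x) B = inB x (bstretch r B).
Proof.
move=> r0; rewrite -(inB_stretch (scal r^-1 x) B r0) scalA divff ?scal1 //.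
by rewrite gt_eqF.
Qed.

Lemma Lset_cover r D V (t t' : seq ((R * R) * (R * R))) : 0 < r ->
  (forall B, B \in t -> proper B) -> (forall x, D x -> exists2 B, B \in t & inB x B) ->
  (forall B, B \in t' -> proper B) -> (forall x, V x -> exists2 B, B \in t' & inB x B) ->
  finite_set (Lset r D V) /\
  (cnt (Lset r D V) <= \sum_(p <- [seq (B, B') | B <- t, B' <- t']) cnt (Lbox r p.1 p.2))%N.
Proof.
move=> r0 pt ct pt' ct'; apply: cnt_cover => [p /allpairsP[[B B'] /= [hB hB' ->]]|x [hL hD hV]].
  by apply: Lbox_finite => //; [exact: pt|exact: pt'].
have [B Bt xB] := ct _ hD; have [B' Bt' xB'] := ct' _ hV.
exists (B, B'); first by apply/allpairsP; exists (B, B').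
by split=> //=; rewrite -inB_dilate.
Qed.

(** Products of inner boxes pack the set and products of covering boxes cover it. Only finitely many
    boxes occur for a given error, so [Lbox_cvg] can be summed. *)
Lemma Lset_cvg D V d v : has_content D d -> has_content V v ->
  (cnt (Lset r D V))%:R / r ^+ 2 @[r --> +oo] --> d * v / 16.
Proof.
move=> cD cV; have d0 := has_content_ge0 cD; have v0 := has_content_ge0 cV.
apply/cvgrPdist_le => eps eps0.
pose k := d + v + 1; have k0 : 0 < k by rewrite /k; lra.
(* With dl <= 1, (d + dl) (v + dl) exceeds d v by at most dl k <= eps. *)
pose dl := Num.min 1 (eps / k).
have dl0 : 0 < dl by rewrite lt_min ltr01 divr_gt0.
have dl1 : dl <= 1 by rewrite ge_min lexx.
have dlk : dl * k <= eps by rewrite -ler_pdivlMr // ge_min lexx orbT.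
have [[s [us sD ds ls]] [t [pt ct lt]]] := cD _ dl0.
have [[s' [us' sV ds' ls']] [t' [pt' ct' lt']]] := cV _ dl0.
pose ps := [seq (B, B') | B <- s, B' <- s'].
pose pt2 := [seq (B, B') | B <- t, B' <- t'].
have lim_ps : (\sum_(p <- ps) (cnt (Lbox r p.1 p.2))%:R / r ^+ 2) @[r --> +oo] -->
    (\sum_(p <- ps) barea p.1 * barea p.2 / 16).
  apply: cvg_sum_seq => p /allpairsP[[B B'] /= [hB hB' ->]] /=.
  by apply: Lbox_cvg; [case: (sD _ hB)|case: (sV _ hB')].
have lim_pt : (\sum_(p <- pt2) (cnt (Lbox r p.1 p.2))%:R / r ^+ 2) @[r --> +oo] -->
    (\sum_(p <- pt2) barea p.1 * barea p.2 / 16).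
  apply: cvg_sum_seq => p /allpairsP[[B B'] /= [hB hB' ->]] /=.
  by apply: Lbox_cvg; [exact: pt|exact: pt'].
have sumE (x y : seq ((R * R) * (R * R))) :
    \sum_(p <- [seq (B, B') | B <- x, B' <- y]) barea p.1 * barea p.2 / 16 =
    (\sum_(B <- x) barea B) * (\sum_(B <- y) barea B) / 16.
  by rewrite big_allpairs big_distrlr /= mulr_suml; apply: eq_bigr => B _; rewrite mulr_suml.
rewrite sumE in lim_ps; rewrite sumE in lim_pt.
set S := \sum_(B <- s) _ in ls lim_ps; set S' := \sum_(B <- s') _ in ls' lim_ps.
set T := \sum_(B <- t) _ in lt lim_pt; set T' := \sum_(B <- t') _ in lt' lim_pt.
have S0 : 0 <= S by rewrite /S big_seq; apply: sumr_ge0 => B /sD[/barea_ge0].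
have S0' : 0 <= S' by rewrite /S' big_seq; apply: sumr_ge0 => B /sV[/barea_ge0].
have T0 : 0 <= T by rewrite /T big_seq; apply: sumr_ge0 => B /pt/barea_ge0.
have T0' : 0 <= T' by rewrite /T' big_seq; apply: sumr_ge0 => B /pt'/barea_ge0.
have up : T * T' / 16 <= d * v / 16 + eps / 16.
  have : T * T' <= (d + dl) * (v + dl) by apply: ler_pM.
  by rewrite /k in dlk; nra.
have low : d * v / 16 - eps / 16 <= S * S' / 16.
  suff : d * v - dl * (d + v) <= S * S' by rewrite /k in dlk; nra.
  (* If d or v is below dl, the left-hand side is at most 0 and S S' >= 0 suffices; otherwise the
     lower bounds can be multiplied. *)
  have [dd|dd] := leP dl d; last by nra.
  have [vd|vd] := leP dl v; last by nra.
  have : (d - dl) * (v - dl) <= S * S' by apply: ler_pM => //; lra.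
  nra.
have e20 : 0 < eps / 2 by lra.
near=> r.
have r0 : 0 < r by near: r; exact: nbhs_pinfty_gt.
have r20 : 0 < r ^+ 2 by rewrite exprn_gt0.
have h1 : `|S * S' / 16 - \sum_(p <- ps) (cnt (Lbox r p.1 p.2))%:R / r ^+ 2| <= eps / 2.
  by near: r; move/cvgrPdist_le: lim_ps => /(_ _ e20).
have h2 : `|T * T' / 16 - \sum_(p <- pt2) (cnt (Lbox r p.1 p.2))%:R / r ^+ 2| <= eps / 2.
  by near: r; move/cvgrPdist_le: lim_pt => /(_ _ e20).
have [fL leL] := Lset_cover r0 pt ct pt' ct'.
have geL : (\sum_(p <- ps) cnt (Lbox r p.1 p.2) <= cnt (Lset r D V))%N.
  apply: cnt_pack => //.
  - by apply: allpairs_uniq => // -[a b] [a' b'] _ _ /= [-> ->].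
  - move=> p /allpairsP[[B B'] /= [hB hB' ->]] x [/= hL hI hJ]; split=> //.
      by apply: (sD _ hB).2; rewrite /= inB_dilate.
    exact: (sV _ hB').2.
  - move=> p q /allpairsP[[B B'] /= [hB hB' ->]] /allpairsP[[C C'] /= [hC hC' ->]].
    move=> neq; rewrite -subset0 => x [/= [_ a1 a2] [_ b1 b2]].
    move: neq; rewrite (ds' _ _ _ hB' hC' a2 b2).
    rewrite -!inB_dilate // in a1 b1.
    by rewrite (ds _ _ _ hB hC a1 b1) eqxx.
rewrite -(ler_nat R) natr_sum in leL; rewrite -(ler_nat R) natr_sum in geL.
rewrite -mulr_suml in h1; rewrite -mulr_suml in h2.
rewrite -(ler_pM2r (x := (r ^+ 2)^-1)) ?invr_gt0 // in leL.
rewrite -(ler_pM2r (x := (r ^+ 2)^-1)) ?invr_gt0 // in geL.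
move: h1 h2 leL geL up low eps0.
set X := (\sum_(p <- ps) _) / _; set Y := (\sum_(p <- pt2) _) / _; set Z := _%:R / _.
rewrite !ler_norml; clear => /andP[h1 h2] /andP[h3 h4] h5 h6 h7 h8 h9.
by apply/andP; split; lra.
Unshelve. all: by end_near.
Qed.

End lattice_count.

(** * Content of the window *)

Section window_content.
Variable R : realType.
Local Notation s2 := (sqrt2 R).
Implicit Types (D V : set (R * R)) (B : (R * R) * (R * R)).

Lemma has_content_scale D v r : 0 < r -> has_content D v ->
  has_content [set x | D (scal r^-1 x)] (r ^+ 2 * v).
Proof.
move=> r0 hD eps eps0; have r20 : 0 < r ^+ 2 by rewrite exprn_gt0.
have e0 : 0 < eps / r ^+ 2 by rewrite divr_gt0.
have [[s [us sD ds ls]] [t [pt ct lt]]] := hD _ e0.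
have inj : injective (@bstretch R r).
  move=> [[a b] [c d]] [[a' b'] [c' d']] [].
  by do 4 move=> /(mulfI (lt0r_neq0 r0)) ->.
have sumE (l : seq ((R * R) * (R * R))) :
    \sum_(B <- map (bstretch r) l) barea B = r ^+ 2 * \sum_(B <- l) barea B.
  by rewrite big_map mulr_sumr; apply: eq_bigr => B _; rewrite barea_stretch.
have e1 : r ^+ 2 * (eps / r ^+ 2) = eps by rewrite mulrC divfK // gt_eqF.
split.
  exists (map (bstretch r) s); split.
  - by rewrite map_inj_uniq.
  - move=> _ /mapP[B hB ->]; rewrite proper_stretch //; have [pB BD] := sD _ hB.
    by split=> // x /=; rewrite -inB_dilate // => /BD.
  - move=> _ _ x /mapP[B hB ->] /mapP[B' hB' ->].
    by rewrite -!inB_dilate // => h h'; rewrite (ds _ _ _ hB hB' h h').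
  - by rewrite sumE -e1 -mulrBr ler_pM2l.
exists (map (bstretch r) t); split.
- by move=> _ /mapP[B hB ->]; rewrite proper_stretch //; exact: pt.
- move=> x /= /ct [B hB xB]; exists (bstretch r B); first exact: map_f.
  by rewrite -inB_dilate.
- by rewrite sumE -[X in _ <= _ + X]e1 -mulrDr ler_pM2l.
Qed.

Lemma has_contentU D D' v v' : has_content D v -> has_content D' v' ->
  D `&` D' = set0 -> has_content (D `|` D') (v + v').
Proof.
move=> hD hD' dis eps eps0; have e0 : 0 < eps / 2 by lra.
have [[s [us sD ds ls]] [t [pt ct lt]]] := hD _ e0.
have [[s' [us' sD' ds' ls']] [t' [pt' ct' lt']]] := hD' _ e0.
have no x : D x -> D' x -> False by move=> h h'; have : (D `&` D') x by []; rewrite dis.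
split; last first.
  exists (t ++ t'); split.
  - by move=> B; rewrite mem_cat => /orP[/pt|/pt'].
  - by move=> x [/ct|/ct'] [B hB xB]; exists B; rewrite // mem_cat hB ?orbT.
  - by rewrite big_cat /=; lra.
have zero B : B \in s -> B \in s' -> barea B = 0.
  move=> hB hB'; have [/andP[p1 p2] BD] := sD _ hB; have [_ BD'] := sD' _ hB'.
  rewrite /barea; apply/eqP; apply/negPn/negP => n0; apply: (no (B.1.1, B.2.1)).
    apply: BD; rewrite /= /inB /inI /= !lexx /= !lt_neqAle p1 p2 !andbT.
    by apply/andP; split; apply: contra n0 => /eqP ->; rewrite subrr ?mul0r ?mulr0.
  apply: BD'; rewrite /= /inB /inI /= !lexx /= !lt_neqAle p1 p2 !andbT.
  by apply/andP; split; apply: contra n0 => /eqP ->; rewrite subrr ?mul0r ?mulr0.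
exists (s ++ [seq B <- s' | B \notin s]); split.
- rewrite cat_uniq us filter_uniq // andbT /=.
  by apply/hasPn => B; rewrite mem_filter => /andP[].
- move=> B; rewrite mem_cat mem_filter => /orP[/sD[pB h]|/andP[_ /sD'[pB h]]].
    by split=> // x /h; left.
  by split=> // x /h; right.
- move=> B B' x; rewrite !mem_cat !mem_filter => /orP[hB|/andP[_ hB]] /orP[hB'|/andP[_ hB']] h h'.
  + exact: ds hB hB' h h'.
  + by case: (no x); [apply: (sD _ hB).2|apply: (sD' _ hB').2].
  + by case: (no x); [apply: (sD _ hB').2|apply: (sD' _ hB).2].
  + exact: ds' hB hB' h h'.
- rewrite big_cat /= big_filter.
  suff : \sum_(B <- s' | B \notin s) barea B = \sum_(B <- s') barea B by lra.
  rewrite [RHS](bigID (mem s)) /= [X in _ = X + _]big1_seq ?add0r // => B.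
  by move=> /andP[hB hB']; exact: zero.
Qed.

(** Accounts for the closed right side of the octagon, which the half-open trapezoids leave out. *)
Lemma has_content_segment (a c : R) : 0 <= c ->
  has_content [set x | x.1 = a /\ `|x.2| <= c] 0.
Proof.
move=> c0 eps eps0; split.
  by exists [::]; split=> //; rewrite big_nil; lra.
have k0 : 0 < 2 * c + 1 by lra.
pose d := eps / (2 * c + 1); have d0 : 0 < d by rewrite divr_gt0.
exists [:: ((a, a + d), (- c, c + 1))]; split.
- by move=> B; rewrite inE => /eqP ->; rewrite /proper /=; apply/andP; split; lra.
- move=> x [xa]; rewrite ler_norml => /andP[h1 h2].
  by exists ((a, a + d), (- c, c + 1)); rewrite ?mem_head // /inB /inI /= xa;
     apply/andP; split; apply/andP; split; lra.
- rewrite big_seq1 /barea /=.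
  have -> : (a + d - a) * (c + 1 - - c) = d * (2 * c + 1) by ring.
  by rewrite divfK ?gt_eqF // add0r.
Qed.

(** A Riemann sum over N columns of width h. The lower bound q on the half-height, together with h
    <= q, keeps the inner boxes from degenerating into reversed intervals. *)
Lemma has_content_trapezoid (p w y0 k q : R) : 0 < w -> 0 < q -> `|k| <= 1 ->
  q <= y0 -> q <= y0 + k * w ->
  has_content [set x | p <= x.1 < p + w /\ `|x.2| <= y0 + k * (x.1 - p)]
    (w * (2 * y0 + k * w)).
Proof.
move=> w0 q0 k1 q1 q2 eps eps0.
(* The factor 4 comes from the outer boxes, which overshoot the area by w (3 h - k h) <= 4 h w. *)
have [N N0 [hq he]] : exists2 N : nat, (0 < N)%N &
    w / N%:R <= q /\ 4 * (w / N%:R) * w <= eps.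
  exists (maxn (Num.truncn (w / q)).+1 (Num.truncn (4 * w * w / eps)).+1).
    by rewrite leq_max.
  set N := maxn _ _.
  have h1 : w / q < N%:R.
    by apply: lt_le_trans (truncnS_gt _) _; rewrite ler_nat leq_maxl.
  have h2 : 4 * w * w / eps < N%:R.
    by apply: lt_le_trans (truncnS_gt _) _; rewrite ler_nat leq_maxr.
  have N0 : 0 < N%:R :> R by rewrite ltr0n leq_max.
  rewrite ltr_pdivrMr // in h1; rewrite ltr_pdivrMr // in h2.
  split; first by rewrite ler_pdivrMr //; lra.
  have -> : 4 * (w / N%:R) * w = 4 * w * w / N%:R by ring.
  by rewrite ler_pdivrMr //; lra.
set h := w / N%:R in hq he.
have N0' : 0 < N%:R :> R by rewrite ltr0n.
have h0 : 0 < h by rewrite divr_gt0.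
have hN : h * N%:R = w by rewrite divfK // gt_eqF.
pose c (i : nat) : R := y0 + k * (i%:R * h).
(* Separate margins below and above: the trapezoid is closed and the boxes are open at the top, so
   the outer boxes take h below and 2 h above. *)
pose bx e e' (i : nat) : (R * R) * (R * R) :=
  ((p + i%:R * h, p + i.+1%:R * h), (- (c i + e), c i + e')).
have sumE e e' n : \sum_(0 <= i < n) barea (bx e e' i) =
    h * (2 * n%:R * y0 + k * h * n%:R * (n%:R - 1) + n%:R * (e + e')).
  elim: n => [|n IHn]; first by rewrite big_geq //; ring.
  by rewrite big_nat_recr //= IHn /barea /= /c -!natr1; ring.
have sumN e e' : \sum_(0 <= i < N) barea (bx e e' i) =
    w * (2 * y0 + k * w) + w * (e + e' - k * h).
  rewrite sumE; transitivity ((h * N%:R) * (2 * y0 + k * (h * N%:R)) +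
    (h * N%:R) * (e + e' - k * h)); first by ring.
  by rewrite hN.
have [k1' k1''] : - 1 <= k /\ k <= 1 by move: k1; rewrite ler_norml => /andP.
(* As |k| <= 1, the half-height varies by at most h across one column. *)
have cell i x : p + i%:R * h <= x < p + i.+1%:R * h ->
    c i - h <= y0 + k * (x - p) <= c i + h.
  rewrite -natr1 /c => /andP[x1 x2].
  have -> : y0 + k * (x - p) = y0 + k * (i%:R * h) + k * (x - p - i%:R * h) by ring.
  set z := x - p - i%:R * h.
  have z0 : 0 <= z by rewrite /z; lra.
  have z1 : z <= h by rewrite /z; lra.
  by apply/andP; split; nra.
have ciq i : (i < N)%N -> q <= c i.
  move=> iN; have i0 : 0 <= i%:R * h by rewrite mulr_ge0 // ltW.
  have i1 : i%:R * h <= w by rewrite -hN mulrC ler_pM2l // ler_nat ltnW.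
  rewrite /c; have [kk|kk] := leP 0 k; nra.
split.
  exists [seq bx (- h) (- h) i | i <- index_iota 0 N]; split.
  - rewrite map_inj_uniq ?iota_uniq // => i j [+ _ _ _].
    by move/addrI/(mulIf (lt0r_neq0 h0))/(mulrIn (oner_neq0 R)).
  - move=> _ /mapP[i + ->]; rewrite mem_index_iota => /andP[_ iN]; split.
      apply/andP; rewrite /= -natr1; split; first lra.
      by have := ciq _ iN; lra.
    move=> x; rewrite /mkset /inB /inI /= => /andP[h1 /andP[h2 h3]]; split.
      have i1 : i.+1%:R * h <= w by rewrite -hN mulrC ler_pM2l // ler_nat.
      have i0 : 0 <= i%:R * h by rewrite mulr_ge0 // ltW.
      by move/andP: h1 => /= [h4 h5]; apply/andP; split; lra.
    have /andP[h4 h5] := cell i x.1 h1.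
    by rewrite ler_norml; apply/andP; split; lra.
  - move=> _ _ x /mapP[i _ ->] /mapP[j _ ->].
    move=> /andP[/andP[/= h1 h2] _] /andP[/andP[/= h3 h4] _].
    suff -> : i = j by [].
    have lt (a b : nat) : a%:R * h < b.+1%:R * h -> (a <= b)%N.
      by rewrite ltr_pM2r // ltr_nat ltnS.
    by apply/eqP; rewrite eqn_leq; apply/andP; split; apply: lt; lra.
  - rewrite big_map sumN; nra.
exists [seq bx h (2 * h) i | i <- index_iota 0 N]; split.
- move=> _ /mapP[i + ->]; rewrite mem_index_iota => /andP[_ iN].
  apply/andP; rewrite /= -natr1; split; first lra.
  by have := ciq _ iN; lra.
- move=> x [/andP[h1 h2] h3]; pose i := Num.truncn ((x.1 - p) / h).
  have /andP[i1 i2] : i%:R <= (x.1 - p) / h < i.+1%:R.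
    by apply: truncn_itv; apply: divr_ge0; lra.
  rewrite ler_pdivlMr // in i1; rewrite ltr_pdivrMr // in i2.
  have iN : (i < N)%N by rewrite -(ltr_nat R) -(ltr_pM2r h0) mulrC [N%:R * _]mulrC hN mulrC; lra.
  have x1 : p + i%:R * h <= x.1 < p + i.+1%:R * h by apply/andP; split; lra.
  exists (bx h (2 * h) i).
    by apply/mapP; exists i; rewrite // mem_index_iota.
  have /andP[h4 h5] := cell i x.1 x1.
  apply/andP; split=> //=; rewrite /inI /=; move: h3; rewrite ler_norml => /andP[h6 h7].
  by apply/andP; split; lra.
- rewrite big_map sumN; nra.
Qed.

(** Two trapezoids of width 1, a central rectangle of width 2 (m - 1) = sqrt2, and the closing right
    side; m is the apothem and m - 1 half the side. The areas add up to 4 m^2 - 2 = 4 (1 +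
    sqrt2). *)
Lemma has_content_win1 : has_content (win (1 : R)) (4 * (1 + s2)).
Proof.
have ss := sqrt2_sqr R; have /andP[s1 s3] := sqrt2_bounds R.
pose m : R := 1 + s2 / 2.
have mb1 : 17 / 10 < m by rewrite /m; lra.
have k0 : `|0 : R| <= 1 by rewrite normr0.
have k1 : `|1 : R| <= 1 by rewrite normr1.
have kN : `|- 1 : R| <= 1 by rewrite normrN normr1.
have w1 : 0 < 1 :> R by [].
have wc : 0 < 2 * (m - 1) by lra.
have q0 : 0 < m - 1 by lra.
have h1 := @has_content_trapezoid (- m) 1 (m - 1) 1 (m - 1) w1 q0 k1 ltac:(lra) ltac:(lra).
have h2 := @has_content_trapezoid (1 - m) (2 * (m - 1)) m 0 (m - 1) wc q0 k0
  ltac:(lra) ltac:(lra).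
have h3 := @has_content_trapezoid (m - 1) 1 m (- 1) (m - 1) w1 q0 kN ltac:(lra) ltac:(lra).
have h4 := @has_content_segment m (m - 1) ltac:(lra).
have h12 := has_contentU h1 h2; have h34 := has_contentU h3 h4.
have /h12{}h12 : [set x : R * R | - m <= x.1 < - m + 1 /\ `|x.2| <= m - 1 + 1 * (x.1 - - m)] `&`
   [set x | 1 - m <= x.1 < 1 - m + 2 * (m - 1) /\ `|x.2| <= m + 0 * (x.1 - (1 - m))] = set0.
  by rewrite -subset0 => x [[/andP[a1 a2] _] [/andP[a3 a4] _]]; lra.
have /h34{}h34 : [set x : R * R | m - 1 <= x.1 < m - 1 + 1 /\ `|x.2| <= m + - 1 * (x.1 - (m - 1))] `&`
   [set x | x.1 = m /\ `|x.2| <= m - 1] = set0.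
  by rewrite -subset0 => x [[/andP[a1 a2] _] [a3 _]]; lra.
have := has_contentU h12 h34.
set A := _ `|` _; set B := _ `|` _; set v := _ + _.
have -> : A `|` B = win 1.
  clear v h1 h2 h3 h4 h12 h34 k0 k1 kN w1 wc q0.
  apply/seteqP; split=> x.
    rewrite /win /= !mul1r -/m; have -> : 1 + s2 = 2 * m - 1 by rewrite /m; lra.
    case=> -[[/andP[a1 a2]]|]; rewrite /=.
    - move=> a3; have := normr_ge0 x.2.
      by move=> ?; split; rewrite ?(ler0_norm (_ : x.1 <= 0)) //; lra.
    - case=> /andP[a1 a2] a3.
      have a4 : `|x.1| <= m - 1 by rewrite ler_norml; apply/andP; split; lra.
      by split; lra.
    - move=> a3; have := normr_ge0 x.2.
      by move=> ?; split; rewrite ?(ger0_norm (_ : 0 <= x.1)) //; lra.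
    - move=> [-> a3]; have := normr_ge0 x.2.
      by move=> ?; split; rewrite ?(ger0_norm (_ : 0 <= m)) //; lra.
  rewrite /win /= !mul1r -/m; have -> : 1 + s2 = 2 * m - 1 by rewrite /m; lra.
  move=> [a1 a2 a3]; move: (a1); rewrite ler_norml => /andP[b1 b2].
  have [lt1|ge1] := ltP x.1 (1 - m).
    left; left; split; first by apply/andP; split; lra.
    by rewrite ler0_norm in a3; lra.
  have [lt2|ge2] := ltP x.1 (m - 1).
    left; right; split; first by apply/andP; split; lra.
    lra.
  have x0 : 0 <= x.1 by lra.
  rewrite ger0_norm // in a3.
  have [lt3|ge3] := ltP x.1 m.
    right; left; split; first by apply/andP; split; lra.
    lra.
  right; right; split; first lra.
  lra.
have -> : v = 4 * (1 + s2).
  have mm : m * m = 3 / 2 + s2 by rewrite /m; nra.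
  rewrite /v; have -> : m = 1 + s2 / 2 by [].
  have -> : 2 * (1 + s2 / 2 - 1) = s2 by lra.
  nra.
clear h1 h2 h3 h4 h12 h34 k0 k1 kN w1 wc q0 ss s1 s3.
apply; rewrite -subset0 => x [] [[/andP[a1 a2] _]|[/andP[a1 a2] _]] [[/andP[a3 a4] _]|[a3 _]];
  lra.
Qed.

Lemma has_content_win c : 0 < c -> has_content (win c) (c ^+ 2 * (4 * (1 + s2))).
Proof.
move=> c0; have -> : win c = [set x | win 1 (scal c^-1 x)].
  apply/funext => x; apply/propext.
  rewrite /mkset win_scalE ?invr_eq0 ?gt_eqF //.
  by rewrite normfV gtr0_norm // invrK mul1r.
exact: has_content_scale c0 has_content_win1.
Qed.

End window_content.

(** * Unimodular points *)

Section sieve.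
Variable R : realType.
Local Notation s2 := (sqrt2 R).
Local Notation OKR := (@OK R).
Local Notation mu := (@mu R).
Implicit Types (D V : set (R * R)) (x y : R * R) (r s : R).

(** s (sqrt2 - 1) is s / lam, so this is the region s (W minus W / lam) of the overview, and [Tset]
    and [Pset] are the sets counted by T and p. *)
Definition annulus s x := win s x /\ ~ win (s * (s2 - 1)) x.

Definition Pset D r s : set (R * R) :=
  [set x | [/\ unimod x, D (scal r^-1 x) & annulus s (conj2 x)]].

Definition Tset D r s : set (R * R) :=
  [set x | [/\ @latL R x, D (scal r^-1 x) & annulus s (conj2 x)]].

Definition in_square (C : R) D := forall x, D x -> `|x.1| <= C /\ `|x.2| <= C.

Lemma win_le s s' x : s <= s' -> win s x -> win s' x.
Proof.
have /andP[s1 s3] := sqrt2_bounds R.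
move=> ss [h1 h2 h3]; split; [apply: le_trans h1 _|apply: le_trans h2 _|
  apply: le_trans h3 _]; rewrite ler_pM2r //; lra.
Qed.

Lemma win_coord s x : 0 <= s -> win s x -> `|x.1| <= 2 * s /\ `|x.2| <= 2 * s.
Proof. by have /andP[s1 s3] := sqrt2_bounds R; move=> s0 [h1 h2 _]; split; nra. Qed.

Lemma Pset_Tset D r s : Pset D r s `<=` Tset D r s.
Proof. by move=> x [[h1 _] h2 h3]. Qed.

(** The upper ends are 2 c rather than c so that a half-open box contains the closed square of
    half-side c. *)
Definition square (c : R) : (R * R) * (R * R) := ((- c, 2 * c), (- c, 2 * c)).

Lemma inB_square c x : 0 < c -> `|x.1| <= c -> `|x.2| <= c -> inB x (square c).
Proof.
move=> c0; rewrite /inB /inI /= !ler_norml => /andP[h1 h2] /andP[h3 h4].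
by apply/andP; split; apply/andP; split; lra.
Qed.

Lemma Tset_sub_Lbox (C : R) D r s c : in_square C D -> 0 < C -> 0 < r -> 0 < s ->
  s <= c -> Tset D r s `<=` Lbox r (square C) (square (2 * c)).
Proof.
move=> DC C0 r0 s0 sc x [hL hD [hw _]]; have [w1 w2] := win_coord (ltW s0) hw.
have [d1 d2] := DC _ hD; split=> //.
  by rewrite -inB_dilate //; apply: inB_square.
by apply: inB_square; lra.
Qed.

Lemma proper_square c : 0 < c -> proper (square c).
Proof. by move=> c0; apply/andP; split; rewrite /=; lra. Qed.

Lemma Tset_finite (C : R) D r s : in_square C D -> 0 < C -> 0 < r -> 0 < s ->
  finite_set (Tset D r s).
Proof.
move=> DC C0 r0 s0.
apply: sub_finite_set (Tset_sub_Lbox DC C0 r0 s0 (lexx s)) _.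
by apply: Lbox_finite => //; apply: proper_square; lra.
Qed.

Lemma Pset_finite (C : R) D r s : in_square C D -> 0 < C -> 0 < r -> 0 < s ->
  finite_set (Pset D r s).
Proof.
move=> DC C0 r0 s0.
exact: sub_finite_set (@Pset_Tset D r s) (Tset_finite DC C0 r0 s0).
Qed.

Lemma annulus_neq0 s x : annulus s x -> 0 < s -> x <> (0, 0).
Proof.
have /andP[s1 s3] := sqrt2_bounds R.
move=> [_ hn] s0 xE; apply: hn; rewrite xE /win /= normr0 addr0.
by split; apply: mulr_ge0; try lra; apply: mulr_ge0; lra.
Qed.

Lemma annulus_scal t s x : 0 < t -> annulus s (scal t x) <-> annulus (s / t) x.
Proof.
move=> t0; have tn0 := lt0r_neq0 t0.
by rewrite /annulus !win_scalE // gtr0_norm // mulrAC.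
Qed.

(** A nonzero coordinate has norm at least 1, while its two absolute values are at most C r and 2 s.
    The set is thus empty once r s is small, which bounds both the range of d and the normalised
    r. *)
Lemma Tset_norm (C : R) D r s x : in_square C D -> 0 < C -> 0 < r -> 0 < s ->
  Tset D r s x -> 1 <= 2 * C * (r * s).
Proof.
move=> DC C0 r0 s0 [[hx1 hx2 _] hD ha].
have [w1 w2] := win_coord (ltW s0) ha.1.
have [d1 d2] := DC _ hD.
have xn : x <> (0, 0).
  by move=> xE; apply: (annulus_neq0 ha s0); rewrite xE /conj2 conj0.
have bnd (y : R) : OKR y -> y != 0 -> `|r^-1 * y| <= C -> `|conjK y| <= 2 * s ->
    1 <= 2 * C * (r * s).
  move=> hy y0 h1 h2; apply: le_trans (norm_ge1 hy y0) _.
  rewrite normrM; have -> : 2 * C * (r * s) = (C * r) * (2 * s) by ring.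
  apply: ler_pM => //.
  by move: h1; rewrite normrM normfV (gtr0_norm r0) mulrC ler_pdivrMr.
have [x10|x10] := eqVneq x.1 0; last exact: bnd hx1 x10 d1 w1.
have [x20|x20] := eqVneq x.2 0; last exact: bnd hx2 x20 d2 w2.
by case: xn; rewrite [x]surjective_pairing x10 x20.
Qed.

Lemma muX_conj n : OKR (mu ^+ n) /\ conjK (mu ^+ n) = mu ^- n.
Proof.
split; first exact: OKX (OK_mu R).
by rewrite conjX ?conj_mu ?exprVn //; exact: OK_mu.
Qed.

Lemma muVX_conj n : OKR (mu ^- n) /\ conjK (mu ^- n) = mu ^+ n.
Proof.
rewrite -exprVn; split; first exact: OKX (OK_muV R).
by rewrite conjX ?conj_muV //; exact: OK_muV.
Qed.

(* Multiplication by the unit mu^-n trades the size of x against the size of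
   its conjugate. *)
Lemma Pset_unit D r s n : Pset D r s =
  [set scal (mu ^+ n) x | x in Pset D (r / mu ^+ n) (s * mu ^+ n)].
Proof.
have m0 : 0 < mu ^+ n by rewrite exprn_gt0 // mu_gt0.
have mn0 := lt0r_neq0 m0.
have [k1 c1] := muX_conj n; have [k2 c2] := muVX_conj n.
have uv : mu ^+ n * mu ^- n = 1 by rewrite mulfV.
have vu : mu ^- n * mu ^+ n = 1 by rewrite mulVf.
apply/seteqP; split=> [x [h1 h2 h3]|_ [x [h1 h2 h3] <-]].
  exists (scal (mu ^- n) x); last by rewrite scalA uv scal1.
  split; first exact: unimod_scal_unit k2 k1 vu h1.
    by rewrite scalA invfM invrK -mulrA uv mulr1.
  rewrite conj2_scal ?c2 //; last exact: h1.1.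
  by rewrite annulus_scal // mulfK.
split; first exact: unimod_scal_unit k1 k2 uv h1.
  by move: h2; rewrite scalA invfM invrK.
rewrite conj2_scal ?c1 //; last exact: h1.1.
by rewrite annulus_scal ?invr_gt0 // invrK.
Qed.

Lemma Pset_unit_cnt (C : R) D r s n : in_square C D -> 0 < C -> 0 < r -> 0 < s ->
  cnt (Pset D r s) = cnt (Pset D (r / mu ^+ n) (s * mu ^+ n)).
Proof.
move=> DC C0 r0 s0; rewrite [in LHS](Pset_unit D r s n).
have m0 : 0 < mu ^+ n by rewrite exprn_gt0 // mu_gt0.
rewrite cnt_image //.
  by apply: (Pset_finite DC); rewrite ?divr_gt0 ?mulr_gt0.
move=> x y _ _ /(congr1 (scal (mu ^- n))).
by rewrite !scalK // lt0r_neq0.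
Qed.

Lemma mu_normalize s : 0 < s -> s <= 1 -> exists n, 1 <= s * mu ^+ n <= mu.
Proof.
move=> s0 s1.
have ex : exists n, 1 <= s * mu ^+ n.
  exists (Num.truncn s^-1).+1; rewrite -ler_pdivrMl // mulr1.
  apply: le_trans (ltW (truncnS_gt _)) _.
  set k := (_).+1; have : k%:R <= 2 ^+ k :> R by rewrite -natrX ler_nat ltnW // ltn_expl.
  move=> h; apply: le_trans h _; apply: lerXn2r; rewrite ?nnegrE //;
    by have := mu_gt5 R; lra.
case: (ex_minnP ex) => n hn nmin; exists n; rewrite hn /=.
case: n hn nmin => [|n] hn nmin.
  by rewrite expr0 mulr1; have := mu_gt5 R; lra.
have : s * mu ^+ n < 1 by rewrite ltNge; apply/negP => /nmin; rewrite ltnn.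
move=> h; rewrite exprSr mulrA -[leRHS]mul1r ler_pM2r ?mu_gt0 //.
exact: ltW.
Qed.

(** Units bring s into [1, mu], so that one conjugate box serves all cases. By [Tset_norm] the new
    r' is then bounded below unless the set is empty, and the additive constants of the strip counts
    are at most multiples of r'. *)
Lemma Pset_bound (C : R) D : in_square C D -> 0 < C ->
  exists2 K, 0 < K & forall r s, 0 < r -> 0 < s -> s <= 1 ->
    (cnt (Pset D r s))%:R <= K * (r * s) ^+ 2.
Proof.
move=> DC C0; have mu5 := mu_gt5 R; have s20 := sqrt2_gt0 R.
have m0 : 0 < 2 * mu by lra.
have pm := proper_square m0.
have le : - (2 * mu) <= 2 * (2 * mu) by lra.
have [C1 C10 h1] := @strip_count R 0 _ _ 1 le ltr01.
have [C2 C20 h2] := @strip_count R 1 _ _ 1 le ltr01.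
(* The terms are, per unit of r': the main term of a strip, its error with eps = 1 over an interval
   of length 3 C, and C1 + C2 multiplied by 2 C mu, where 2 C mu r' >= 1. *)
pose k := 3 * C * (2 * (2 * mu) - - (2 * mu)) / (4 * s2) + 3 * C + (C1 + C2) * (2 * C * mu).
have k0 : 0 < k.
  rewrite /k; have : 0 <= 3 * C * (2 * (2 * mu) - - (2 * mu)) / (4 * s2).
    by apply: divr_ge0; [apply: mulr_ge0; lra|lra].
  have : 0 <= (C1 + C2) * (2 * C * mu) by apply: mulr_ge0; [lra|apply: mulr_ge0; lra].
  lra.
exists (2 * k ^+ 2) => [|r s r0 s0 s1]; first by rewrite mulr_gt0 // exprn_gt0.
have [n /andP[n1 n2]] := mu_normalize s0 s1.
rewrite (Pset_unit_cnt n DC C0 r0 s0).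
have mun : 0 < mu ^+ n by rewrite exprn_gt0 // mu_gt0.
have -> : r * s = (r / mu ^+ n) * (s * mu ^+ n) by field; rewrite gt_eqF.
have r0' : 0 < r / mu ^+ n by rewrite divr_gt0.
move: n1 n2; set s' := s * _; set r' := r / _ in r0' * => n1 n2.
have s0' : 0 < s' by lra.
have [->|/set0P[x Px]] := eqVneq (Pset D r' s') set0.
  by rewrite cnt0 mulr_ge0 ?sqr_ge0 // mulr_ge0 ?sqr_ge0.
have := Tset_norm DC C0 r0' s0' (Pset_Tset Px) => big.
have r1 : 1 <= 2 * C * mu * r'.
  apply: le_trans big _; have -> : 2 * C * mu * r' = 2 * C * (r' * mu) by ring.
  by rewrite ler_pM2l ?ler_pM2l //; lra.
have sub : Pset D r' s' `<=` Lbox r' (square C) (square (2 * mu)).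
  by move=> y /Pset_Tset; exact: Tset_sub_Lbox.
have fin := Lbox_finite r0' (proper_square C0) pm.
have {sub fin}: (cnt (Pset D r' s') <= cnt (Lbox r' (square C) (square (2 * mu))))%N.
  exact: cnt_le.
rewrite cnt_Lbox //; last exact: proper_square.
rewrite -(ler_nat R) natrD !natrM /= => hc; apply: le_trans hc _.
have le' : r' * - C <= r' * (2 * C) by rewrite ler_pM2l //; lra.
have := (h1 _ _ le').2; have := (h2 _ _ le').2; rewrite /stretch /=.
set X := (cnt _)%:R; set Y := (cnt _)%:R.
have X0 : 0 <= X by rewrite ler0n.
have Y0 : 0 <= Y by rewrite ler0n.
rewrite !ler_norml => /andP[_ hX] /andP[_ hY].
have e1 : (r' * (2 * C) - r' * - C) * (2 * (2 * mu) - - (2 * mu)) / (4 * s2) =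
   r' * (3 * C * (2 * (2 * mu) - - (2 * mu)) / (4 * s2)) by ring.
rewrite e1 in hX; rewrite e1 in hY.
have kr : k * r' = r' * (3 * C * (2 * (2 * mu) - - (2 * mu)) / (4 * s2)) +
    3 * C * r' + (C1 + C2) * (2 * C * mu * r') by rewrite /k; ring.
have c12 : C1 + C2 <= (C1 + C2) * (2 * C * mu * r') by rewrite ler_peMr //; lra.
have XK : X <= k * r' by rewrite kr; lra.
have YK : Y <= k * r' by rewrite kr; lra.
have rs : r' <= r' * s' by rewrite ler_peMr // ltW.
have fin a : 0 <= a -> a <= k * r' -> a * a <= k ^+ 2 * (r' * s') ^+ 2.
  move=> a0 ak; rewrite -exprMn expr2.
  have ak' : a <= k * (r' * s') by apply: le_trans ak _; rewrite ler_pM2l.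
  exact: ler_pM.
have := fin _ X0 XK; have := fin _ Y0 YK.
by set Z := k ^+ 2 * _ => u v; rewrite -mulrA -/Z; lra.
Qed.

(** The annulus is a difference of two windows; its area is s^2 (4 (1 + sqrt2) - 4 (sqrt2 - 1)) = 8
    s^2, to be divided by the covolume 16. *)
Lemma Tset_cvg D d s : has_content D d -> (exists C, in_square C D /\ 0 < C) ->
  0 < s -> (cnt (Tset D r s))%:R / r ^+ 2 @[r --> +oo] --> d * s ^+ 2 / 2.
Proof.
move=> hD [C [DC C0]] s0; have /andP[s1 s3] := sqrt2_bounds R.
have ss := sqrt2_sqr R.
have s0' : 0 < s * (s2 - 1) by apply: mulr_gt0; lra.
have c1 := Lset_cvg hD (has_content_win s0).
have c2 := Lset_cvg hD (has_content_win s0').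
have c3 := cvgB c1 c2.
have -> : d * s ^+ 2 / 2 = d * (s ^+ 2 * (4 * (1 + s2))) / 16 -
    d * ((s * (s2 - 1)) ^+ 2 * (4 * (1 + s2))) / 16.
  have e : (s2 - 1) ^+ 2 * (1 + s2) = s2 - 1.
    transitivity ((s2 * s2 - 1) * (s2 - 1)); first by ring.
    by rewrite ss; ring.
  rewrite exprMn; transitivity (d * s ^+ 2 * (4 * (1 + s2) - 4 * (s2 - 1)) / 16).
    by field.
  by rewrite -[in LHS]e; field.
apply: (cvg_trans _ (c3 _)); apply: near_eq_cvg; near=> r.
have r0 : 0 < r by near: r; exact: nbhs_pinfty_gt.
change ((cnt (Lset r D (win s)))%:R / r ^+ 2 -
  (cnt (Lset r D (win (s * (s2 - 1)))))%:R / r ^+ 2 = (cnt (Tset D r s))%:R / r ^+ 2).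
rewrite -mulrBl; congr (_ / _).
have sub : Lset r D (win (s * (s2 - 1))) `<=` Lset r D (win s).
  move=> x [h1 h2 h3]; split=> //; apply: win_le h3.
  by rewrite ger_pMr //; lra.
have fin t : 0 < t -> finite_set (Lset r D (win t)).
  move=> t0; have t20 : 0 < 2 * t by lra.
  apply: sub_finite_set (Lbox_finite r0 (proper_square C0) (proper_square t20)).
  move=> x [hL hx /(win_coord (ltW t0))[w1 w2]]; have [d1 d2] := DC _ hx.
  split=> //; last by apply: inB_square.
  by rewrite -inB_dilate //; apply: inB_square.
have -> : cnt (Lset r D (win s)) =
    (cnt (Lset r D (win (s * (s2 - 1))%R)) + cnt (Tset D r s))%N.
  rewrite -cntU; [|exact: fin|exact: Tset_finite DC C0 r0 s0|].
    congr cnt; apply/seteqP; split=> [x [h1 h2 h3]|x [/sub //|[h1 h2 [h3 _]]//]].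
    by have [h|h] := pselect (win (s * (s2 - 1)) (conj2 x)); [left|right].
  by rewrite -subset0 => x [[_ _ h] [_ _ [_ h']]].
by rewrite natrD addrC addKr.
Unshelve. all: by end_near.
Qed.

(** For rational part a > 0 the admissible b are the a integers with - a <= 2 b < a, the least being
    minus the integer part of a / 2; normalised generators are thus indexed by pairs j < a. *)
Definition rep (a j : nat) : R := zs R a (j%:Z - (a./2)%:Z).

Lemma repP a j : (0 < a)%N -> (j < a)%N -> is_rep (rep a j).
Proof.
by move=> a0 ja; exists a%:Z, (j%:Z - (a./2)%:Z); split=> //; lia.
Qed.

Lemma rep_inj a j a' j' : rep a j = rep a' j' -> a = a' /\ j = j'.
Proof. by move=> /zs_inj [[->]] h; split=> //; lia. Qed.

Lemma rep_surj d : is_rep d -> exists a j, [/\ (0 < a)%N, (j < a)%N & d = rep a j].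
Proof.
move=> [a [b [-> a0 h1 h2]]]; exists (absz a), (absz (b + ((absz a)./2)%:Z)).
by split; [lia|lia|rewrite /rep; congr (zs _ _ _); lia].
Qed.

Lemma rep1 : rep 1 0 = 1.
Proof. by rewrite /rep zs_eq1. Qed.

Lemma rep_eq1 d : is_rep d -> d <> 1 ->
  exists a j, [/\ (1 < a)%N, (j < a)%N & d = rep a j].
Proof.
move=> rd d1; have [a [j [a0 ja dE]]] := rep_surj rd; exists a, j; split=> //.
rewrite ltn_neqAle a0 andbT; apply/eqP => a1; apply: d1; move: ja.
by rewrite dE -a1; case: j {dE} => // _; exact: rep1.
Qed.

(** |2 b| <= a gives 2 b^2 <= a^2 / 2, so the norm a^2 - 2 b^2 keeps at least half of a^2. *)
Lemma rep_norm a j : (0 < a)%N -> (j < a)%N ->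
  a%:R ^+ 2 / 2 <= rep a j * conjK (rep a j).
Proof.
move=> a0 ja; rewrite norm_zs ler_pdivrMr // -natrX.
have -> : 2 = 2%:~R :> R by [].
rewrite -intrM pmulrn ler_int.
have : `|2 * (j%:Z - (a./2)%:Z)| <= a by lia.
rewrite expnS expn1; nia.
Qed.

Definition ratio_set D r s d := [set scal d y | y in Pset D (r / d) (s / conjK d)].

Lemma Tset_ratio D r s d : is_rep d -> 0 < r -> 0 < s ->
  ratio_set D r s d `<=` Tset D r s.
Proof.
move=> rd r0 s0 _ [y [uy hD ha] <-]; have d0 := rep_gt0 rd.
have c0 := rep_conj_ge1 rd; have hd := rep_OK rd.
split; first by apply: latL_scal => //; exact: uy.1.
  by move: hD; rewrite scalA invfM invrK.
rewrite conj2_scal //; last exact: uy.1.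
by rewrite annulus_scal //; lra.
Qed.

Lemma Tset_decomp D r s x : 0 < s -> Tset D r s x ->
  exists2 d, is_rep d & ratio_set D r s d x.
Proof.
move=> s0 [hL hD ha].
have xn : x <> (0, 0).
  by move=> xE; apply: (annulus_neq0 ha s0); rewrite xE /conj2 conj0.
have [d [y [rd uy xE]]] := latL_decomp hL xn; exists d => //.
have d0 := rep_gt0 rd; have c0 := rep_conj_ge1 rd; have hd := rep_OK rd.
exists y => //; split=> //.
  by move: hD; rewrite xE scalA invfM invrK.
move: ha; rewrite xE conj2_scal //; last exact: uy.1.
by rewrite annulus_scal //; lra.
Qed.

(** Existence and uniqueness of x = d y partition the set by d; the pair (1, 0), that is d = 1, is
    the leading term. The cut-off is justified by the norm: a nonempty class needs norm of d at most
    2 C r s, while this norm is at least a^2 / 2 >= a / 2. *)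
Lemma Tset_sum (C : R) D r s M : in_square C D -> 0 < C -> 0 < r -> 0 < s ->
  4 * C * (r * s) < M%:R ->
  cnt (Tset D r s) = (cnt (Pset D r s) +
    \sum_(2 <= a < M) \sum_(0 <= j < a)
      cnt (Pset D (r / rep a j) (s / conjK (rep a j))))%N.
Proof.
move=> DC C0 r0 s0 hM.
pose idx := [seq (a, j) | a <- index_iota 2 M, j <- index_iota 0 a].
pose l := (1%N, 0%N) :: idx.
have idxP p : p \in idx -> (1 < p.1 < M)%N && (p.2 < p.1)%N.
  by move=> /allpairsPdep[a [j [+ + ->]]]; rewrite !mem_index_iota /= => -> ->.
have lP p : p \in l -> is_rep (rep p.1 p.2).
  rewrite inE => /orP[/eqP -> /=|/idxP /andP[/andP[h1 h2] h3]].
    exact: repP.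
  by apply: repP => //; apply: ltn_trans h1.
have ul : uniq l.
  rewrite /= ; apply/andP; split; first by apply/negP => /idxP.
  apply: allpairs_uniq_dep; [exact: iota_uniq|by move=> a _; exact: iota_uniq|].
  by case=> a j [a' j'] _ _ /= [-> ->].
pose F p := ratio_set D r s (rep p.1 p.2).
have finF p : p \in l -> finite_set (F p).
  move=> pl; apply: sub_finite_set (Tset_ratio (lP _ pl) r0 s0) _.
  exact: Tset_finite DC C0 r0 s0.
have cntF p : p \in l -> cnt (F p) =
    cnt (Pset D (r / rep p.1 p.2) (s / conjK (rep p.1 p.2))).
  move=> pl; have rd := lP _ pl.
  have d0 := rep_gt0 rd; have c0 := rep_conj_ge1 rd; rewrite /F /ratio_set cnt_image //.
    by apply: (Pset_finite DC) => //; apply: divr_gt0 => //; lra.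
  move=> x y _ _ /(congr1 (scal (rep p.1 p.2)^-1)).
  by rewrite !scalK // lt0r_neq0.
have -> : (cnt (Pset D r s) + \sum_(2 <= a < M) \sum_(0 <= j < a)
      cnt (Pset D (r / rep a j) (s / conjK (rep a j))) = \sum_(p <- l) cnt (F p))%N.
  rewrite big_cons (cntF _ (mem_head _ _)) /= rep1 conj1 !divr1; congr addn.
  rewrite [RHS]big_seq (eq_bigr (fun p => cnt (Pset D (r / rep p.1 p.2) (s / conjK (rep p.1 p.2))))).
    by rewrite -big_seq big_allpairs_dep.
  by move=> p pi; rewrite cntF // inE pi orbT.
apply/eqP; rewrite eqn_leq; apply/andP; split.
  apply: (cnt_cover finF _).2 => x hx.
  have [d rd [y hy xE]] := Tset_decomp s0 hx.
  have [d1|d1] := pselect (d = 1).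
    by exists (1%N, 0%N); [exact: mem_head|rewrite /F /= rep1 -d1; exists y].
  have [a [j [a1 ja dE]]] := rep_eq1 rd d1.
  exists (a, j); last by rewrite /F /= -dE; exists y.
  rewrite inE; apply/orP; right; apply/allpairsPdep; exists a, j.
  rewrite !mem_index_iota a1 ja; split=> //=.
  have d0 := rep_gt0 rd; have c0 := rep_conj_ge1 rd.
  rewrite -(ltr_nat R); apply: le_lt_trans hM.
  have r0' : 0 < r / d by rewrite divr_gt0.
  have c0' : 0 < conjK d by lra.
  have s0' : 0 < s / conjK d by rewrite divr_gt0.
  have := Tset_norm DC C0 r0' s0' (Pset_Tset hy).
  rewrite mulf_div [2 * C * (_ / _)]mulrA ler_pdivlMr ?mulr_gt0 // mul1r => h.
  have a0 : (0 < a)%N by apply: ltn_trans a1.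
  have := rep_norm a0 ja; rewrite -dE => h2.
  have a1' : 1 <= a%:R :> R by rewrite ler1n.
  have : a%:R <= a%:R ^+ 2 :> R by rewrite expr2 ler_peMr //; lra.
  have -> : 4 * C * (r * s) = 2 * (2 * C * (r * s)) by ring.
  lra.
apply: cnt_pack => //; first exact: Tset_finite DC C0 r0 s0.
  by move=> p pl; exact: Tset_ratio (lP _ pl) r0 s0.
move=> p q pl ql npq; rewrite -subset0 => _ [[x [ux _ _] <-] [y [uy _ _] E]].
have [e _] := latL_decomp_unique (lP _ ql) (lP _ pl) uy ux E.
have [e1 e2] := rep_inj e; move: npq.
by rewrite [p]surjective_pairing [q]surjective_pairing e1 e2 eqxx.
Qed.

End sieve.

(** * Partial sums of the zeta series and the contraction of the error *)

Section contraction.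
Variable R : realType.
Local Notation s2 := (sqrt2 R).
Implicit Types (D : set (R * R)) (r s : R).

Definition rnorm (a j : nat) : R := rep R a j * conjK (rep R a j).

Definition zeta_part (m n : nat) : R :=
  \sum_(m <= a < n) \sum_(0 <= j < a) (rnorm a j ^+ 2)^-1.

Lemma rnorm_ge a j : (0 < a)%N -> (j < a)%N -> a%:R ^+ 2 / 2 <= rnorm a j.
Proof. exact: rep_norm. Qed.

Lemma rnorm_gt0 a j : (0 < a)%N -> (j < a)%N -> 0 < rnorm a j.
Proof.
move=> a0 ja; apply: lt_le_trans (rnorm_ge a0 ja).
by rewrite divr_gt0 // exprn_gt0 // ltr0n.
Qed.

Lemma zeta_term_ge0 a : 0 <= \sum_(0 <= j < a) (rnorm a j ^+ 2)^-1.
Proof.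
by apply: sumr_ge0 => j _; rewrite invr_ge0 sqr_ge0.
Qed.

Lemma zeta_part_ge0 m n : 0 <= zeta_part m n.
Proof. by apply: sumr_ge0 => a _; exact: zeta_term_ge0. Qed.

Lemma zeta_part_cat m n p : (m <= n)%N -> (n <= p)%N ->
  zeta_part m p = zeta_part m n + zeta_part n p.
Proof. by move=> mn np; rewrite /zeta_part (big_cat_nat mn np). Qed.

Lemma zeta_term_le a : (0 < a)%N ->
  \sum_(0 <= j < a) (rnorm a j ^+ 2)^-1 <= 4 / a%:R ^+ 3.
Proof.
move=> a0; have a0' : 0 < a%:R :> R by rewrite ltr0n.
have h : \sum_(0 <= j < a) (rnorm a j ^+ 2)^-1 <= \sum_(0 <= j < a) (4 / a%:R ^+ 4 : R).
  apply: ler_sum_nat => j /andP[_ ja].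
  have n0 := rnorm_gt0 a0 ja; have nl := rnorm_ge a0 ja.
  have -> : 4 / a%:R ^+ 4 = ((a%:R ^+ 2 / 2) ^+ 2)^-1 :> R by field; rewrite gt_eqF.
  rewrite lef_pV2 ?posrE ?exprn_gt0 ?divr_gt0 ?exprn_gt0 //.
  by apply: lerXn2r => //; rewrite nnegrE ltW // divr_gt0 // exprn_gt0.
apply: le_trans h _; rewrite sumr_const_nat subn0 -[_ *+ a]mulr_natr.
by have -> : 4 / a%:R ^+ 4 * a%:R = 4 / a%:R ^+ 3 :> R by field; rewrite gt_eqF.
Qed.

(** a = 2 contributes at most 4 / 2^3 = 1/2. For a >= 3 the bound 4 / a^3 is majorised by 4 / ((a -
    1) a (a + 1)), which telescopes to 2 / (2 * 3) = 1/3. What the contraction needs is a bound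
    below 1. *)
Lemma zeta_part_bound n : zeta_part 2 n <= 5 / 6.
Proof.
have h k : zeta_part 3 (k + 3) <= 1 / 3 - 2 / ((k%:R + 2) * (k%:R + 3)).
  elim: k => [|k IHk].
    by rewrite add0n /zeta_part big_geq // !add0r; lra.
  rewrite addSn /zeta_part big_nat_recr ?leq_addl //= -/(zeta_part 3 (k + 3)).
  have k0 : 0 <= k%:R :> R by [].
  have t := @zeta_term_le (k + 3); rewrite addnS in t; have {}t := t isT.
  have e : (k + 2).+1%:R = k%:R + 3 :> R by rewrite -addnS natrD.
  rewrite e in t; rewrite -addnS in t.
  have kk : k.+1%:R = k%:R + 1 :> R by rewrite -natr1.
  have le : 4 / (k%:R + 3) ^+ 3 <= 2 / ((k%:R + 2) * (k%:R + 3)) -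
      2 / ((k.+1%:R + 2) * (k.+1%:R + 3)) :> R.
    rewrite kk.
    have -> : 2 / ((k%:R + 2) * (k%:R + 3)) - 2 / ((k%:R + 1 + 2) * (k%:R + 1 + 3)) =
       4 / ((k%:R + 2) * (k%:R + 3) * (k%:R + 4)) :> R.
      by field; rewrite !gt_eqF //; lra.
    rewrite ler_pM2l // lef_pV2 ?posrE.
    - set x : R := k%:R in k0 *; nra.
    - by rewrite exprn_gt0 //; lra.
    - by rewrite !mulr_gt0 //; lra.
  lra.
have z2 : \sum_(0 <= j < 2) (rnorm 2 j ^+ 2)^-1 <= 1 / 2 :> R.
  by apply: le_trans (@zeta_term_le 2 isT) _; lra.
have [n3|n3] := leqP 3 n.
  rewrite (@zeta_part_cat 2 3 n) // {1}/zeta_part big_nat1.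
  have := h (n - 3)%N; rewrite subnK //.
  have : 0 <= 2 / (((n - 3)%:R + 2) * ((n - 3)%:R + 3)) :> R.
    by rewrite divr_ge0 // mulr_ge0 // addr_ge0.
  lra.
by rewrite /zeta_part big_geq //; lra.
Qed.

(** The error budget of one improvement step. S1 is the error of the finitely many small d, S2 that
    of the tail, and z1, z2 are their zeta weights. The small d cost (5/6) th; the error of T, the
    truncation of Z and the tail cost dl (1 + k + A) = th / 12 together. The new factor is 5/6 +
    1/12 = 11/12. *)
Lemma contraction_arith (p t S1 S2 k Z X th z1 z2 A dl : R) :
  0 <= X -> 0 <= k -> 0 <= A -> 0 <= th ->
  - (th * X * z1) <= S1 <= th * X * z1 ->
  - (A * X * z2) <= S2 <= A * X * z2 ->
  - (dl * X) <= t - k * Z * X <= dl * X ->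
  t = p + (S1 + S2 + k * X * (z1 + z2)) ->
  1 + (z1 + z2) <= Z -> Z - dl <= 1 + z1 -> 0 <= z2 -> z1 <= 5 / 6 ->
  dl * (1 + k + A) = th / 12 ->
  - (th * (11 / 12) * X) <= p - k * X <= th * (11 / 12) * X.
Proof.
move=> X0 k0 A0 t0 /andP[e1 e2] /andP[e3 e4] /andP[e5 e6] e7 hZ hd z20 z15 hdl.
have kX : 0 <= k * X by apply: mulr_ge0.
have f1 : 0 <= k * X * (Z - 1 - z1 - z2) by apply: mulr_ge0 => //; lra.
have f2 : k * X * (Z - 1 - z1 - z2) <= k * X * dl by apply: ler_wpM2l => //; lra.
have f3 : th * X * z1 <= th * X * (5 / 6).
  by apply: ler_wpM2l => //; apply: mulr_ge0.
have f4 : A * X * z2 <= A * X * dl.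
  by apply: ler_wpM2l; [apply: mulr_ge0|lra].
have f5 : dl * (1 + k + A) * X = th / 12 * X by rewrite hdl.
by apply/andP; split; lra.
Qed.

Lemma Pset_cvg D d Z : has_content D d -> (exists C, in_square C D /\ 0 < C) ->
  (forall M, 1 + zeta_part 2 M <= Z) ->
  (forall eps, 0 < eps -> exists M, Z - eps <= 1 + zeta_part 2 M) ->
  (cnt (Pset D r 1))%:R / r ^+ 2 @[r --> +oo] --> d / (2 * Z).
Proof.
move=> hD exC Zub Zlim; have [C [DC C0]] := exC.
have d0 := has_content_ge0 hD.
have Z1 : 1 <= Z by apply: le_trans (Zub 2); rewrite lerDl zeta_part_ge0.
have Z2 : Z <= 11 / 6.
  apply/ler_addgt0Pl => e e0; have [M hM] := Zlim _ e0.
  by have := zeta_part_bound M; lra.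
have [K K0 hK] := Pset_bound DC C0.
set kap := d / (2 * Z).
have kap0 : 0 <= kap by apply: divr_ge0; lra.
pose A := K + kap; have A0 : 0 < A by rewrite /A; lra.
have base r s : 0 < r -> 0 < s -> s <= 1 ->
    `|(cnt (Pset D r s))%:R - kap * (r * s) ^+ 2| <= A * (r * s) ^+ 2.
  move=> r0 s0 s1; have := hK _ _ r0 s0 s1.
  have : 0 <= (cnt (Pset D r s))%:R :> R by [].
  set p := (cnt _)%:R; set X := (r * s) ^+ 2 => p0 pK.
  have X0 : 0 <= X by exact: sqr_ge0.
  have kX : 0 <= kap * X by apply: mulr_ge0.
  have KX : 0 <= K * X by apply: mulr_ge0 => //; lra.
  by rewrite ler_norml /A mulrDl; apply/andP; split; lra.
pose th : R := 11 / 12.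
have th0 : 0 < th by rewrite /th; lra.
(* The induction is over n for all s at once, because the step at s calls the hypothesis at s / conj
   d. The threshold in r may depend on s. *)
have S n s : 0 < s -> s <= 1 -> \forall r \near +oo,
    `|(cnt (Pset D r s))%:R - kap * (r * s) ^+ 2| <= A * th ^+ n * (r * s) ^+ 2.
  elim: n s => [|n IHn] s s0 s1.
    apply: filterS (nbhs_pinfty_gt (num_real (0 : R))) => r r0.
    by rewrite expr0 mulr1; exact: base.
  have thn0 : 0 < th ^+ n by rewrite exprn_gt0.
  (* Chosen so that dl (1 + kap + A) is one twelfth of the current error. *)
  pose dl := A * th ^+ n / (12 * (1 + kap + A)).
  have dl0 : 0 < dl by rewrite divr_gt0 ?mulr_gt0 //; lra.
  (* Below M the induction hypothesis is used for finitely many pairs, so one threshold in r serves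
     them all; from M on the zeta tail is at most dl and the crude bound [base] is enough. *)
  have [M M2 hM] : exists2 M, (2 <= M)%N & Z - dl <= 1 + zeta_part 2 M.
    have [M hM] := Zlim _ dl0; exists (maxn 2 M); first exact: leq_maxl.
    apply: le_trans hM _; rewrite lerD2l.
    have [//|M2] := leqP 2 M.
    by rewrite {1}/zeta_part big_geq ?(ltnW M2) // zeta_part_ge0.
  have dls2 : 0 < dl * s ^+ 2 by rewrite mulr_gt0 // exprn_gt0.
  have small : \forall r \near +oo, forall a j, (1 < a < M)%N -> (j < a)%N ->
      `|(cnt (Pset D (r / rep R a j) (s / conjK (rep R a j))))%:R -
        kap * (r * s) ^+ 2 / rnorm a j ^+ 2| <= A * th ^+ n * (r * s) ^+ 2 / rnorm a j ^+ 2.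
    have key : \forall r \near +oo, forall p : 'I_M * 'I_M, (1 < p.1)%N -> (p.2 < p.1)%N ->
      `|(cnt (Pset D (r / rep R p.1 p.2) (s / conjK (rep R p.1 p.2))))%:R -
        kap * (r * s) ^+ 2 / rnorm p.1 p.2 ^+ 2| <=
          A * th ^+ n * (r * s) ^+ 2 / rnorm p.1 p.2 ^+ 2.
      apply: filter_forall => -[a j] /=.
      have [a1|a1] := leqP 2 a; last by apply: nearW => r.
      have [ja|ja] := ltnP j a; last by apply: nearW => r _.
      have a0 : (0 < a)%N by apply: ltn_trans a1.
      have rd := repP R a0 ja; have rd0 := rep_gt0 rd; have rc1 := rep_conj_ge1 rd.
      have rc0 : 0 < conjK (rep R a j) by lra.
      have sc0 : 0 < s / conjK (rep R a j) by rewrite divr_gt0.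
      have sc1 : s / conjK (rep R a j) <= 1 by rewrite ler_pdivrMr //; lra.
      have [R0 [_ hR0]] := IHn _ sc0 sc1.
      (* The hypothesis is applied at r / d, so its threshold is multiplied by d. *)
      exists (R0 * rep R a j); split; first exact: num_real.
      move=> r hr _ _; have := hR0 (r / rep R a j); rewrite ltr_pdivlMr // => /(_ hr).
      have -> : (r / rep R a j * (s / conjK (rep R a j))) ^+ 2 =
        (r * s) ^+ 2 / rnorm a j ^+ 2.
        by rewrite /rnorm mulf_div expr_div_n.
      by rewrite !mulrA.
    apply: filterS key => r h a j /andP[a1 aM] ja.
    exact: h (Ordinal aM, Ordinal (ltn_trans ja aM)) a1 ja.
  have Tlim := Tset_cvg hD exC s0.
  have Tnear : \forall r \near +oo,
      `|d * s ^+ 2 / 2 - (cnt (Tset D r s))%:R / r ^+ 2| <= dl * s ^+ 2.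
    by move/cvgrPdist_le: Tlim => /(_ _ dls2).
  apply: filterS3 (nbhs_pinfty_gt (num_real (0 : R))) small Tnear => r r0 hsmall hT.
  (* M' grows with r to exceed the cut-off of [Tset_sum], whereas M is fixed. *)
  pose M' := maxn (maxn 2 M) (Num.truncn (4 * C * (r * s))).+1.
  have hM' : 4 * C * (r * s) < M'%:R.
    by apply: lt_le_trans (truncnS_gt _) _; rewrite ler_nat leq_maxr.
  have M'2 : (2 <= M')%N by rewrite /M' -maxnA leq_maxl.
  have MM' : (M <= M')%N by rewrite /M' maxnAC leq_maxr.
  have := Tset_sum DC C0 r0 s0 hM'.
  move/(congr1 (fun k : nat => k%:R : R)); rewrite natrD natr_sum.
  under eq_bigr do rewrite natr_sum.
  pose X := (r * s) ^+ 2; have X0 : 0 <= X by exact: sqr_ge0.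
  pose P a j : R := (cnt (Pset D (r / rep R a j) (s / conjK (rep R a j))))%:R.
  pose E a j := P a j - kap * X / rnorm a j ^+ 2.
  rewrite -[X in _ = _ + X]/(\sum_(2 <= a < M') \sum_(0 <= j < a) P a j).
  have -> : \sum_(2 <= a < M') \sum_(0 <= j < a) P a j =
      \sum_(2 <= a < M') \sum_(0 <= j < a) E a j + kap * X * zeta_part 2 M'.
    rewrite /zeta_part mulr_sumr -big_split; apply: eq_bigr => a _ /=.
    rewrite mulr_sumr -big_split; apply: eq_bigr => j _ /=.
    by rewrite /E subrK.
  have sumE (B : R) m k : (2 <= m)%N ->
      (forall a j, (m <= a < k)%N -> (j < a)%N -> `|E a j| <= B * X / rnorm a j ^+ 2) ->
      `|\sum_(m <= a < k) \sum_(0 <= j < a) E a j| <= B * X * zeta_part m k.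
    move=> m2 hE; rewrite /zeta_part mulr_sumr; apply: le_trans (ler_norm_sum _ _ _) _.
    apply: ler_sum_nat => a ak; rewrite mulr_sumr; apply: le_trans (ler_norm_sum _ _ _) _.
    by apply: ler_sum_nat => j /andP[_ ja]; exact: hE.
  rewrite (big_cat_nat M2 MM') /=.
  have E1 := sumE _ _ _ (leqnn 2) hsmall.
  have E2 : `|\sum_(M <= a < M') \sum_(0 <= j < a) E a j| <= A * X * zeta_part M M'.
    apply: sumE => // a j /andP[aM _] ja.
    have a0 : (0 < a)%N by apply: leq_trans aM; apply: leq_trans M2.
    have rd := repP R a0 ja; have rd0 := rep_gt0 rd; have rc1 := rep_conj_ge1 rd.
    have rc0 : 0 < conjK (rep R a j) by lra.
    have sc0 : 0 < s / conjK (rep R a j) by rewrite divr_gt0.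
    have sc1 : s / conjK (rep R a j) <= 1 by rewrite ler_pdivrMr //; lra.
    have rr0 : 0 < r / rep R a j by rewrite divr_gt0.
    have := base _ _ rr0 sc0 sc1.
    have -> : (r / rep R a j * (s / conjK (rep R a j))) ^+ 2 = X / rnorm a j ^+ 2.
      by rewrite /rnorm mulf_div expr_div_n.
    by rewrite /E /P !mulrA.
  have zc := zeta_part_cat M2 MM'.
  have zu := Zub M'.
  have zb := zeta_part_bound M.
  have z0 := zeta_part_ge0 M M'.
  have T1 : `|(cnt (Tset D r s))%:R - kap * Z * X| <= dl * X.
    have r20 : 0 < r ^+ 2 by rewrite exprn_gt0.
    set t := (cnt _)%:R in hT *.
    have -> : t - kap * Z * X = - ((d * s ^+ 2 / 2 - t / r ^+ 2) * r ^+ 2).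
      by rewrite /kap /X; field; apply/andP; split; rewrite gt_eqF //; lra.
    have -> : dl * X = dl * s ^+ 2 * r ^+ 2 by rewrite /X; ring.
    by rewrite normrN normrM (gtr0_norm r20) ler_pM2r.
  have dlE : dl * (1 + kap + A) = A * th ^+ n / 12 by rewrite /dl; field; lra.
  clearbody dl.
  move: E1 E2 T1; rewrite -/X.
  set p := (cnt (Pset D r s))%:R; set t := (cnt (Tset D r s))%:R.
  set S1 := \sum_(2 <= a < M) _; set S2 := \sum_(M <= a < M') _.
  set th' := A * th ^+ n in dlE *.
  set z1 := zeta_part 2 M in zc zb hM *; set z2 := zeta_part M M' in zc z0 *.
  rewrite zc in zu *.
  have thE : A * th ^+ n.+1 = th' * (11 / 12) by rewrite exprS /th' /th; ring.
  rewrite thE !ler_norml => /andP[e1 e2] /andP[e3 e4] /andP[e5 e6] e7.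
  apply: (contraction_arith (t := t) (Z := Z) (A := A) (dl := dl) (z1 := z1)
    (z2 := z2) (S1 := S1) (S2 := S2)) => //; first exact: ltW.
  - by rewrite mulr_ge0 // ltW.
  - by apply/andP; split.
  - by apply/andP; split.
  - by apply/andP; split.
apply/cvgrPdist_le => eps eps0.
have [n hn] : exists n, A * th ^+ n <= eps.
  have [n hn] : exists n : nat, 12 * A / eps < n%:R.
    by exists (Num.truncn (12 * A / eps)).+1; exact: truncnS_gt.
  (* Bernoulli: th^-1 = 12/11 and th^-n >= 1, so each step adds at least 1/11 >= 1/12. *)
  exists n; have pw : n%:R / 12 <= th ^- n.
    elim: n {hn} => [|n IHn]; first by rewrite mul0r expr0 invr1.
    have : 1 <= th ^- n.
      by rewrite -exprVn exprn_ege1 // /th; lra.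
    rewrite exprS invfM -natr1; have -> : th^-1 = 1 + 1 / 11 by rewrite /th; lra.
    set y := th ^- n in IHn *; lra.
  rewrite ltr_pdivrMr // in hn.
  rewrite -ler_pdivlMr ?exprn_gt0 //.
  have : eps * (n%:R / 12) <= eps * th ^- n by rewrite ler_pM2l.
  lra.
apply: filterS2 (nbhs_pinfty_gt (num_real (0 : R))) (S n 1 ltr01 (lexx 1)) => r r0.
have r20 : 0 < r ^+ 2 by rewrite exprn_gt0.
rewrite mulr1; set p := (cnt _)%:R => h.
have -> : kap - p / r ^+ 2 = - ((p - kap * r ^+ 2) / r ^+ 2) by field; lra.
rewrite normrN normrM normfV (gtr0_norm r20) ler_pdivrMr //.
by apply: le_trans h _; rewrite ler_pM2r.
Qed.

End contraction.

(** * The value of the zeta function *)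

Section zeta_value.
Variable R : realType.
Local Notation OKR := (@OK R).

Definition pideal (d : R) : set R := [set d * z | z in OKR].

Lemma pideal_ideal d : OKR d -> is_ideal OKR (pideal d).
Proof.
move=> hd; split.
- by move=> _ [z hz <-]; exact: OKM.
- by exists 0; [exact: OK0|rewrite mulr0].
- move=> _ _ [z hz <-] [w hw <-]; exists (z + w); first exact: OKD.
  by rewrite mulrDr.
- move=> x _ hx [z hz <-]; exists (x * z); first exact: OKM.
  by rewrite mulrCA.
Qed.

Lemma cnt_II n : cnt `I_n = n.
Proof.
by rewrite /cnt fset_set_II card_imfset /=; [exact: size_enum_ord|exact: val_inj].
Qed.

(* Hermite normal form: with c = gcd(a, b), the ideal (a + b sqrt2) is spanned
   over Z by n / c and some t + c sqrt2, where n is the norm. *)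
Lemma ideal_norm_pideal (a b : int) : 0 < a * a - 2 * (b * b) ->
  ideal_norm OKR (pideal (zs R a b)) = absz (a * a - 2 * (b * b))%R.
Proof.
set n := a * a - 2 * (b * b) => n0.
have a0 : a != 0 by apply/eqP => aE; move: n0; rewrite /n aE; nia.
pose c := gcdz a b; have c0 : 0 < c by rewrite /c /gcdz ltz_nat gcdn_gt0 absz_gt0 a0.
have cn0 : c != 0 by lia.
have [a' aE] : exists a', a = a' * c by apply/dvdzP; exact: dvdz_gcdl.
have [b' bE] : exists b', b = b' * c by apply/dvdzP; exact: dvdz_gcdr.
have [u [v uv]] : exists u v, u * a + v * b = c.
  by have [u [v uv]] := Bezoutz a b; exists u, v.
have uv' : u * a' + v * b' = 1.
  by apply: (mulIf cn0); rewrite mul1r -[in RHS]uv aE bE; ring.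
pose m := (a' * a' - 2 * (b' * b')) * c.
have nm : n = m * c by rewrite /n /m aE bE; ring.
have m0 : 0 < m by move: n0; rewrite nm pmulr_lgt0.
have mn0 : m != 0 by rewrite gt_eqF.
have hd := OK_zs R a b.
have [IO I0 ID IM] := pideal_ideal hd.
have IN x : pideal (zs R a b) x -> pideal (zs R a b) (- x).
  by move=> h; rewrite -mulN1r; apply: IM => //; apply: OKN; exact: OK1.
have Im : pideal (zs R a b) (zs R m 0).
  exists (zs R a' (- b')); first exact: OK_zs.
  by rewrite zsM; congr (zs _ _ _); rewrite /m aE bE; ring.
have [t Ic] : exists t, pideal (zs R a b) (zs R t c).
  exists (a * v + 2 * (b * u)); exists (zs R v u); first exact: OK_zs.
  by rewrite zsM; congr (zs _ _ _); rewrite -uv; ring.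
have small (x y k : int) : x = k * y -> `|x| < y -> k = 0.
  move=> -> h; apply/eqP; rewrite -absz_eq0; apply/negPn; rewrite -lt0n; apply/negP => k0.
  move: h; rewrite normrM => h.
  have : `|y| <= `|k| * `|y| by apply: ler_peMl => //; lia.
  lia.
(* y is a multiple of c smaller than c, so it vanishes. As a' and b' are coprime, (p, q) is then
   (a', - b') times u p - v q, and x is the same multiple of m, hence 0 as well. *)
have ker x y : pideal (zs R a b) (zs R x y) -> `|x| < m -> `|y| < c -> x = 0 /\ y = 0.
  move=> [_ /OKP[p [q ->]]]; rewrite zsM => /zs_inj [ex ey] hx hy.
  have ey' : y = (a' * q + b' * p) * c by rewrite -ey aE bE; ring.
  have y0 : a' * q + b' * p = 0 by apply: small ey' hy.
  have yz : y = 0 by rewrite ey' y0 mul0r.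
  have pk : p = a' * (u * p - v * q).
    transitivity ((u * a' + v * b') * p - v * (a' * q + b' * p)).
      by rewrite uv' y0; ring.
    by ring.
  have qk : q = - b' * (u * p - v * q).
    transitivity ((u * a' + v * b') * q - u * (a' * q + b' * p)).
      by rewrite uv' y0; ring.
    by ring.
  have xk : x = (u * p - v * q) * m.
    rewrite -ex; move: pk qk; set k := u * p - v * q => -> ->.
    by rewrite /m aE bE; ring.
  by split=> //; rewrite xk (small _ _ _ xk hx) mul0r.
pose I := pideal (zs R a b).
pose coset (x : R) := [set x + y | y in I].
have coset_eq x y : coset x = coset y <-> I (x - y).
  split=> [e|h].
    have : coset x x by exists 0; rewrite ?addr0.
    by rewrite e => -[z Iz <-]; rewrite addrC addKr.
  apply/seteqP; split=> _ [z Iz <-].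
    by exists (x - y + z); [exact: ID|ring].
  by exists (z - (x - y)); [apply: ID => //; exact: IN|ring].
have dist (i i' : nat) (k : int) : 0 < k -> (i < absz k)%N -> (i' < absz k)%N ->
    `|i%:Z + - i'%:Z| < k by lia.
have sub0 (i i' : nat) : i%:Z + - i'%:Z = 0 -> i = i' by lia.
pose f (p : nat * nat) := coset (zs R p.1 p.2).
have cosE : [set [set x + y | y in I] | x in OKR] = f @` (`I_(absz m) `*` `I_(absz c)).
  apply/seteqP; split=> [_ [_ /OKP[p [q ->]] <-]|_ [[i j] _ <-]]; last first.
    by exists (zs R i j) => //; exact: OK_zs.
  (* Subtracting a multiple of t + c sqrt2 reduces the second coordinate modulo c and shifts the
     first one to p', which is then reduced modulo m. *)
  pose p' := p - (q %/ c)%Z * t.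
  exists (absz (p' %% m)%Z, absz (q %% c)%Z).
    have h1 := ltz_pmod p' m0; have h2 := modz_ge0 p' mn0.
    have h3 := ltz_pmod q c0; have h4 := modz_ge0 q cn0.
    have m0' := ltW m0; have c0' := ltW c0.
    by split; rewrite /mkset /fst /snd -ltz_nat !gez0_abs.
  rewrite /f /=; apply/coset_eq.
  have -> : zs R (absz (p' %% m)%Z) (absz (q %% c)%Z) - zs R p q =
     - (zs R (p' %/ m)%Z 0 * zs R m 0 + zs R (q %/ c)%Z 0 * zs R t c).
    rewrite !gez0_abs ?modz_ge0 // !zsM !zsD !zsN zsD.
    have e1 := divz_eq p' m; have e2 := divz_eq q c.
    move: e1 e2; set pm := (p' %% m)%Z; set pd := (p' %/ m)%Z; set qm := (q %% c)%Z.
    rewrite /p'; set qd := (q %/ c)%Z => e1 e2.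
    by congr (zs _ _ _); [have -> : p = pd * m + pm + qd * t by rewrite -e1; ring|rewrite e2];
      ring.
  by apply: IN; apply: ID; apply: IM => //; exact: OK_zs.
rewrite /ideal_norm -/I cosE -/(cnt _) cnt_image.
- by rewrite cntX ?cnt_II; [rewrite nm abszM|exact: finite_II|exact: finite_II].
- by apply: finite_setX; exact: finite_II.
- move=> [i j] [i' j']; rewrite !inE => -[/= i1 j1] [/= i2 j2] /coset_eq.
  rewrite zsN zsD => /ker h.
  by have [/sub0 /= -> /sub0 /= ->] := h (dist _ _ _ m0 i1 i2) (dist _ _ _ c0 j1 j2).
Qed.

Lemma rnorm_ideal a j : (0 < a)%N -> (j < a)%N ->
  (ideal_norm OKR (pideal (rep R a j)))%:R = rnorm R a j.
Proof.
move=> a0 ja; have := rnorm_gt0 R a0 ja.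
rewrite /rnorm /rep norm_zs ltr0z => n0.
by rewrite ideal_norm_pideal // natr_absz gtr0_norm.
Qed.

Definition repidx : set (nat * nat) := [set p | (0 < p.1)%N && (p.2 < p.1)%N].

(** Reindexes the sum over ideals by pairs (a, j). Two generators of the same ideal differ by a
    unit, so uniqueness of normalised generators gives injectivity. *)
Lemma ideals_bij : set_bij repidx [set I | is_ideal OKR I /\ I <> [set 0]]
  (fun p => pideal (rep R p.1 p.2)).
Proof.
split.
- move=> [a j] /= /andP[a0 ja].
  have rd := repP R a0 ja; split; first by apply: pideal_ideal; exact: rep_OK.
  move=> e; have : pideal (rep R a j) (rep R a j).
    by exists 1; [exact: OK1|rewrite mulr1].
  by rewrite e /= => d0; have := rep_gt0 rd; rewrite d0 ltxx.
- move=> [a j] [a' j']; rewrite !inE /= => /andP[a0 ja] /andP[a0' ja'] e.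
  have rd := repP R a0 ja; have rd' := repP R a0' ja'.
  have : pideal (rep R a j) (rep R a j) by exists 1; [exact: OK1|rewrite mulr1].
  rewrite e => -[u hu eu].
  have : pideal (rep R a' j') (rep R a' j') by exists 1; [exact: OK1|rewrite mulr1].
  rewrite -e => -[v hv ev].
  have uv : u * v = 1.
    apply: (mulfI (lt0r_neq0 (rep_gt0 rd'))); rewrite mulr1 mulrA eu; exact: ev.
  by have [/= -> ->] := rep_inj (rep_unique rd rd' hu hv uv (esym eu)).
- move=> I [iI I0]; have [g [hg g0 IE]] := ideal_principal iI I0.
  have [d [u [v [rd hu hv uv gE]]]] := rep_exists hg g0.
  have [a [j [a0 ja dE]]] := rep_surj rd.
  exists (a, j); first by rewrite /repidx /= a0.
  rewrite /= -dE IE; apply/seteqP; split=> _ [z hz <-].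
    exists (v * z); first exact: OKM.
    by rewrite gE -mulrA [u * _]mulrA uv mul1r.
  exists (u * z); first exact: OKM.
  by rewrite gE mulrA.
Qed.

(** The pair of d = 1 stands apart, so that the sum is 1 + [zeta_part 2 M] for every M, also for M <
    2. *)
Definition repseq M : seq (nat * nat) :=
  (1%N, 0%N) :: [seq (a, j) | a <- index_iota 2 M, j <- index_iota 0 a].

Lemma repseqP M p : p \in repseq M <-> repidx p /\ (p = (1%N, 0%N) \/ (p.1 < M)%N).
Proof.
case: p => a j; rewrite /repidx /= inE; split.
  case/orP => [/eqP[-> ->]|]; first by split=> //; left.
  move=> /allpairsPdep[a' [j' [+ + [-> ->]]]]; rewrite !mem_index_iota /=.
  by move=> /andP[a2 aM] ja; split; [lia|right].
move=> [/andP[a0 ja] [-> //|aM]]; have [a1|a1] := eqVneq a 1%N.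
  by rewrite a1 in ja *; case: j ja.
apply/orP; right; apply/allpairsPdep; exists a, j; rewrite !mem_index_iota.
by split=> //; lia.
Qed.

Lemma repseq_uniq M : uniq (repseq M).
Proof.
rewrite /=; apply/andP; split.
  apply/negP => /allpairsPdep[a [j [+ _ [ae _]]]].
  by rewrite mem_index_iota -ae.
apply: allpairs_uniq_dep; [exact: iota_uniq|by move=> a _; exact: iota_uniq|].
by case=> a j [a' j'] _ _ /= [-> ->].
Qed.

Lemma sum_repseq M : \sum_(p <- repseq M) (rnorm R p.1 p.2 ^+ 2)^-1 =
  1 + zeta_part R 2 M.
Proof.
rewrite big_cons big_allpairs_dep /=; congr (_ + _).
by rewrite /rnorm rep1 conj1 mulr1 expr1n invr1.
Qed.

Lemma ler_sum_sub (T : eqType) (s l : seq T) (f : T -> R) :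
  uniq s -> uniq l -> {subset s <= l} -> (forall x, 0 <= f x) ->
  \sum_(x <- s) f x <= \sum_(x <- l) f x.
Proof.
move=> us ul sl f0; rewrite [leRHS](bigID (mem s)) /=.
have -> : \sum_(x <- l | x \in s) f x = \sum_(x <- s) f x.
  rewrite -big_filter; apply: perm_big; apply: uniq_perm; rewrite ?filter_uniq //.
  move=> x; rewrite mem_filter; have [/sl ->|//] := boolP (x \in s); exact: andbT.
by rewrite lerDl sumr_ge0.
Qed.

(** Zeta at 2 is the supremum of the partial sums. Every finite set of pairs lies in some
    [repseq M], so the bound 11/6 makes the extended sum finite, and [fine] in the definition
    returns its true value. *)
Lemma dedekind_zetaP : let Z := dedekind_zeta (Qsqrt2 R) 2 in
  (forall M, 1 + zeta_part R 2 M <= Z) /\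
  (forall eps, 0 < eps -> exists M, Z - eps <= 1 + zeta_part R 2 M).
Proof.
move=> Z; pose g (p : nat * nat) : R := (rnorm R p.1 p.2 ^+ 2)^-1.
have g0 p : 0 <= g p by rewrite invr_ge0 sqr_ge0.
have ZE : Z = fine (\esum_(p in repidx) (g p)%:E).
  congr fine; rewrite (reindex_esum _ _ _ _ ideals_bij).
  apply: eq_esum => -[a j] /andP[a0 ja]; congr EFin.
  rewrite rnorm_ideal // powRN; congr (_^-1).
  by rewrite -[2]/(2%:R) powR_mulrn // ltW // rnorm_gt0.
set S := \esum_(p in repidx) _ in ZE.
have lo M : ((1 + zeta_part R 2 M)%:E <= S)%E.
  rewrite -sum_repseq; apply: esum_ge; exists [set` repseq M].
    split; first exact: finite_seq.
    by move=> p /repseqP[].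
  by rewrite -fsbig_seq ?repseq_uniq // sumEFin.
have up X : fsets repidx X -> exists M, (\sum_(p \in X) (g p)%:E <= (1 + zeta_part R 2 M)%:E)%E.
  move=> [fX XP]; rewrite fsbig_finite //= sumEFin.
  exists (\max_(p <- fset_set X) p.1).+1; rewrite lee_fin -sum_repseq.
  apply: ler_sum_sub => //; [exact: fset_uniq|exact: repseq_uniq|] => p pX.
  apply/repseqP; split; first by apply: XP; move: pX; rewrite in_fset_set // inE.
  by right; rewrite ltnS; exact: (@leq_bigmax_seq _ _ predT (fun q : nat * nat => q.1) p pX isT).
have Sfin : S \is a fin_num.
  rewrite ge0_fin_numE; last by apply: esum_ge0 => p _; rewrite lee_fin.
  apply: (@le_lt_trans _ _ (11 / 6 : R)%:E); last exact: ltry.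
  apply: ge_ereal_sup => _ [X fX <-]; have [M hM] := up _ fX.
  apply: le_trans hM _; rewrite lee_fin; have := zeta_part_bound R M; lra.
have SE : S = Z%:E by rewrite ZE fineK.
split=> [M|eps eps0]; first by have := lo M; rewrite SE lee_fin.
have [_ [X fX <-] h'] := ub_ereal_sup_adherent eps0 Sfin.
have [M hM] := up _ fX; exists M; move: h'.
rewrite -[ereal_sup _]/S SE => h.
by have := le_trans (ltW h) hM; rewrite -EFinB lee_fin.
Qed.

End zeta_value.

(** * Jordan measurable sets *)

Section jordan.
Variable R : realType.
Implicit Types (D : set (R * R)) (B : (R * R) * (R * R)).

Local Notation m := (@lebesgue_measure R \x @lebesgue_measure R)%E.

Definition bset B : set (R * R) := [set x | inB x B].

Lemma bsetE B : bset B = `[B.1.1, B.1.2[%classic `*` `[B.2.1, B.2.2[%classic.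
Proof.
apply/seteqP; split=> x; rewrite /bset /inB /inI /=.
  by move=> /andP[h1 h2]; split; rewrite /= in_itv.
by move=> [/=]; rewrite !in_itv /= => -> ->.
Qed.

Lemma measurable_bset B : measurable (bset B).
Proof. by rewrite bsetE; apply: measurableX; exact: measurable_itv. Qed.

Lemma measure_bset B : proper B -> m (bset B) = (barea B)%:E.
Proof.
move=> /andP[h1 h2]; rewrite bsetE product_measure1E; try exact: measurable_itv.
have e (a b : R) : a <= b -> lebesgue_measure `[a, b[%classic = (b - a)%:E.
  move=> ab; rewrite lebesgue_measure_itv /= lte_fin.
  by case: ltgtP ab => // -> _; rewrite subrr.
by rewrite /barea EFinM; congr (_ * _)%E; exact: e.
Qed.

Definition bunion (s : seq ((R * R) * (R * R))) : set (R * R) :=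
  [set x | exists2 B, B \in s & inB x B].

Lemma bunion_cons B s : bunion (B :: s) = bset B `|` bunion s.
Proof.
apply/seteqP; split=> [x [B']|x [hx|[B' hB' hx]]].
- by rewrite inE => /orP[/eqP -> ?|? ?]; [left|right; exists B'].
- by exists B; rewrite ?mem_head.
- by exists B'; rewrite // inE hB' orbT.
Qed.

Lemma bunion_nil : bunion [::] = set0.
Proof. by rewrite -subset0 => x []. Qed.

Lemma measurable_bunion s : measurable (bunion s).
Proof.
elim: s => [|B s IHs]; first by rewrite bunion_nil.
by rewrite bunion_cons; apply: measurableU => //; exact: measurable_bset.
Qed.

Lemma measure_bunion_le s : (forall B, B \in s -> proper B) ->
  (m (bunion s) <= (\sum_(B <- s) barea B)%:E)%E.
Proof.
elim: s => [|B s IHs] h; first by rewrite bunion_nil measure0 big_nil.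
rewrite bunion_cons big_cons EFinD.
apply: (@le_trans _ _ (m (bset B) + m (bunion s))%E).
  by apply: measureU2; [exact: measurable_bset|exact: measurable_bunion].
apply: leeD; first by rewrite measure_bset //; apply: h; rewrite mem_head.
by apply: IHs => B' hB'; apply: h; rewrite inE hB' orbT.
Qed.

Lemma measure_bunion s : (forall B, B \in s -> proper B) -> uniq s ->
  (forall B B' x, B \in s -> B' \in s -> inB x B -> inB x B' -> B = B') ->
  m (bunion s) = (\sum_(B <- s) barea B)%:E.
Proof.
elim: s => [|B s IHs] h; first by rewrite bunion_nil measure0 big_nil.
move=> /= /andP[Bs us] dis; rewrite bunion_cons big_cons EFinD.
have dis0 : bset B `&` bunion s = set0.
  rewrite -subset0 => x [hx [B' hB' hx']]; move: Bs.
  by rewrite (dis B B' x) ?hB' // inE ?eqxx ?hB' ?orbT.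
transitivity (m (bset B) + m (bunion s))%E.
  by apply: measureU => //; [exact: measurable_bset|exact: measurable_bunion].
rewrite measure_bset; last by apply: h; rewrite mem_head.
congr (_ + _)%E; apply: IHs => //.
  by move=> B' hB'; apply: h; rewrite inE hB' orbT.
by move=> B1 B2 x h1 h2; apply: dis; rewrite inE ?h1 ?h2 orbT.
Qed.

Lemma area_measurable D : measurable D -> area D = m D.
Proof. by move=> mD; rewrite /area measurable_mu_extE. Qed.

Lemma area_le D D' : D `<=` D' -> (area D <= area D')%E.
Proof. exact: le_mu_ext. Qed.

(** [area] is an outer measure, monotone on all sets: D is squeezed between finite unions of boxes,
    and only these have to be measurable. *)
Lemma has_content_area D v : has_content D v -> area D = v%:E.
Proof.
move=> h; apply/eqP; rewrite eq_le; apply/andP; split.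
  apply/lee_addgt0Pr => eps eps0; have [_ [t [pt ct lt]]] := h _ eps0.
  apply: le_trans (@area_le D (bunion t) _) _; first by move=> x /ct.
  rewrite area_measurable; last exact: measurable_bunion.
  by apply: le_trans (measure_bunion_le pt) _; rewrite -EFinD lee_fin.
apply/lee_subgt0Pr => eps eps0; have [[s [us sD ds ls]] _] := h _ eps0.
apply: le_trans (@area_le (bunion s) D _); last first.
  by move=> x [B hB]; exact: (sD _ hB).2.
rewrite area_measurable; last exact: measurable_bunion.
rewrite measure_bunion //.
by move=> B /sD[].
Qed.

Definition cell (k : nat) (i j : int) : (R * R) * (R * R) :=
  ((i%:~R / 2 ^+ k, (i + 1)%:~R / 2 ^+ k), (j%:~R / 2 ^+ k, (j + 1)%:~R / 2 ^+ k)).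

Lemma inI_cell k (i : int) (x : R) :
  inI x (i%:~R / 2 ^+ k, (i + 1)%:~R / 2 ^+ k) = (Num.floor (x * 2 ^+ k) == i).
Proof.
have p0 : 0 < 2 ^+ k :> R by rewrite exprn_gt0.
by rewrite /inI /= ler_pdivrMr // ltr_pdivlMr // floor_eq.
Qed.

Lemma inB_cell k i j x : inB x (cell k i j) =
  (Num.floor (x.1 * 2 ^+ k) == i) && (Num.floor (x.2 * 2 ^+ k) == j).
Proof. by rewrite /inB !inI_cell. Qed.

Lemma proper_cell k i j : proper (cell k i j).
Proof.
have p0 : 0 < (2 ^+ k)^-1 :> R by rewrite invr_gt0 exprn_gt0.
by apply/andP; rewrite /= !ler_pM2r // !ler_int; split; lia.
Qed.

Lemma cell_inj k i j i' j' : cell k i j = cell k i' j' -> i = i' /\ j = j'.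
Proof.
have p0 : (2 ^+ k)^-1 != 0 :> R by rewrite invr_eq0 expf_neq0.
by case=> /(mulIf p0)/intr_inj -> _ /(mulIf p0)/intr_inj -> _.
Qed.

(** Dyadic nesting: the floor of 2^k c is determined by the floor of 2^(k+1) c, so each cell lies in
    a single cell of the next coarser mesh. *)
Lemma cell_parent k i j x y : inB x (cell k.+1 i j) -> inB y (cell k.+1 i j) ->
  forall i' j', inB x (cell k i' j') -> inB y (cell k i' j').
Proof.
have half (a b : R) (n : int) : Num.floor (a * 2 ^+ k.+1) = n ->
    Num.floor (b * 2 ^+ k.+1) = n -> Num.floor (a * 2 ^+ k) = Num.floor (b * 2 ^+ k).
  have key (c : R) : Num.floor (c * 2 ^+ k.+1) = n -> Num.floor (c * 2 ^+ k) = (n %/ 2)%Z.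
    move/eqP; rewrite floor_eq exprSr mulrA => /andP[h1 h2].
    apply/eqP; rewrite floor_eq; set z := c * 2 ^+ k in h1 h2 *.
    have h3 : (n %/ 2)%Z * 2 <= n /\ n + 1 <= ((n %/ 2)%Z + 1) * 2 by lia.
    have h4 : (n %/ 2)%Z%:~R * 2 <= n%:~R :> R.
      by rewrite -(rmorph_nat intr) -rmorphM ler_int h3.1.
    have h5 : (n + 1)%:~R <= ((n %/ 2)%Z + 1)%:~R * 2 :> R.
      by rewrite -(rmorph_nat intr) -rmorphM ler_int h3.2.
    by apply/andP; split; lra.
  by move=> ha hb; rewrite (key _ ha) (key _ hb).
rewrite !inB_cell => /andP[/eqP x1 /eqP x2] /andP[/eqP y1 /eqP y2] i' j'.
by rewrite inB_cell inB_cell (half _ _ _ x1 y1) (half _ _ _ x2 y2).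
Qed.

Lemma cell_close k i j x y : inB x (cell k i j) -> inB y (cell k i j) ->
  `|x.1 - y.1| <= (2 ^+ k)^-1 /\ `|x.2 - y.2| <= (2 ^+ k)^-1.
Proof.
rewrite /inB /inI /= !rmorphD /= !mulrDl !mul1r.
move=> /andP[/andP[h1 h2] /andP[h3 h4]] /andP[/andP[h5 h6] /andP[h7 h8]].
move: h1 h2 h3 h4 h5 h6 h7 h8.
set u := (2 ^+ k)^-1; set a := i%:~R * _; set b := j%:~R * _.
by clear => *; rewrite !ler_norml; split; apply/andP; split; lra.
Qed.


Lemma inB_cell_self k x :
  inB x (cell k (Num.floor (x.1 * 2 ^+ k)) (Num.floor (x.2 * 2 ^+ k))).
Proof. by rewrite inB_cell !eqxx. Qed.

Definition grid (N k : nat) : seq ((R * R) * (R * R)) :=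
  let r := [seq n%:Z - (N * 2 ^ k)%:Z | n <- iota 0 (2 * (N * 2 ^ k))] in
  [seq cell k i j | i <- r, j <- r].

Lemma grid_uniq N k : uniq (grid N k).
Proof.
have u : uniq [seq n%:Z - (N * 2 ^ k)%:Z | n <- iota 0 (2 * (N * 2 ^ k))].
  by rewrite map_inj_uniq ?iota_uniq // => a b; lia.
by apply: allpairs_uniq => // -[i j] [i' j'] _ _ /= /cell_inj[-> ->].
Qed.

Lemma gridP N k B : B \in grid N k -> exists i j, B = cell k i j.
Proof. by move=> /allpairsP[[i j] [_ _ ->]]; exists i, j. Qed.

Lemma mem_grid (N k : nat) i j x : `|x.1| < N%:R -> `|x.2| < N%:R ->
  inB x (cell k i j) -> cell k i j \in grid N k.
Proof.
have p0 : 0 < 2 ^+ k :> R by rewrite exprn_gt0.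
have mem (a : R) (n : int) : `|a| < N%:R -> Num.floor (a * 2 ^+ k) = n ->
    n \in [seq n%:Z - (N * 2 ^ k)%:Z | n <- iota 0 (2 * (N * 2 ^ k))].
  rewrite ltr_norml => /andP[a1 a2] /eqP; rewrite floor_eq => /andP[h1 h2].
  have P : ((N * 2 ^ k)%N%:Z)%:~R = N%:R * 2 ^+ k :> R.
    by rewrite -pmulrn natrM natrX.
  have l1 : n < (N * 2 ^ k)%N%:Z.
    by rewrite -(ltr_int R) P; apply: le_lt_trans h1 _; rewrite ltr_pM2r.
  have l2 : - (N * 2 ^ k)%N%:Z < n + 1.
    rewrite -(ltr_int R) rmorphN /= P; apply: lt_trans h2.
    by rewrite -mulNr ltr_pM2r.
  move: l1 l2; set L := (N * 2 ^ k)%N => l1 l2.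
  apply/mapP; exists (absz (n + L%:Z)); last by lia.
  by rewrite mem_iota; lia.
move=> x1 x2; rewrite inB_cell => /andP[/eqP e1 /eqP e2].
by apply/allpairsP; exists (i, j); split; [exact: mem x1 e1|exact: mem x2 e2|].
Qed.

Definition inner D B := `[< bset B `<=` D >].

Definition meets D B := `[< exists2 x, D x & inB x B >].

Definition cells_boundary D N k := [seq B <- grid N k | meets D B && ~~ inner D B].

Lemma cells_disjoint N k B B' x : B \in grid N k -> B' \in grid N k ->
  inB x B -> inB x B' -> B = B'.
Proof.
move=> /gridP[i [j ->]] /gridP[i' [j' ->]]; rewrite !inB_cell.
by move=> /andP[/eqP <- /eqP <-] /andP[/eqP <- /eqP <-].
Qed.

Lemma grid_proper N k B : B \in grid N k -> proper B.
Proof. by move=> /gridP[i [j ->]]; exact: proper_cell. Qed.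

Lemma cells_boundaryP D (N k : nat) x : (forall y, D y -> `|y.1| < N%:R /\ `|y.2| < N%:R) ->
  bunion (cells_boundary D N k) x <-> exists i j y z,
    [/\ inB x (cell k i j), inB y (cell k i j), D y, inB z (cell k i j) & ~ D z].
Proof.
move=> DN; split.
  move=> [B]; rewrite mem_filter => /andP[/andP[/asboolP[y Dy yB] /asboolPn hB]].
  move=> /gridP[i [j BE]] xB; rewrite BE in yB xB hB.
  have [z [hz nz]] : exists z, inB z (cell k i j) /\ ~ D z.
    by apply: contrapT => h; apply: hB => z hz; apply: contrapT => nz; apply: h; exists z.
  by exists i, j, y, z.
move=> [i [j [y [z [xB yB Dy zB nDz]]]]]; exists (cell k i j) => //.
have [y1 y2] := DN _ Dy.
rewrite mem_filter (mem_grid y1 y2 yB) andbT; apply/andP; split.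
  by apply/asboolP; exists y.
by apply/asboolPn => h; apply: nDz; apply: h.
Qed.

(* The cells of mesh 2^-k meeting both D and its complement decrease with k,
   and their intersection lies in the boundary of D. *)
Lemma cells_boundary_small D (N : nat) eps :
  (forall y, D y -> `|y.1| < N%:R /\ `|y.2| < N%:R) ->
  area (boundary D) = 0%E -> 0 < eps ->
  exists k, \sum_(B <- cells_boundary D N k) barea B <= eps.
Proof.
move=> DN bD eps0; pose F k := bunion (cells_boundary D N k).
have FE k : m (F k) = (\sum_(B <- cells_boundary D N k) barea B)%:E.
  rewrite measure_bunion //.
  - by move=> B; rewrite mem_filter => /andP[_ /grid_proper].
  - by rewrite filter_uniq // grid_uniq.
  - move=> B B' x; rewrite !mem_filter => /andP[_ h] /andP[_ h'].
    exact: cells_disjoint h h'.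
have mF k : measurable (F k) by exact: measurable_bunion.
have mI : measurable (\bigcap_k F k) by exact: bigcap_measurable.
have dec k : F k.+1 `<=` F k.
  move=> x /(cells_boundaryP _ _ DN)[i [j [y [z [xB yB Dy zB nDz]]]]].
  apply/(cells_boundaryP _ _ DN).
  exists (Num.floor (x.1 * 2 ^+ k)), (Num.floor (x.2 * 2 ^+ k)), y, z.
  have xs := inB_cell_self k x; split=> //.
    exact: cell_parent xB yB _ _ xs.
  exact: cell_parent xB zB _ _ xs.
have cap : \bigcap_k F k `<=` boundary D.
  move=> x hx.
  have near_x (U : set (R * R)) : nbhs x U -> exists y z, [/\ U y, D y, U z & ~ D z].
    move=> /nbhs_ballP[e /= e0 he].
    have [k hk] : exists k, (2 ^+ k)^-1 < e.
      have [k hk] : exists k : nat, e^-1 < k%:R.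
        by exists (Num.truncn e^-1).+1; exact: truncnS_gt.
      exists k; rewrite -[e]invrK ltf_pV2 ?posrE ?exprn_gt0 ?invr_gt0 //.
      by apply: lt_le_trans hk _; rewrite -natrX ler_nat ltnW // ltn_expl.
    have /(cells_boundaryP _ _ DN)[i [j [y [z [xB yB Dy zB nDz]]]]] := hx k I.
    exists y, z; split=> //; apply: he; split; apply: le_lt_trans hk.
    + exact: (cell_close xB yB).1.
    + exact: (cell_close xB yB).2.
    + exact: (cell_close xB zB).1.
    + exact: (cell_close xB zB).2.
  split.
    by move=> U /near_x[y [z [Uy Dy _ _]]]; exists y.
  by move=> /near_x[y [z [_ _ Dz nDz]]].
have z0 : m (\bigcap_k F k) = 0%E.
  apply/eqP; rewrite eq_le measure_ge0 andbT -area_measurable // -bD.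
  exact: area_le.
have lim : (m \o F) k @[k --> \oo] --> 0%E.
  rewrite -z0; apply: nonincreasing_cvg_mu => //.
    by change (m (F 0%N) < +oo)%E; rewrite FE ltry.
  by apply/nonincreasing_seqP => k; apply/subsetPset; exact: dec.
have /fine_cvgP[_ /cvgrPdist_le /(_ _ eps0)[k _ hk]] := lim.
exists k; have := hk k (leqnn k).
rewrite sub0r normrN /=; change (`|fine (m (F k))| <= eps -> 
  \sum_(B <- cells_boundary D N k) barea B <= eps).
by rewrite FE /= => h; apply: le_trans h; exact: ler_norm.
Qed.

Lemma bounded_in_square D : bounded_set D -> exists2 C, 0 < C & in_square C D.
Proof.
move=> [M [_ hM]]; pose C := Num.max 1 (M + 1).
exists C; first by rewrite lt_max ltr01.
move=> x Dx; have : `|x| <= C.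
  by apply: (hM C) => //; rewrite /C lt_max ltrDl ltr01 orbT.
by rewrite prod_normE ge_max => /andP.
Qed.

(** Cells inside D pack it and cells meeting D cover it; the families differ by the cells straddling
    the boundary, whose total area becomes arbitrarily small. *)
Lemma jordan_has_content D : jordan_measurable D ->
  (exists2 C, 0 < C & in_square C D) /\
  exists d, area D = d%:E /\ has_content D d.
Proof.
move=> [bdD bD].
have [C C0 hC] := bounded_in_square bdD.
split; first by exists C.
pose N := (Num.truncn C).+1.
have DN x : D x -> `|x.1| < N%:R /\ `|x.2| < N%:R.
  have CN : C < N%:R by exact: truncnS_gt.
  by move=> /hC[h1 h2]; split; [exact: le_lt_trans h1 _|exact: le_lt_trans h2 _].
(* With both conjuncts, t k splits exactly into s k and the boundary cells. *)
pose s k := [seq B <- grid N k | inner D B && meets D B].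
pose t k := [seq B <- grid N k | meets D B].
have sP k B : B \in s k -> proper B /\ [set x | inB x B] `<=` D.
  by rewrite mem_filter => /andP[/andP[/asboolP h _] /grid_proper].
have sd k B B' x : B \in s k -> B' \in s k -> inB x B -> inB x B' -> B = B'.
  rewrite !mem_filter => /andP[_ h] /andP[_ h']; exact: cells_disjoint h h'.
have su k : uniq (s k) by rewrite filter_uniq // grid_uniq.
have tP k B : B \in t k -> proper B by rewrite mem_filter => /andP[_ /grid_proper].
have tc k x : D x -> exists2 B, B \in t k & inB x B.
  move=> Dx; exists (cell k (Num.floor (x.1 * 2 ^+ k)) (Num.floor (x.2 * 2 ^+ k))).
    have xs := inB_cell_self k x; have [x1 x2] := DN _ Dx.
    rewrite mem_filter (mem_grid x1 x2 xs) andbT.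
    by apply/asboolP; exists x.
  exact: inB_cell_self.
have st k : \sum_(B <- t k) barea B =
    \sum_(B <- s k) barea B + \sum_(B <- cells_boundary D N k) barea B.
  rewrite !big_filter (bigID (inner D)) /=; congr (_ + _).
  by apply: eq_bigl => B; rewrite andbC.
have low k : ((\sum_(B <- s k) barea B)%:E <= area D)%E.
  rewrite -measure_bunion; [|by move=> B /sP[]|exact: su|exact: sd].
  rewrite -area_measurable; last exact: measurable_bunion.
  by apply: area_le => x [B /sP[_ h] xB]; exact: h.
have up k : (area D <= (\sum_(B <- t k) barea B)%:E)%E.
  apply: le_trans (measure_bunion_le (@tP k)).
  rewrite -area_measurable; last exact: measurable_bunion.
  by apply: area_le => x /(tc k).
have fin : area D \is a fin_num.
  rewrite fin_numE; apply/andP; split.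
    by apply/eqP => e; have := low 0%N; rewrite e.
  by apply/eqP => e; have := up 0%N; rewrite e.
exists (fine (area D)); split; first by rewrite fineK.
move=> eps eps0; have [k hk] := cells_boundary_small DN bD eps0.
have := low k; have := up k; rewrite -(fineK fin) !lee_fin st => u l.
split.
  exists (s k); split; [exact: su|exact: sP|exact: sd|].
  by rewrite lerBlDr; apply: le_trans u _; rewrite lerD2l.
exists (t k); split; [exact: tP|exact: tc|].
by rewrite st; apply: lerD.
Qed.

End jordan.

(** * From counts to densities *)

Section density.
Variable R : realType.
Local Notation Z := (dedekind_zeta (Qsqrt2 R) 2).
Implicit Types (P D : set (R * R)) (c r : R).

Lemma dilateE c D : c != 0 -> dilate c D = [set x | D (scal c^-1 x)].
Proof.
move=> c0; apply/seteqP; split=> [_ [x Dx <-]|x Dx] /=.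
  by rewrite -[(c * _, _)]/(scal c x) scalK.
exists (scal c^-1 x) => //; rewrite -[(_, _)]/(scal c (scal c^-1 x)).
by rewrite scalA divff // scal1.
Qed.

Lemma visible_dilate c P : c != 0 -> visible (dilate c P) = dilate c (visible P).
Proof.
move=> c0; have comm t x : scal c^-1 (scal t x) = scal t (scal c^-1 x).
  by rewrite !scalA mulrC.
rewrite !dilateE //; apply/seteqP; split=> x [Px hx]; split=> // t t01 h;
  apply: (hx t t01).
  by change (P (scal c^-1 (scal t x))); rewrite comm.
by change (P (scal t (scal c^-1 x))); rewrite -comm.
Qed.

Lemma visible_Pset D r : r != 0 ->
  visible (ammann_beenker' R) `&` dilate r D = Pset D r 1.
Proof.
move=> r0; rewrite visible_ammann_beenker' dilateE //.
apply/seteqP; split=> x; rewrite /Pset /annulus /= mul1r.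
  by move=> [[h1 h2 h3] h4].
by move=> [h1 h2 [h3 h4]].
Qed.

Lemma visible_locally_finite : locally_finite (visible (ammann_beenker' R)).
Proof.
move=> B /bounded_in_square[C C0 hC].
(* Local finiteness is the case r = 1 of the finiteness of [Pset]. *)
have e : dilate 1 B = B.
  by rewrite dilateE ?oner_neq0 // invr1; apply/seteqP; split=> x /=; rewrite scal1.
rewrite -[in X in finite_set X]e visible_Pset ?oner_neq0 //.
exact: Pset_finite hC C0 ltr01 ltr01.
Qed.

Lemma locally_finite_dilate c P : 0 < c -> locally_finite P ->
  locally_finite (dilate c P).
Proof.
move=> c0 lP B /bounded_in_square[C C0 hC].
pose B' := [set x | B (scal c x)].
have bB' : bounded_set B'.
  exists (C / c); split; first exact: num_real.
  move=> M hM x /= /hC[]; rewrite /= !normrM (gtr0_norm c0) => h1 h2.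
  rewrite prod_normE ge_max; rewrite ltr_pdivrMr // in hM.
  apply/andP; split; rewrite -(ler_pM2l c0); lra.
apply: sub_finite_set (finite_image (scal c) (lP _ bB')).
by move=> _ [[x Px <-] hB]; exists x.
Qed.

Lemma area_dilate D d r : has_content D d -> 0 < r ->
  area (dilate r D) = (r ^+ 2 * d)%:E.
Proof.
move=> hD r0; apply: has_content_area; rewrite dilateE ?gt_eqF //.
exact: has_content_scale.
Qed.

Lemma Pset_density D d : has_content D d -> (exists C, in_square C D /\ 0 < C) ->
  0 < d -> (cnt (Pset D r 1))%:R / (r ^+ 2 * d) @[r --> +oo] --> 1 / (2 * Z).
Proof.
move=> hD sq d0; have [Zub Zlim] := dedekind_zetaP R.
have Z1 : 1 <= Z by apply: le_trans (Zub 2); rewrite lerDl zeta_part_ge0.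
have lim := Pset_cvg hD sq Zub Zlim.
have -> : 1 / (2 * Z) = d / (2 * Z) * d^-1 by field; rewrite !gt_eqF //; lra.
under eq_fun do rewrite invfM mulrA.
by apply: cvgM => //; exact: cvg_cst.
Qed.

Lemma cvg_pinfty_scale (f : R -> R) (l : R) c : 0 < c ->
  f r @[r --> +oo] --> l -> f (r * c) @[r --> +oo] --> l.
Proof.
move=> c0 fl; apply: (cvg_comp (fun r => r * c) f _ fl).
apply/cvgryPge => A; apply: filterS (nbhs_pinfty_ge (num_real (A / c))) => r.
by rewrite ler_pdivrMr.
Qed.

End density.

Theorem theorem4p9 (R : realType) :
  has_density (visible (ammann_beenker' R))
    (1 / (2 * dedekind_zeta (Qsqrt2 R) 2)) /\
  has_density (visible (ammann_beenker R))
    (1 / dedekind_zeta (Qsqrt2 R) 2).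
Proof.
have s0 := sqrt2_gt0 R; have sn0 := sqrt2_neq0 R; have ss := sqrt2_sqr R.
have siv0 : 0 < (sqrt2 R)^-1 by rewrite invr_gt0.
have main D d : has_content D d -> area D = d%:E -> (0 < area D)%E ->
    (exists C, in_square C D /\ 0 < C) ->
    (cnt (Pset D r 1))%:R / (r ^+ 2 * d) @[r --> +oo] -->
      1 / (2 * dedekind_zeta (Qsqrt2 R) 2).
  by move=> hD -> ; rewrite lte_fin => d0 sq; exact: Pset_density.
split; split.
- exact: visible_locally_finite.
- move=> D /jordan_has_content[[C C0 hC] [d [ad hD]]] aD.
  apply: (cvg_trans _ (main D d hD ad aD (ex_intro _ C (conj hC C0)))).
  apply: near_eq_cvg; apply: filterS (nbhs_pinfty_gt (num_real (0 : R))) => r r0.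
  by rewrite visible_Pset ?gt_eqF // (area_dilate hD r0).
- rewrite visible_dilate ?invr_eq0 //.
  exact: locally_finite_dilate siv0 (@visible_locally_finite R).
- move=> D /jordan_has_content[[C C0 hC] [d [ad hD]]] aD.
  (* A point of A in r D is 1 / sqrt2 times a point of A' in (r sqrt2) D, while the area taken is
     that of r D: the density gains the factor sqrt2^2 = 2. *)
  have lim := cvg_pinfty_scale s0 (main D d hD ad aD (ex_intro _ C (conj hC C0))).
  have -> : 1 / dedekind_zeta (Qsqrt2 R) 2 = 1 / (2 * dedekind_zeta (Qsqrt2 R) 2) * 2.
    by rewrite !mul1r invfM mulrAC mulVf ?mul1r.
  have := cvgM lim (cvg_cst (2 : R)) => /(_ _) h.
  apply: (cvg_trans _ (h _)); apply: near_eq_cvg.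
  apply: filterS (nbhs_pinfty_gt (num_real (0 : R))) => r r0.
  rewrite visible_dilate ?invr_eq0 // (area_dilate hD r0) /=.
  have rs0 : 0 < r * sqrt2 R by rewrite mulr_gt0.
  have -> : dilate (sqrt2 R)^-1 (visible (ammann_beenker' R)) `&` dilate r D =
      [set scal (sqrt2 R)^-1 x | x in Pset D (r * sqrt2 R) 1].
    rewrite -visible_Pset ?gt_eqF // !dilateE ?gt_eqF // invrK.
    apply/seteqP; split=> [x [h1 h2]|_ [x [h1 h2] <-]].
      exists (scal (sqrt2 R) x); last by rewrite scalK.
      by split=> //=; rewrite scalA invfM -mulrA mulVf // mulr1.
    split; rewrite /= scalA ?divff ?scal1 //.
    by move: h2; rewrite /= invfM.
  rewrite -/(cnt _) cnt_image; last 2 first.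
  + exact: Pset_finite hC C0 rs0 ltr01.
  + by move=> x y _ _ /(congr1 (scal (sqrt2 R))); rewrite !scalA divff // !scal1.
  have d0 : 0 < d by move: aD; rewrite ad lte_fin.
  rewrite exprMn [sqrt2 R ^+ 2]expr2 ss.
  by field; rewrite !gt_eqF.
Qed.
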